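(* Let $(X_j)_{j\ge0}$ be a stationary, long-range dependent standard Gaussian process (centered, unit variance) with autocovariance function $r(k)=\operatorname{Cov}(X_0,X_k)=L(k)k^{-D}$, $k\ge1$, where $0<D<1$ and $L$ is slowly varying at infinity. Let $p\in\mathbb{N}$ and let $f:\mathbb{R}^p\to\mathbb{R}$ be a function with Hermite rank $1$ (with respect to the distribution of $(X_1,\ldots,X_p)$) satisfying $E(f(X_1,\ldots,X_p))^2<\infty$. Then, as $n\to\infty$, \[ \frac{1}{n^{1-D/2}L^{1/2}(n)}\sum_{i=1}^n\bigl(f(X_i,\ldots,X_{i+p-1})-E f(X_1,\ldots,X_p)\bigr)\longrightarrow\mathcal N\Bigl(0,\,c_D\Bigl(\sum_{j=1}^p\alpha_j\Bigr)^2\Bigr) \] in distribution, where $c_D=\frac{2}{(1-D)(2-D)}$ and $\alpha=(\alpha_1,\ldots,\alpha_p)^t=\Sigma_p^{-1}c$, with $\Sigma_p$ the covariance matrix of $(X_1,\ldots,X_p)$ and $c=(c_1,\ldots,c_p)^t$, $c_k=E(f(X_1,\ldots,X_p)X_k)$, $1\le k\le p$.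
   Context: Hermite rank: let $H_k(x)=(-1)^ke^{x^2/2}\frac{d^k}{dx^k}e^{-x^2/2}$ and $H_{l_1,\ldots,l_p}(x)=\prod_{i=1}^pH_{l_i}(x_i)$. For $G:\mathbb{R}^p\to\mathbb{R}$ square-integrable with respect to the standard normal law $\mathcal N(0,E_p)$ ($E_p$ the identity matrix) and $U\sim\mathcal N(0,E_p)$, the Hermite rank is $m(G,E_p):=\min\{l_1+\cdots+l_p\ge1:E(G(U)H_{l_1,\ldots,l_p}(U))\ne0\}$. For a positive definite covariance matrix $\Sigma=AA^t$ ($A$ a square matrix) and $G$ square-integrable with respect to $\mathcal N(0,\Sigma)$, the Hermite rank of $G$ with respect to $\mathcal N(0,\Sigma)$ is $m(G,\Sigma)=m(G\circ A,E_p)$; it does not depend on the choice of $A$. $\mathcal N(0,0)$ is understood as the Dirac measure at $0$. *)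

(* Defs.v *)
From HB Require Import structures.
From mathcomp Require Import all_boot all_order all_algebra.
From mathcomp Require Import all_classical all_reals all_analysis.

Set Implicit Arguments.
Unset Strict Implicit.
Unset Printing Implicit Defensive.

Import Order.TTheory GRing.Theory Num.Theory.
Import numFieldNormedType.Exports.

Local Open Scope classical_set_scope.
Local Open Scope ring_scope.

(* [normal_prob] is a measure on [measurableTypeR R], whose display differs
   from that of the canonical Borel structure on R carried by {RV P >-> R};
   pushing forward along the identity bridges the two. *)
Definition to_canonicalR (R : realType) (x : measurableTypeR R) : R := x.

HB.instance Definition _ (R : realType) :=
  isMeasurableFun.Build _ _ _ _ (@to_canonicalR R) (@measurable_id _ _ setT).

Definition normal_law (R : realType) (m s : R) : probability R R :=
  distribution (normal_prob m s) (@to_canonicalR R).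

(* N(m, v) with v the variance. The case v = 0 is separate because the
   library's [normal_prob m 0] is a uniform law, not the Dirac measure. *)
Definition gaussian_law (R : realType) (m v : R) : probability R R :=
  if v == 0 then (\d_m : probability R R) else normal_law m (Num.sqrt v).

Definition pair_cons (R : realType) (n : nat) (x : R * n.-tuple R) :
  n.+1.-tuple R := [tuple of x.1 :: x.2].

Lemma measurable_pair_cons (R : realType) (n : nat) :
  measurable_fun [set: R * n.-tuple R] (@pair_cons R n).
Proof. exact: measurable_cons. Qed.

HB.instance Definition _ (R : realType) (n : nat) :=
  isMeasurableFun.Build _ _ _ _ (@pair_cons R n) (@measurable_pair_cons R n).

(* N(0, E_n) on R^n, as the n-fold product of N(0, 1). *)
Fixpoint std_gaussian (R : realType) (n : nat) : probability (n.-tuple R) R :=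
  match n with
  | 0 => (\d_[tuple] : probability (0.-tuple R) R)
  | k.+1 => distribution (normal_law 0 1 \x std_gaussian R k)%E (@pair_cons R k)
  end.

Definition hermite (R : realType) (k : nat) (x : R) : R :=
  (-1) ^+ k * expR (x ^+ 2 / 2) * derive1n k (fun y : R => expR (- (y ^+ 2 / 2))) x.

Definition multi_hermite (R : realType) (p : nat) (l : 'I_p -> nat)
  (u : p.-tuple R) : R := \prod_(i < p) hermite (l i) (tnth u i).

(* The l_1 + ... + l_p >= 1 with E(G(U) H_l(U)) != 0, for U ~ N(0, E_p). *)
Definition hermite_degrees (R : realType) (p : nat) (G : p.-tuple R -> R) :
  set nat :=
  [set q | exists l : 'I_p -> nat, [/\ q = (\sum_(i < p) l i)%N, (1 <= q)%N &
     'E_(std_gaussian R p)[fun u => (G u * multi_hermite l u)%R]%E <> 0%E]].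

(* m(G, E_p) = m; no such m exists when G is a.s. constant. *)
Definition hermite_rank_std (R : realType) (p : nat) (G : p.-tuple R -> R)
  (m : nat) : Prop :=
  hermite_degrees G m /\ forall q, hermite_degrees G q -> (m <= q)%N.

Definition tuple_mulmx (R : realType) (p : nat) (A : 'M[R]_p)
  (u : p.-tuple R) : p.-tuple R :=
  [tuple \sum_(j < p) A i j * tnth u j | i < p].

(* m(G, Sigma) = m. Since m(G \o A, E_p) does not depend on the choice of A,
   it is enough to ask for some A. *)
Definition hermite_rank (R : realType) (p : nat) (Sigma : 'M[R]_p)
  (G : p.-tuple R -> R) (m : nat) : Prop :=
  exists2 A : 'M[R]_p, Sigma = A *m A^T & hermite_rank_std (G \o tuple_mulmx A) m.

Definition slowly_varying (R : realType) (L : R -> R) : Prop :=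
  (exists a : R, measurable_fun `[a, +oo[ L /\ forall x, a <= x -> 0 < L x) /\
  forall lambda : R, 0 < lambda -> L (lambda * x) / L x @[x --> +oo%R] --> (1 : R).

Section Process.
Context d (T : measurableType d) (R : realType) (P : probability T R).
Implicit Type X : nat -> {RV P >-> R}.

(* (X_i, ..., X_(i+m-1)) *)
Definition window X (i m : nat) (w : T) : m.-tuple R :=
  [tuple X (i + j)%N w | j < m].

Definition stationary X : Prop :=
  forall (h m : nat) (B : set (m.-tuple R)), measurable B ->
    P (window X h m @^-1` B) = P (window X 0 m @^-1` B).

(* Every finite linear combination is normally distributed, possibly
   degenerate. *)
Definition gaussian_process X : Prop :=
  forall (m : nat) (a : 'I_m -> R), exists mu v : R, 0 <= v /\
    forall B : set R, measurable B ->
      P ((fun w => \sum_(i < m) a i * X i w) @^-1` B) = gaussian_law mu v B.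

Definition standardized X : Prop :=
  forall j, 'E_P[X j]%E = 0%E /\ 'V_P[X j]%E = 1%E.

Definition autocov X (k : nat) : R := fine (covariance P (X 0%N) (X k)).

(* The covariance matrix of (X_1, ..., X_p); the index i : 'I_p is that of
   X_(i+1). *)
Definition cov_matrix X (p : nat) : 'M[R]_p :=
  \matrix_(i < p, j < p) fine (covariance P (X i.+1) (X j.+1)).

(* c_k = E(f(X_1, ..., X_p) X_k) *)
Definition cross_moments X (p : nat) (f : p.-tuple R -> R) : 'cV[R]_p :=
  \col_(k < p) fine 'E_P[fun w => (f (window X 1 p w) * X k.+1 w)%R]%E.

Definition cvg_in_law (Y : nat -> T -> R) (mu : probability R R) : Prop :=
  forall g : R -> R, continuous g -> bounded_fun g ->
    'E_P[g \o Y n]%E @[n --> \oo] --> (\int[mu]_x (g x)%:E)%E.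

End Process.

(* Main.v *)
(* Subtract from f(X_i, ..., X_(i+p-1)) its mean and its linear part
   sum_j alpha_j X_(i+j), and call Y_i the difference. Up to a term bounded in
   L^2 the linear parts add up to (sum_j alpha_j) S_n with S_n = X_1 + ... + X_n,
   a Gaussian variable whose variance is equivalent to c_D n^(2-D) L(n) by
   Karamata's theorem. It remains to see that the Y_i are negligible.

   Y_i is orthogonal to 1 and to its window, so the covariance of Y_i and Y_(i+k)
   is quadratic in the correlations at lags close to k; hence the variance of
   Y_1 + ... + Y_n is O(n sum_(k <= n) r(k)^2) = o(n^(2-D) L(n)), because r -> 0.
   The quadratic bound needs no Hermite expansion. For standard Gaussian vectors
   U, V with cross-covariance M, the functions
   k_s(U) = exp(|s|^2/2) (cos (s.U) + sin (s.U)) span a dense subspace of L^2 and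
   satisfy E(k_s(U) k_t(V)) = exp(s.M t); the terms of degree at least 2 of this
   exponential series are bounded on finite combinations by those of exp(s.s')
   and exp(t.t'), and the bound passes to the closure. *)

Require Import Defs.
From HB Require Import structures.
From mathcomp Require Import all_boot all_order all_algebra.
From mathcomp Require Import all_classical all_reals all_analysis.
From mathcomp Require Import measurable_realfun zify ring lra.

Set Implicit Arguments.
Unset Strict Implicit.
Unset Printing Implicit Defensive.

Import Order.TTheory GRing.Theory Num.Theory.
Import numFieldNormedType.Exports.

Local Open Scope classical_set_scope.
Local Open Scope ring_scope.

(** Forming alpha requires Sigma_p to be invertible. This follows from r -> 0: by stationarity a
    null combination of consecutive variables stays null under shifts, and would produce null
    combinations of variables so widely spaced that they are almost orthonormal. Density in L^2 is a
    monotone class argument. The bounded elements of the closure of an algebra are stable under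
    products and bounded limits, so the events whose indicator lies in the closure form a
    sigma-algebra; the coordinates are measurable for it, being limits of n sin (x / n). The
    comparison of exponential series requires the entries of M to be small; where they are not, the
    Cauchy-Schwarz inequality already gives the quadratic bound. Karamata's theorem is proved by
    halving. Passing from n/2 to n involves only indices k with L(k) / L(n) uniformly close to 1,
    and the normalised sums satisfy s_n = q_n s_(n/2) + b_n with lim q_n < 1, a contraction whose
    fixed point is the limit. The same recursion gives the decay of n^(-a) L(n) for a > 0. *)

Lemma cvg_sum_seq (R : realType) I (r : seq I) (Q : pred I) (f : I -> nat -> R)
    (l : I -> R) : (forall i, Q i -> f i n @[n --> \oo] --> l i) ->
  \sum_(i <- r | Q i) f i n @[n --> \oo] --> \sum_(i <- r | Q i) l i.
Proof.
move=> fl; elim: r => [|i r IH].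
  by rewrite big_nil; under eq_fun do rewrite big_nil; exact: cvg_cst.
rewrite big_cons; under eq_fun do rewrite big_cons.
by case: ifP => // Qi; apply: cvgD => //; exact: fl.
Qed.

Lemma le_cvg_seq (R : realType) (f g : nat -> R) (l l' : R) :
  f n @[n --> \oo] --> l -> g n @[n --> \oo] --> l' -> (forall n, f n <= g n) -> l <= l'.
Proof. by move=> fl gl' fg; apply: ler_cvg_to fl gl' _; exact: nearW. Qed.

(** * Square-integrable random variables *)

Section SquareIntegrable.
Context d (T : measurableType d) (R : realType) (P : probability T R).
Implicit Types Y Z V : T -> R.

Definition sqint Y : Prop :=
  measurable_fun setT Y /\ P.-integrable setT (EFin \o (fun w => Y w ^+ 2)).

Definition dotp Y Z : R := \int[P]_w (Y w * Z w).

Lemma sqintM_integrable Y Z : sqint Y -> sqint Z ->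
  P.-integrable setT (EFin \o (fun w => Y w * Z w)).
Proof.
move=> [mY iY] [mZ iZ].
apply: (@le_integrable _ _ _ P setT measurableT _
    (fun w => ((Y w ^+ 2)%:E + (Z w ^+ 2)%:E)%E)).
- by apply/measurable_EFinP; exact: measurable_funM.
- move=> w _ /=; rewrite lee_fin normrM [leRHS]ger0_norm; last first.
    by rewrite addr_ge0 ?sqr_ge0.
  rewrite -(real_normK (num_real (Y w))) -(real_normK (num_real (Z w))).
  have := sqr_ge0 (`|Y w| - `|Z w|).
  have := mulr_ge0 (normr_ge0 (Y w)) (normr_ge0 (Z w)).
  by nra.
- exact: integrableD.
Qed.

Lemma bounded_sqint Y (M : R) : measurable_fun setT Y -> (forall w, `|Y w| <= M) ->
  sqint Y.
Proof.
move=> mY Yb; split=> //.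
apply: (@le_integrable _ _ _ P setT measurableT _ (EFin \o cst (M ^+ 2))).
- by apply/measurable_EFinP; exact: measurable_funX.
- move=> w _ /=; rewrite lee_fin normrX [leRHS]ger0_norm ?sqr_ge0//.
  by rewrite ler_pXn2r ?nnegrE ?normr_ge0// (le_trans _ (Yb w)).
- exact: finite_measure_integrable_cst.
Qed.

Lemma sqint_cst c : sqint (fun=> c).
Proof. exact: (@bounded_sqint _ `|c|). Qed.

Lemma sqint1 : sqint 1.
Proof. exact: sqint_cst. Qed.

Lemma sqint0 : sqint 0.
Proof. exact: sqint_cst. Qed.

Lemma sqint_integrable Y : sqint Y -> P.-integrable setT (EFin \o Y).
Proof.
move=> /sqintM_integrable /(_ sqint1); apply: eq_integrable => // w _ /=.
by rewrite mulr1.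
Qed.

Lemma sqintD Y Z : sqint Y -> sqint Z -> sqint (Y + Z).
Proof.
move=> sY sZ; have [mY iY] := sY; have [mZ iZ] := sZ.
split; first exact: measurable_funD.
have -> : EFin \o (fun w => (Y + Z) w ^+ 2) =
   (EFin \o (fun w => Y w ^+ 2)) \+ ((EFin \o (fun w => Z w ^+ 2)) \+
    (fun w => 2%:E * (EFin \o (fun w => (Y w * Z w)%R)) w)%E).
  by apply/funext => w /=; rewrite -EFinM -!EFinD; congr EFin; rewrite !fctE; ring.
apply: integrableD => //; apply: integrableD => //; apply: integrableZl => //.
exact: sqintM_integrable.
Qed.

Lemma sqintZ a Y : sqint Y -> sqint (a *: Y).
Proof.
move=> [mY iY]; split; first exact: measurable_funM.
have -> : EFin \o (fun w => (a *: Y) w ^+ 2) =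
   (fun w => (a ^+ 2)%:E * (EFin \o (fun w => (Y w ^+ 2)%R)) w)%E.
  by apply/funext => w /=; rewrite -EFinM -exprMn.
exact: integrableZl.
Qed.

Lemma sqintN Y : sqint Y -> sqint (- Y).
Proof. by move=> /(sqintZ (-1)); rewrite scaleN1r. Qed.

Lemma sqintB Y Z : sqint Y -> sqint Z -> sqint (Y - Z).
Proof. by move=> sY /sqintN; exact: sqintD. Qed.

Lemma sqint_sum I (r : seq I) (Q : pred I) (F : I -> T -> R) :
  (forall i, Q i -> sqint (F i)) -> sqint (\sum_(i <- r | Q i) F i).
Proof. by move=> h; elim/big_ind : _ => //; [exact: sqint0|exact: sqintD]. Qed.

Lemma dotpC Y Z : dotp Y Z = dotp Z Y.
Proof. by apply: eq_Rintegral => w _; rewrite mulrC. Qed.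

Lemma dotpDl Y Z V : sqint Y -> sqint Z -> sqint V ->
  dotp (Y + Z) V = dotp Y V + dotp Z V.
Proof.
move=> sY sZ sV; rewrite /dotp -RintegralD//; try exact: sqintM_integrable.
by apply: eq_Rintegral => w _; rewrite !fctE mulrDl.
Qed.

Lemma dotpZl a Y V : sqint Y -> sqint V -> dotp (a *: Y) V = a * dotp Y V.
Proof.
move=> sY sV; rewrite /dotp -RintegralZl//; try exact: sqintM_integrable.
by apply: eq_Rintegral => w _; rewrite mulrA.
Qed.

Lemma dotpNl Y V : sqint Y -> sqint V -> dotp (- Y) V = - dotp Y V.
Proof. by move=> sY sV; rewrite -scaleN1r dotpZl// mulN1r. Qed.

Lemma dotpBl Y Z V : sqint Y -> sqint Z -> sqint V ->
  dotp (Y - Z) V = dotp Y V - dotp Z V.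
Proof. by move=> sY sZ sV; rewrite dotpDl ?dotpNl//; exact: sqintN. Qed.

Lemma dotp0l V : dotp 0 V = 0.
Proof.
rewrite /dotp (_ : (fun=> _) = cst 0) ?Rintegral_cst ?mul0r//.
by apply/funext => w /=; rewrite mul0r.
Qed.

Lemma dotpDr Y Z V : sqint Y -> sqint Z -> sqint V ->
  dotp V (Y + Z) = dotp V Y + dotp V Z.
Proof. by move=> *; rewrite dotpC dotpDl// !(dotpC V). Qed.

Lemma dotpZr a Y V : sqint Y -> sqint V -> dotp V (a *: Y) = a * dotp V Y.
Proof. by move=> *; rewrite dotpC dotpZl// !(dotpC V). Qed.

Lemma dotpBr Y Z V : sqint Y -> sqint Z -> sqint V ->
  dotp V (Y - Z) = dotp V Y - dotp V Z.
Proof. by move=> *; rewrite dotpC dotpBl// !(dotpC V). Qed.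

Lemma dotp_suml I (r : seq I) (Q : pred I) (F : I -> T -> R) V :
  (forall i, Q i -> sqint (F i)) -> sqint V ->
  dotp (\sum_(i <- r | Q i) F i) V = \sum_(i <- r | Q i) dotp (F i) V.
Proof.
move=> sF sV; suff [] : sqint (\sum_(i <- r | Q i) F i) /\
  dotp (\sum_(i <- r | Q i) F i) V = \sum_(i <- r | Q i) dotp (F i) V by [].
elim/big_rec2 : _ => [|i x y Qi [sy <-]].
  by split; [exact: sqint0|rewrite dotp0l].
by split; [apply: sqintD => //; exact: sF|rewrite dotpDl//; exact: sF].
Qed.

Lemma dotp_sumr I (r : seq I) (Q : pred I) (F : I -> T -> R) V :
  (forall i, Q i -> sqint (F i)) -> sqint V ->
  dotp V (\sum_(i <- r | Q i) F i) = \sum_(i <- r | Q i) dotp V (F i).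
Proof.
move=> sF sV; rewrite dotpC dotp_suml//; apply: eq_bigr => i _; exact: dotpC.
Qed.

Lemma dotp_ge0 Y : 0 <= dotp Y Y.
Proof. by apply: Rintegral_ge0 => w _; rewrite -expr2 sqr_ge0. Qed.

Lemma dotpNN Y Z : dotp (- Y) (- Z) = dotp Y Z.
Proof. by apply: eq_Rintegral => w _; rewrite /= mulrNN. Qed.

Lemma dotp_sqrD Y Z : sqint Y -> sqint Z ->
  dotp (Y + Z) (Y + Z) = dotp Y Y + 2 * dotp Y Z + dotp Z Z.
Proof.
move=> sY sZ; have sYZ := sqintD sY sZ.
by rewrite dotpDl// !dotpDr// (dotpC Z Y); ring.
Qed.

Lemma dotp_sqrB Y Z : sqint Y -> sqint Z ->
  dotp (Y - Z) (Y - Z) = dotp Y Y - 2 * dotp Y Z + dotp Z Z.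
Proof.
move=> sY sZ; have sYZ := sqintB sY sZ.
by rewrite dotpBl// !dotpBr// (dotpC Z Y); ring.
Qed.

Lemma dotp_CS Y Z : sqint Y -> sqint Z ->
  dotp Y Z ^+ 2 <= dotp Y Y * dotp Z Z.
Proof.
move=> sY sZ; have Y0 := dotp_ge0 Y; have Z0 := dotp_ge0 Z.
have H t : 0 <= dotp Y Y - 2 * t * dotp Y Z + t ^+ 2 * dotp Z Z.
  have := dotp_ge0 (Y - t *: Z); have sZ' := sqintZ t sZ.
  by rewrite dotp_sqrB// dotpZl// !dotpZr//; lra.
have [Z00|Z00] := eqVneq (dotp Z Z) 0.
  have [->|yz0] := eqVneq (dotp Y Z) 0; first by rewrite expr0n Z00 mulr0.
  (* When Z is null the quadratic form is affine in t; this t gives it the value -1. *)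
  have := H ((dotp Y Y + 1) / (2 * dotp Y Z)); rewrite Z00 mulr0 addr0.
  have -> : 2 * ((dotp Y Y + 1) / (2 * dotp Y Z)) * dotp Y Z = dotp Y Y + 1.
    by field; rewrite yz0.
  by lra.
have Zp : 0 < dotp Z Z by rewrite lt_def Z00.
have := H (dotp Y Z / dotp Z Z).
have -> : dotp Y Y - 2 * (dotp Y Z / dotp Z Z) * dotp Y Z +
    (dotp Y Z / dotp Z Z) ^+ 2 * dotp Z Z =
  (dotp Y Y * dotp Z Z - dotp Y Z ^+ 2) / dotp Z Z by field.
by rewrite pmulr_lge0 ?invr_gt0// subr_ge0.
Qed.

Lemma dotp_sqrD_le Y Z : sqint Y -> sqint Z ->
  dotp (Y + Z) (Y + Z) <= 2 * (dotp Y Y + dotp Z Z).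
Proof.
move=> sY sZ; rewrite dotp_sqrD//; have := dotp_ge0 (Y - Z).
by rewrite dotp_sqrB//; lra.
Qed.

Lemma dotp_cvg (F G : nat -> T -> R) Y Z :
  (forall n, sqint (F n)) -> (forall n, sqint (G n)) -> sqint Y -> sqint Z ->
  dotp (F n - Y) (F n - Y) @[n --> \oo] --> 0 ->
  dotp (G n - Z) (G n - Z) @[n --> \oo] --> 0 ->
  dotp (F n) (G n) @[n --> \oo] --> dotp Y Z.
Proof.
move=> sF sG sY sZ FY GZ.
have sFY n : sqint (F n - Y) by exact: sqintB.
have sGZ n : sqint (G n - Z) by exact: sqintB.
have E n : dotp (F n) (G n) = dotp Y Z +
   (dotp (F n - Y) (G n - Z) + dotp Y (G n - Z) + dotp (F n - Y) Z).
  rewrite [X in _ + (X + _ + _)]dotpBl// !dotpBr// dotpBl//; ring.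
rewrite (funext E).
rewrite -[X in _ --> X]addr0; apply: cvgD; first exact: cvg_cst.
have sq0 (u : nat -> R) : u n ^+ 2 @[n --> \oo] --> 0 -> u n @[n --> \oo] --> 0.
  move=> u0; apply: norm_cvg0.
  have -> : (fun n => `|u n|) = (fun n => Num.sqrt (u n ^+ 2)).
    by apply/funext => n; rewrite sqrtr_sqr.
  rewrite -[X in _ --> X](@sqrtr0 R); apply: continuous_cvg => //.
  exact: sqrt_continuous.
have CS (A B : nat -> T -> R) (b : R) : (forall n, sqint (A n)) ->
    (forall n, sqint (B n)) ->
    dotp (A n) (A n) @[n --> \oo] --> 0 -> dotp (B n) (B n) @[n --> \oo] --> b ->
    dotp (A n) (B n) @[n --> \oo] --> 0.
  move=> sA sB A0 Bb; apply: sq0.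
  apply: (@squeeze_cvgr _ _ _ _ (cst 0)
    (fun n => dotp (A n) (A n) * dotp (B n) (B n))).
  - by near=> n; rewrite sqr_ge0 dotp_CS.
  - exact: cvg_cst.
  - by rewrite -[X in _ --> X](mul0r b); exact: cvgM.
rewrite -[X in _ --> X]addr0 -[X in _ --> X + _]addr0.
apply: cvgD; [apply: cvgD|].
- exact: (CS _ _ 0).
- under eq_fun do rewrite dotpC.
  by apply: (CS _ (fun=> Y) (dotp Y Y)) => //; exact: cvg_cst.
- by apply: (CS _ (fun=> Z) (dotp Z Z)) => //; exact: cvg_cst.
Unshelve. all: end_near. Qed.

End SquareIntegrable.

(** * Polynomial approximation of a step function *)

Section RealSequences.
Context {R : realType}.
Implicit Types x t y : R.

Lemma bernoulli_lb x n : 0 <= x <= 1 -> 1 - n%:R * x <= (1 - x) ^+ n.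
Proof.
move=> /andP[x0 x1]; elim: n => [|n IH]; first by rewrite expr0 mul0r subr0.
have n0 : 0 <= n%:R :> R by [].
have e0 : 0 <= (1 - x) ^+ n by rewrite exprn_ge0// subr_ge0.
rewrite exprS -natr1; apply: (@le_trans _ _ ((1 - x) * (1 - n%:R * x))).
  by have := mulr_ge0 n0 (mulr_ge0 x0 x0); lra.
by rewrite ler_wpM2l// subr_ge0.
Qed.

Lemma bernoulli_ub x n : 0 <= x <= 1 -> (1 - x) ^+ n * (1 + n%:R * x) <= 1.
Proof.
move=> /andP[x0 x1]; elim: n => [|n IH]; first by rewrite expr0 mul0r addr0 mul1r.
have n0 : 0 <= n%:R :> R by [].
have e0 : 0 <= (1 - x) ^+ n by rewrite exprn_ge0// subr_ge0.
rewrite exprSr -mulrA; apply: le_trans IH; rewrite ler_wpM2l// -natr1.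
by have := mulr_ge0 n0 (mulr_ge0 x0 x0); have := mulr_ge0 x0 x0; lra.
Qed.

(* For y > 0 the base ((1 - y) / 2) is below 1/2, so that its n-th power beats
   the exponent 2 ^ n; for y < 0 it is above 1/2. The second factor forces the
   value 0 at y = 0. *)
Definition step_approx n y : R :=
  (1 - ((1 - y) / 2) ^+ n) ^+ (2 ^ n) * (1 - (1 - y ^+ 2) ^+ n).

Lemma step_approx_bound n y : -1 <= y <= 1 -> 0 <= step_approx n y <= 1.
Proof.
move=> /andP[y0 y1].
have t0 : 0 <= (1 - y) / 2 <= 1 by lra.
have y2 : 0 <= 1 - y ^+ 2 <= 1 by rewrite !expr2; apply/andP; split; nra.
have h (z : R) k : 0 <= z <= 1 -> 0 <= z ^+ k <= 1.
  by move=> /andP[? ?]; rewrite exprn_ge0//= exprn_ile1.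
have h' (z : R) : 0 <= z <= 1 -> 0 <= 1 - z <= 1 by lra.
have /andP[a0 a1] := h _ (2 ^ n)%N (h' _ (h _ n t0)).
have /andP[b0 b1] := h' _ (h _ n y2).
by rewrite /step_approx mulr_ge0//= mulr_ile1.
Qed.

(** Polynomials with values in [0, 1] that reach the indicator of y > 0: they carry an algebra of
    bounded functions to indicators by dominated convergence. Both signs of y are settled by
    Bernoulli's inequality, because 2^n ((1 - y) / 2)^n = (1 - y)^n. *)
Lemma cvg_step_approx y : -1 <= y <= 1 ->
  step_approx n y @[n --> \oo] --> ((0 < y)%R%:R : R).
Proof.
move=> /andP[yN1 y1].
have t0 n : 0 <= ((1 - y) / 2) ^+ n <= 1.
  by rewrite exprn_ge0/= ?exprn_ile1//; lra.
have [y0|y0|<-] := ltgtP 0 y.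
- have A : (1 - y ^+ 2) ^+ n @[n --> \oo] --> 0.
    by apply: cvg_expr; rewrite ger0_norm !expr2; nra.
  rewrite -[X in _ --> X]mulr1 /=; apply: cvgM; last first.
    by rewrite -[X in _ --> X]subr0; apply: cvgB => //; exact: cvg_cst.
  apply: (@squeeze_cvgr _ _ _ _ (fun n => 1 - (1 - y) ^+ n) (cst 1)).
  + near=> n; rewrite exprn_ile1 ?andbT//; try by have /andP[] := t0 n; lra.
    apply: le_trans (bernoulli_lb (2 ^ n) (t0 n)).
    by rewrite natrX -exprMn mulrC divfK.
  + rewrite -[X in _ --> X]subr0; apply: cvgB; first exact: cvg_cst.
    by apply: cvg_expr; rewrite ger0_norm; lra.
  + exact: cvg_cst.
- have A : (1 - y)^-1 ^+ n @[n --> \oo] --> 0.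
    apply: cvg_expr; rewrite ger0_norm ?invr_ge0; last by lra.
    by rewrite invf_lt1; lra.
  apply: (@squeeze_cvgr _ _ _ _ (cst 0) (fun n => (1 - y)^-1 ^+ n)) => //; last first.
    exact: cvg_cst.
  near=> n.
  have /andP[-> _] /= : 0 <= step_approx n y <= 1.
    by apply: step_approx_bound; rewrite yN1 y1.
  have b0 : 0 <= 1 - (1 - y ^+ 2) ^+ n <= 1.
    have /andP[? ?] : 0 <= (1 - y ^+ 2) ^+ n <= 1; last by lra.
    by rewrite exprn_ge0/= ?exprn_ile1// !expr2; nra.
  (* Bounds the first factor by (1 - y)^(-n), which tends to 0 since 1 - y > 1. *)
  have := bernoulli_ub (2 ^ n) (t0 n).
  have a0 : 0 <= (1 - ((1 - y) / 2) ^+ n) ^+ (2 ^ n).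
    by rewrite exprn_ge0//; have /andP[] := t0 n; lra.
  rewrite natrX -exprMn (mulrC 2) divfK// exprVn => H.
  have p0 : 0 < (1 - y) ^+ n by rewrite exprn_gt0//; lra.
  apply: (@le_trans _ _ ((1 - ((1 - y) / 2) ^+ n) ^+ (2 ^ n))).
    by rewrite /step_approx ler_piMr//; lra.
  by rewrite -[leRHS]mul1r ler_pdivlMr//; lra.
- under eq_fun do rewrite /step_approx expr0n /= subr0 expr1n subrr mulr0.
  exact: cvg_cst.
Unshelve. all: end_near. Qed.

End RealSequences.

Lemma dominated_Rintegral d (T : measurableType d) (R : realType)
    (mu : {measure set T -> \bar R}) (F : nat -> T -> R) (Y G : T -> R) :
  (forall n, measurable_fun setT (F n)) -> (forall w, F n w @[n --> \oo] --> Y w) ->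
  mu.-integrable setT (EFin \o G) -> (forall n w, `|F n w| <= G w) ->
  \int[mu]_w F n w @[n --> \oo] --> \int[mu]_w Y w.
Proof.
move=> mF FY iG FG.
have mY : measurable_fun setT Y by apply: measurable_fun_cvg mF _ => w _; exact: FY.
have mF' n : measurable_fun setT (EFin \o F n) by exact/measurable_EFinP.
have mY' : measurable_fun setT (EFin \o Y) by exact/measurable_EFinP.
have FY' w : setT w -> (F n w)%:E @[n --> \oo] --> (Y w)%:E.
  by move=> _; apply: cvg_EFin; [exact: nearW|exact: FY].
have FG' w n : setT w -> (`|(F n w)%:E| <= (G w)%:E)%E.
  by move=> _; rewrite lee_fin.
have [iY _ c] := dominated_convergence measurableT mF' mY' (aeW mu FY') iG (aeW mu FG').
by apply: fine_cvg; rewrite fineK//; exact: integrable_fin_num.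
Qed.

Section DominatedConvergence.
Context d (T : measurableType d) (R : realType) (P : probability T R).
Implicit Types Y Z G : T -> R.

Lemma dotp_le (c : R) Y Z : sqint P Y -> sqint P Z ->
  (forall w, Y w ^+ 2 <= c * Z w ^+ 2) -> dotp P Y Y <= c * dotp P Z Z.
Proof.
move=> sY sZ YZ; rewrite /dotp -RintegralZl//; last exact: sqintM_integrable.
apply: le_Rintegral => //; first exact: sqintM_integrable.
  have := sqintM_integrable (sqintZ c sZ) sZ; apply: eq_integrable => // w _ /=.
  by rewrite mulrA.
by move=> w _; rewrite -!expr2.
Qed.

Lemma dotp_dominated_cvg (F : nat -> T -> R) Y G :
  (forall n, measurable_fun setT (F n)) -> (forall w, F n w @[n --> \oo] --> Y w) ->
  sqint P G -> (forall n w, `|F n w| <= G w) ->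
  sqint P Y /\ dotp P (F n - Y) (F n - Y) @[n --> \oo] --> 0.
Proof.
move=> mF FY sG FG.
have mY : measurable_fun setT Y by apply: measurable_fun_cvg mF _ => w _; exact: FY.
have YG w : `|Y w| <= G w.
  have c : `|F n w| @[n --> \oo] --> `|Y w| by apply: cvg_norm; exact: FY.
  rewrite -(cvg_lim _ c)//; apply: limr_le; first by apply/cvg_ex; eexists; exact: c.
  by apply: nearW => n; exact: FG.
have [mG iG] := sG; split.
  split=> //; apply: le_integrable iG => //.
    by apply/measurable_EFinP; exact: measurable_funX.
  move=> w _ /=; rewrite lee_fin !normrX ler_pXn2r ?nnegrE ?normr_ge0//.
  by rewrite (le_trans (YG w))// ler_norm.
have -> : 0 = \int[P]_w (fun=> 0) w :> R by rewrite Rintegral_cst// mul0r.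
apply: (@dominated_Rintegral _ _ _ _ _ _ (fun w => 4 * (G w * G w))).
- move=> n; apply: measurable_funM; apply: measurable_funB => //; exact: mF.
- move=> w; rewrite -[X in _ --> X](mul0r 0); apply: cvgM;
  by apply/subr_cvg0; exact: FY.
- have : P.-integrable setT (fun w => (4%:E * (G w ^+ 2)%:E)%E).
    exact: integrableZl.
  by apply: eq_integrable => // w _ /=.
- move=> n w; have := FG n w; have := YG w.
  rewrite -expr2 normrX => YGw FGw.
  have H : `|(F n - Y) w| <= 2 * G w.
    by rewrite (le_trans (ler_normB _ _))//; lra.
  rewrite (_ : 4 * _ = (2 * G w) ^+ 2); last by ring.
  by rewrite ler_pXn2r ?nnegrE ?normr_ge0// (le_trans _ H).
Qed.

End DominatedConvergence.

(** * Density of trigonometric polynomials *)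

Section Density.
Import HBSimple HBNNSimple.
Context d (T : measurableType d) (R : realType) (P : probability T R).
Implicit Types Y Z G : T -> R.
Variable A : set (T -> R).
Hypothesis A1 : A 1.
Hypothesis AD : forall Y Z, A Y -> A Z -> A (Y + Z).
Hypothesis AZ : forall a Y, A Y -> A (a *: Y).
Hypothesis AM : forall Y Z, A Y -> A Z -> A (Y * Z).
Hypothesis A_meas : forall Y, A Y -> measurable_fun setT Y.
Hypothesis A_bounded : forall Y, A Y -> exists M : R, forall w, `|Y w| <= M.

Definition L2closure Y := sqint P Y /\
  forall e : R, 0 < e -> exists2 Z, A Z & dotp P (Y - Z) (Y - Z) <= e.

(** Boundedness is imposed because products of general elements of the closure may leave L^2; the
    bounded ones form an algebra. *)
Definition bounded_closure Y := L2closure Y /\ exists M : R, forall w, `|Y w| <= M.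

Lemma gen_sqint Y : A Y -> sqint P Y.
Proof.
by move=> AY; have [M Yb] := A_bounded AY; apply: bounded_sqint Yb; exact: A_meas.
Qed.

Lemma gen_L2closure Y : A Y -> L2closure Y.
Proof.
move=> AY; split; first exact: gen_sqint.
by move=> e e0; exists Y => //; rewrite subrr dotp0l ltW.
Qed.

Lemma gen_bounded_closure Y : A Y -> bounded_closure Y.
Proof. by move=> AY; split; [exact: gen_L2closure|exact: A_bounded]. Qed.

Lemma L2closure_closed Y : sqint P Y ->
  (forall e : R, 0 < e -> exists2 Z, L2closure Z & dotp P (Y - Z) (Y - Z) <= e) ->
  L2closure Y.
Proof.
move=> sY cY; split=> // e e0.
(* The squared norm of a sum is at most twice the sum of the squared norms, hence e / 4 for each of
   the two errors. *)
have [//|Z [sZ cZ] YZ] := cY (e / 4); first by lra.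
have [|V AV ZV] := cZ (e / 4); first by lra.
exists V => //; have sV := gen_sqint AV.
rewrite (_ : Y - V = (Y - Z) + (Z - V)); last by rewrite addrA subrK.
have := dotp_sqrD_le (sqintB sY sZ) (sqintB sZ sV); lra.
Qed.

Lemma L2closureD Y Z : L2closure Y -> L2closure Z -> L2closure (Y + Z).
Proof.
move=> [sY cY] [sZ cZ]; split; first exact: sqintD.
move=> e e0; have [|Y' AY' YY'] := cY (e / 4); first by lra.
have [|Z' AZ' ZZ'] := cZ (e / 4); first by lra.
exists (Y' + Z'); first exact: AD.
rewrite opprD addrACA.
have := dotp_sqrD_le (sqintB sY (gen_sqint AY')) (sqintB sZ (gen_sqint AZ')); lra.
Qed.

Lemma L2closureZ a Y : L2closure Y -> L2closure (a *: Y).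
Proof.
move=> [sY cY]; split; first exact: sqintZ.
move=> e e0; have p : 0 < a ^+ 2 + 1 by have := sqr_ge0 a; lra.
have [|Y' AY' YY'] := cY (e / (a ^+ 2 + 1)); first by rewrite divr_gt0.
exists (a *: Y'); first exact: AZ.
have s := sqintB sY (gen_sqint AY'); have s' := sqintZ a s.
rewrite -scalerBr dotpZl// dotpZr// mulrA -expr2.
move: YY'; rewrite ler_pdivlMr//; have := dotp_ge0 P (Y - Y'); nra.
Qed.

Lemma L2closure_dominated (F : nat -> T -> R) Y G :
  (forall n, L2closure (F n)) -> (forall w, F n w @[n --> \oo] --> Y w) ->
  sqint P G -> (forall n w, `|F n w| <= G w) -> L2closure Y.
Proof.
move=> cF FY sG FG.
have mF n : measurable_fun setT (F n) by have [[]] := cF n.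
have [sY c] := dotp_dominated_cvg mF FY sG FG.
apply: L2closure_closed => // e e0.
have /cvgrPdist_lt/(_ _ e0)[N _ /(_ N (leqnn N))] := c.
rewrite sub0r normrN ger0_norm ?dotp_ge0// => /ltW H.
by exists (F N) => //; rewrite -opprB dotpNN.
Qed.

(** Multiplication by a function bounded by M is Lipschitz in L^2 with constant M, so Y may be
    replaced by generators close to it. *)
Lemma L2closureMb Y Z (M : R) : L2closure Y -> measurable_fun setT Z ->
  (forall w, `|Z w| <= M) -> (forall V, A V -> L2closure (V * Z)) -> L2closure (Y * Z).
Proof.
move=> [sY cY] mZ bZ AVZ.
have bZ2 w : Z w ^+ 2 <= M ^+ 2.
  rewrite -(real_normK (num_real (Z w))) ler_pXn2r ?nnegrE ?normr_ge0//.
  exact: le_trans (bZ w).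
have sMb V : sqint P V -> sqint P (V * Z).
  move=> [mV iV]; split; first exact: measurable_funM.
  apply: (@le_integrable _ _ _ P setT measurableT _
    (fun w => ((M ^+ 2)%:E * (V w ^+ 2)%:E)%E)).
  - by apply/measurable_EFinP; apply: measurable_funX; exact: measurable_funM.
  - move=> w _ /=; rewrite lee_fin (ger0_norm (sqr_ge0 _)).
    rewrite (ger0_norm (mulr_ge0 (sqr_ge0 M) (sqr_ge0 (V w)))).
    by rewrite fctE exprMn mulrC ler_wpM2r ?sqr_ge0.
  - exact: (integrableZl measurableT (M ^+ 2) iV).
apply: L2closure_closed; first exact: sMb.
move=> e e0; have p : 0 < M ^+ 2 + 1 by have := sqr_ge0 M; lra.
have [|V AV YV] := cY (e / (M ^+ 2 + 1)); first by rewrite divr_gt0.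
exists (V * Z); first exact: AVZ.
have s := sqintB sY (gen_sqint AV).
rewrite -mulrBl; apply: (@le_trans _ _ (M ^+ 2 * dotp P (Y - V) (Y - V))).
  apply: dotp_le => //; first exact: sMb.
  by move=> w; rewrite fctE exprMn mulrC ler_wpM2r ?sqr_ge0.
move: YV; rewrite ler_pdivlMr//; have := dotp_ge0 P (Y - V); nra.
Qed.

Lemma bounded_closureM Y Z :
  bounded_closure Y -> bounded_closure Z -> bounded_closure (Y * Z).
Proof.
move=> [cY [M YM]] [cZ [N ZN]]; split; last first.
  by exists (M * N) => w; rewrite normrM ler_pM.
apply: (L2closureMb (M := N)) => //; first by have [[]] := cZ.
(* Y has been replaced by a generator V, which is itself bounded; exchanging the factors replaces Z
   by a generator as well, and A is stable under products. *)
move=> V AV; rewrite mulrC; have [K VK] := A_bounded AV.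
apply: (L2closureMb (M := K)) => //; first exact: A_meas.
by move=> W AW; apply: gen_L2closure; exact: AM.
Qed.

Lemma bounded_closureD Y Z :
  bounded_closure Y -> bounded_closure Z -> bounded_closure (Y + Z).
Proof.
move=> [cY [M YM]] [cZ [N ZN]]; split; first exact: L2closureD.
by exists (M + N) => w; rewrite (le_trans (ler_normD _ _))// lerD.
Qed.

Lemma bounded_closureZ a Y : bounded_closure Y -> bounded_closure (a *: Y).
Proof.
move=> [cY [M YM]]; split; first exact: L2closureZ.
by exists (`|a| * M) => w; rewrite normrM ler_wpM2l.
Qed.

Lemma bounded_closure1 : bounded_closure 1.
Proof. exact: gen_bounded_closure. Qed.

Lemma bounded_closureB Y Z :
  bounded_closure Y -> bounded_closure Z -> bounded_closure (Y - Z).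
Proof.
by move=> cY cZ; rewrite -scaleN1r; apply: bounded_closureD => //; exact: bounded_closureZ.
Qed.

Lemma bounded_closureX Y n : bounded_closure Y -> bounded_closure (Y ^+ n).
Proof.
move=> cY; elim: n => [|n IH]; first exact: bounded_closure1.
by rewrite exprS; exact: bounded_closureM.
Qed.

Lemma bounded_closure_lim (F : nat -> T -> R) Y (M : R) :
  (forall n, bounded_closure (F n)) -> (forall w, F n w @[n --> \oo] --> Y w) ->
  (forall n w, `|F n w| <= M) -> bounded_closure Y.
Proof.
move=> cF FY FM; split.
  by apply: (L2closure_dominated (F := F) (G := cst M)) => //;
    [move=> n; have [] := cF n|exact: sqint_cst].
exists M => w; have c : `|F n w| @[n --> \oo] --> `|Y w| by apply: cvg_norm; exact: FY.
rewrite -(cvg_lim _ c)//; apply: limr_le; first by apply/cvg_ex; eexists; exact: c.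
by apply: nearW => n; exact: FM.
Qed.

Definition closure_sets : set (set T) := [set B | bounded_closure \1_B].

(** Once Y is scaled into [-1, 1], the functions [step_approx n] of it are polynomials in a bounded
    element of the closure and converge boundedly to the indicator. *)
Lemma closure_sets_gt0 Y : bounded_closure Y -> closure_sets [set w | 0 < Y w].
Proof.
move=> cY; have [_ [M YM]] := cY.
pose M' := `|M| + 1; have M'0 : 0 < M' by rewrite ltr_wpDl.
pose Z := M'^-1 *: Y; have cZ : bounded_closure Z by exact: bounded_closureZ.
have Z1 w : -1 <= Z w <= 1.
  rewrite -ler_norml /Z fctE normrM gtr0_norm ?invr_gt0// mulrC ler_pdivrMr// mul1r.
  by rewrite (le_trans (YM w))// (le_trans (ler_norm _))// lerDl.
have -> : closure_sets [set w | 0 < Y w] =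
    bounded_closure (fun w => (0 < Z w)%R%:R : R).
  congr bounded_closure; apply/funext => w; rewrite indicE.
  rewrite /Z fctE pmulr_rgt0 ?invr_gt0//.
  suff -> : (w \in [set w | 0 < Y w]) = (0 < Y w) by [].
  by apply/idP/idP; rewrite inE.
apply: (@bounded_closure_lim (fun n w => step_approx n (Z w)) _ 1).
- move=> n; pose V := (1 - (2^-1 *: (1 - Z)) ^+ n) ^+ (2 ^ n) * (1 - (1 - Z ^+ 2) ^+ n).
  have expf (U : T -> R) k w : (U ^+ k) w = U w ^+ k.
    by elim: k => [//|k IH]; rewrite exprS fctE IH -exprS.
  have -> : (fun w => step_approx n (Z w)) = V.
    apply/funext => w; rewrite /V /step_approx !(fctE, expf) /=.
    by rewrite -[2^-1 *: _]/(2^-1 * _) (mulrC 2^-1).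
  have c1 := bounded_closure1.
  apply: bounded_closureM; first apply: bounded_closureX; apply: bounded_closureB => //;
    apply: bounded_closureX.
    by apply: bounded_closureZ; exact: bounded_closureB.
  by apply: bounded_closureB => //; exact: bounded_closureX.
- by move=> w; exact: cvg_step_approx.
- move=> n w; have /andP[a b] := step_approx_bound n (Z1 w).
  by rewrite ger0_norm.
Qed.

Lemma closure_sets_sigma_algebra : sigma_algebra setT closure_sets.
Proof.
have c0 : closure_sets set0.
  rewrite /closure_sets /= (_ : \1_set0 = (0 : R) *: (1 : T -> R)); last first.
    by apply/funext => w; rewrite indic0 scale0r.
  by apply: bounded_closureZ; exact: bounded_closure1.
have cC B : closure_sets B -> closure_sets (~` B).
  rewrite /closure_sets /= => cB.
  have -> : \1_(~` B) = 1 - \1_B :> (T -> R).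
    apply/funext => w; rewrite !fctE !indicE in_setC; case: (w \in B) => /=.
      by rewrite subrr.
    by rewrite subr0.
  by apply: bounded_closureB => //; exact: bounded_closure1.
have cI B C : closure_sets B -> closure_sets C -> closure_sets (B `&` C).
  rewrite /closure_sets /= => cB cC'; rewrite indicI; exact: bounded_closureM.
have cU B C : closure_sets B -> closure_sets C -> closure_sets (B `|` C).
  move=> cB cC'; rewrite -(setCK (B `|` C)) setCU; apply: (cC); apply: cI; exact: cC.
split=> //; first by move=> B cB; rewrite setTD; exact: cC.
move=> F cF.
have cn n : closure_sets (\bigcup_(k < n) F k).
  elim: n => [|n IH]; first by rewrite bigcup_mkord big_ord0.
  by rewrite bigcup_mkord big_ord_recr/= -bigcup_mkord; exact: cU.
apply: (@bounded_closure_lim (fun n => \1_(\bigcup_(k < n) F k)) _ 1) => //.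
- move=> w; have [[k _ Fk]|h] := pselect ((\bigcup_k F k) w).
    apply: cvg_near_cst; exists k.+1 => //= n /= kn.
    by rewrite !indicE !mem_set//; exists k.
  apply: cvg_near_cst; exists 0%N => //= n _; rewrite !indicE !memNset//.
  by move=> [k _ Fk]; apply: h; exists k.
- by move=> n w; rewrite indicE; case: (_ \in _); rewrite ?normr1 ?normr0.
Qed.

Lemma closure_sets_measurableE :
  @measurable _ (g_sigma_algebraType closure_sets) = closure_sets.
Proof. exact: sigma_algebra_id closure_sets_sigma_algebra. Qed.

Lemma bounded_closure_measurable Y : bounded_closure Y ->
  measurable_fun (setT : set (g_sigma_algebraType closure_sets)) Y.
Proof.
move=> cY; apply: (measurability _ (RGenOInfty.measurableE R)).
move=> _ [_ [x ->] <-]; rewrite setTI.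
have -> : Y @^-1` `]x, +oo[ = [set w | 0 < (Y - x *: (1 : T -> R)) w].
  apply/seteqP; split => w /=; rewrite in_itv/= andbT !fctE -[_ *: _]/(_ * _);
  by rewrite mulr1 subr_gt0.
rewrite [X in X _]closure_sets_measurableE; apply: closure_sets_gt0.
by apply: bounded_closureB => //; apply: bounded_closureZ; exact: bounded_closure1.
Qed.

(** Simple functions over the closure sets lie in the closure and increase to Y, which dominates
    them. Density is thereby reduced to a question of measurability. *)
Lemma closure_measurable_ge0 Y :
  measurable_fun (setT : set (g_sigma_algebraType closure_sets)) Y ->
  (forall w, 0 <= Y w) -> sqint P Y -> L2closure Y.
Proof.
move=> mY Y0 sY.
have mY' : measurable_fun (setT : set (g_sigma_algebraType closure_sets)) (EFin \o Y).
  exact/measurable_EFinP.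
have [g [gnd gY]] := approximation measurableT mY' (fun w _ => Y0 w).
have gY' w : (g n : T -> R) w @[n --> \oo] --> Y w.
  by have /fine_cvg := gY w I.
apply: (L2closure_dominated (F := fun n => g n : T -> R) (G := Y)) => //; last first.
  move=> n w; rewrite ger0_norm ?fun_ge0//.
  rewrite -(cvg_lim _ (gY' w))//; apply: nondecreasing_cvgn_le.
    by move=> i j ij; exact/lefP/gnd.
  by apply/cvg_ex; eexists; exact: gY'.
move=> n.
have -> : (g n : T -> R) = \sum_(y <- finmap.enum_fset (fset_set (range (g n))))
    y *: \1_(g n @^-1` [set y]).
  by apply/funext => w; rewrite fct_sumE fimfunE fsbig_finite.
elim/big_rec : _ => [|y Z _ cZ].
  by have := L2closureZ 0 (gen_L2closure A1); rewrite scale0r.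
apply: L2closureD => //; apply: L2closureZ.
have : closure_sets (g n @^-1` [set y]).
  have mB : measurable (g n @^-1` [set y]) by exact: measurable_sfunP.
  by move: mB; rewrite [X in X _ -> _]closure_sets_measurableE.
by case.
Qed.

Lemma closure_measurable Y :
  measurable_fun (setT : set (g_sigma_algebraType closure_sets)) Y ->
  sqint P Y -> L2closure Y.
Proof.
move=> mY [mY' iY].
have -> : Y = Y^\+ + (-1) *: Y^\-.
  by rewrite scaleN1r funrposBneg.
have le1 Z : measurable_fun setT Z -> (forall w, `|Z w| <= `|Y w|) -> sqint P Z.
  move=> mZ ZY; split=> //; apply: le_integrable iY => //.
    by apply/measurable_EFinP; exact: measurable_funX.
  by move=> w _; rewrite /= lee_fin !normrX ler_pXn2r ?nnegrE.
apply: L2closureD; last apply: L2closureZ; apply: closure_measurable_ge0.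
- exact: measurable_funrpos.
- by move=> w; exact: funrpos_ge0.
- apply: le1; first exact: measurable_funrpos.
  move=> w; rewrite ger0_norm ?funrpos_ge0// /funrpos /=.
  by rewrite /Num.max; case: ifP => // _; exact: ler_norm.
- exact: measurable_funrneg.
- by move=> w; exact: funrneg_ge0.
- apply: le1; first exact: measurable_funrneg.
  move=> w; rewrite ger0_norm ?funrneg_ge0// /funrneg /=.
  by rewrite /Num.max; case: ifP => // _; rewrite -normrN; exact: ler_norm.
Qed.

End Density.

(** * Second-order decorrelation of Gaussian vectors *)

Section SchurPowers.
Context {R : realFieldType} (p : nat).

Definition dotr (s t : 'rV[R]_p) : R := \sum_i s 0 i * t 0 i.

Definition bilr (M : 'M[R]_p) (s t : 'rV[R]_p) : R :=
  \sum_i \sum_j M i j * (s 0 i * t 0 j).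

Lemma gram_powerS I (r : seq I) (s : I -> 'rV[R]_p) n (c : I -> R) :
  \sum_(a <- r) \sum_(b <- r) c a * c b * dotr (s a) (s b) ^+ n.+1 =
  \sum_i \sum_(a <- r) \sum_(b <- r)
    (c a * s a 0 i) * (c b * s b 0 i) * dotr (s a) (s b) ^+ n.
Proof.
rewrite [RHS]exchange_big; apply: eq_bigr => a _; rewrite [RHS]exchange_big.
apply: eq_bigr => b _; rewrite exprS mulrA mulr_sumr mulr_suml.
by apply: eq_bigr => i _; ring.
Qed.

(** Schur's product theorem for entrywise powers of a Gram matrix: [gram_powerS] absorbs one factor
    into the coefficients, and at exponent 0 the form is a square. *)
Lemma gram_power_ge0 I (r : seq I) (s : I -> 'rV[R]_p) n (c : I -> R) :
  0 <= \sum_(a <- r) \sum_(b <- r) c a * c b * dotr (s a) (s b) ^+ n.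
Proof.
elim: n c => [|n IH] c.
  rewrite (_ : \sum_(a <- r) _ = (\sum_(a <- r) c a) ^+ 2) ?sqr_ge0//.
  rewrite expr2 mulr_suml; apply: eq_bigr => a _; rewrite mulr_sumr.
  by apply: eq_bigr => b _; rewrite expr0 mulr1.
by rewrite gram_powerS; apply: sumr_ge0 => i _; exact: IH.
Qed.

(* Expanding one factor of every n.+1-st power reduces to exponent n with the
   coefficients c a * s_a,i and k b * t_b,j. *)
Lemma bilr_power_bound (M : 'M[R]_p) (e : R) I (r : seq I) (s : I -> 'rV[R]_p)
    J (q : seq J) (t : J -> 'rV[R]_p) n (c : I -> R) (k : J -> R) :
  (forall i j, `|M i j| <= e) ->
  `|\sum_(a <- r) \sum_(b <- q) c a * k b * bilr M (s a) (t b) ^+ n| <=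
  (p%:R * e) ^+ n / 2 *
  (\sum_(a <- r) \sum_(b <- r) c a * c b * dotr (s a) (s b) ^+ n +
   \sum_(a <- q) \sum_(b <- q) k a * k b * dotr (t a) (t b) ^+ n).
Proof.
move=> Me; elim: n c k => [|n IH] c k.
  have E U V (x : seq U) (y : seq V) (f : U -> R) (g : V -> R) (h : U -> V -> R) :
      \sum_(a <- x) \sum_(b <- y) f a * g b * h a b ^+ 0 =
      (\sum_(a <- x) f a) * (\sum_(b <- y) g b).
    rewrite mulr_suml; apply: eq_bigr => a _; rewrite mulr_sumr.
    by apply: eq_bigr => b _; rewrite expr0 mulr1.
  rewrite !E expr0 div1r ler_norml.
  set x := \sum_(a <- r) c a; set y := \sum_(a <- q) k a.
  have := sqr_ge0 (x + y); have := sqr_ge0 (x - y); rewrite !expr2.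
  by move=> ? ?; apply/andP; split; nra.
pose A i := \sum_(a <- r) \sum_(b <- r)
  (c a * s a 0 i) * (c b * s b 0 i) * dotr (s a) (s b) ^+ n.
pose B j := \sum_(a <- q) \sum_(b <- q)
  (k a * t a 0 j) * (k b * t b 0 j) * dotr (t a) (t b) ^+ n.
rewrite !gram_powerS (_ : \sum_(a <- r) _ = \sum_i \sum_j M i j * \sum_(a <- r) \sum_(b <- q)
    (c a * s a 0 i) * (k b * t b 0 j) * bilr M (s a) (t b) ^+ n); last first.
  transitivity (\sum_(a <- r) \sum_(b <- q) \sum_i \sum_j
      M i j * ((c a * s a 0 i) * (k b * t b 0 j) * bilr M (s a) (t b) ^+ n)).
    apply: eq_bigr => a _; apply: eq_bigr => b _.
    rewrite exprS mulrA {1}/bilr mulr_sumr mulr_suml; apply: eq_bigr => i _.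
    rewrite mulr_sumr mulr_suml; apply: eq_bigr => j _; ring.
  under eq_bigr => a _ do rewrite exchange_big.
  rewrite exchange_big; apply: eq_bigr => i _.
  under eq_bigr => a _ do rewrite exchange_big.
  rewrite exchange_big; apply: eq_bigr => j _.
  by rewrite mulr_sumr; apply: eq_bigr => a _; rewrite mulr_sumr.
apply: (@le_trans _ _ (\sum_i \sum_j e * ((p%:R * e) ^+ n / 2 * (A i + B j)))).
  apply: le_trans (ler_norm_sum _ _ _) _; apply: ler_sum => i _.
  apply: le_trans (ler_norm_sum _ _ _) _; apply: ler_sum => j _.
  by rewrite normrM ler_pM//; exact: IH.
rewrite le_eqVlt; apply/orP; left; apply/eqP.
have sumc (x : R) : \sum_(i < p) x = p%:R * x.
  by rewrite sumr_const card_ord mulr_natl.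
have E i : \sum_j e * ((p%:R * e) ^+ n / 2 * (A i + B j)) =
    e * ((p%:R * e) ^+ n / 2) * (p%:R * A i + \sum_j B j).
  by rewrite -(sumc (A i)) -big_split mulr_sumr; apply: eq_bigr => j _ /=; ring.
under eq_bigr => i _ do rewrite E.
by rewrite -mulr_sumr big_split /= sumc -mulr_sumr exprS /A /B; ring.
Qed.

End SchurPowers.

Section TrigLimits.
Context {R : realType}.
Implicit Types x y : R.

(** The limits n sin (x / n) -> x and n (exp (x / n) - 1) -> x drawn from it recover moments from
    trigonometric transforms: n sin (Y / n) is bounded, dominated by |Y| and converges to Y. *)
Lemma cvg_scaled_increment (f : R -> R) (l x : R) : is_derive (0 : R) (1 : R) f l ->
  n.+1%:R * (f (x / n.+1%:R) - f 0) @[n --> \oo] --> l * x.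
Proof.
move=> [df fl]; have [->|x0] := eqVneq x 0.
  rewrite mulr0; under eq_fun do rewrite mul0r subrr mulr0; exact: cvg_cst.
have u0 n : x / n.+1%:R != 0 by rewrite mulf_neq0// invr_eq0.
have uc : x / n.+1%:R @[n --> \oo] --> (0 : R).
  rewrite -(mulr0 x); apply: cvgM; [exact: cvg_cst|exact: cvg_harmonic].
have : h^-1 *: (f (h *: (1 : R) + 0) - f 0) @[h --> 0^'] --> l.
  by rewrite -fl; exact: df.
move/cvgr_dnbhsP => /(_ _ (conj u0 uc)) c.
have : ((x / n.+1%:R)^-1 *: (f ((x / n.+1%:R) *: (1 : R) + 0) - f 0)) * x @[n --> \oo] --> l * x.
  by apply: cvgM => //; exact: cvg_cst.
apply: cvg_trans; apply: near_eq_cvg; apply: nearW => n /=.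
rewrite addr0 [_ *: 1]mulr1 -[_ *: _]/(_ * _) invf_div.
by rewrite -!mulrA (mulrC _ x) !mulrA divfK.
Qed.

Lemma cvg_sin_scaled x : n.+1%:R * sin (x / n.+1%:R) @[n --> \oo] --> x.
Proof.
have := @cvg_scaled_increment sin (cos 0) x (is_derive_sin 0); rewrite cos0 mul1r sin0.
by under eq_fun do rewrite subr0; exact.
Qed.

Lemma cvg_expR_scaled x : n.+1%:R * (expR (x / n.+1%:R) - 1) @[n --> \oo] --> x.
Proof.
have := @cvg_scaled_increment expR (expR 0) x (is_derive_expR 0); rewrite expR0 mul1r; exact.
Qed.

Lemma sin_le_norm x : `|sin x| <= `|x|.
Proof.
have h y : 0 <= y -> `|sin y| <= y.
  move=> y0.
  have cs : {within `[0, y], continuous (@sin R)}.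
    exact/continuous_subspaceT/continuous_sin.
  have [c _] := MVT_segment y0 (fun z _ => is_derive_sin z) cs.
  rewrite sin0 !subr0 => ->; rewrite normrM (ger0_norm y0).
  by rewrite ler_piMl// cos_max.
have [x0|x0] := leP 0 x; first by rewrite (ger0_norm x0) h.
by rewrite -normrN -sinN -(normrN x) (ger0_norm (x := - x)) ?h//; lra.
Qed.

(* Real substitute for exp(i x): products of [cas] functions are again
   combinations of [cas] functions, and E sin(G) = 0 for a centered Gaussian G. *)
Definition cas x := cos x + sin x.

Lemma cas0 : cas 0 = 1.
Proof. by rewrite /cas cos0 sin0 addr0. Qed.

Lemma sin_cas x : sin x = (cas x - cas (- x)) / 2.
Proof. by rewrite /cas cosN sinN; field. Qed.

Lemma casMcos x y : cas x * cas y = cos (x - y) + sin (x + y).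
Proof. by rewrite cosB sinD /cas; ring. Qed.

Lemma casM x y : cas x * cas y =
  (cas (x - y) + cas (y - x) + cas (x + y) - cas (- (x + y))) / 2.
Proof.
by rewrite casMcos -(opprB x y) /cas !cosN !sinN; field.
Qed.

Lemma cas_bounded x : `|cas x| <= 2.
Proof.
rewrite (le_trans (ler_normD _ _))//.
by have := cos_max x; have := sin_max x; lra.
Qed.

Lemma continuous_cas : continuous cas.
Proof. by move=> x; apply: cvgD; [exact: continuous_cos|exact: continuous_sin]. Qed.

End TrigLimits.

Lemma scale_funAl (T : Type) (R : realType) (a : R) (Y Z : T -> R) :
  (a *: Y) * Z = a *: (Y * Z).
Proof. by apply/funext => w; rewrite !fctE -mulrA. Qed.

Lemma scale_funAr (T : Type) (R : realType) (a : R) (Y Z : T -> R) :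
  Y * (a *: Z) = a *: (Y * Z).
Proof. by apply/funext => w; rewrite !fctE mulrCA. Qed.

Section TrigSpan.
Context d (T : measurableType d) (R : realType) (P : probability T R) (p : nat).
Variable U : 'I_p -> T -> R.
Hypothesis mU : forall i, measurable_fun setT (U i).
Implicit Types s t : 'rV[R]_p.

Definition lin s (w : T) : R := \sum_i s 0 i * U i w.

Lemma linD s t w : lin (s + t) w = lin s w + lin t w.
Proof. by rewrite -big_split; apply: eq_bigr => i _; rewrite !mxE mulrDl. Qed.

Lemma linN s w : lin (- s) w = - lin s w.
Proof. by rewrite -sumrN; apply: eq_bigr => i _; rewrite !mxE mulNr. Qed.

Lemma lin0 w : lin 0 w = 0.
Proof. by rewrite /lin big1// => i _; rewrite mxE mul0r. Qed.

Lemma lin_delta a i w : lin (a *: delta_mx 0 i) w = a * U i w.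
Proof.
rewrite /lin (bigD1 i)//= big1 ?addr0; first by rewrite !mxE !eqxx mulr1.
by move=> j ji; rewrite !mxE (negbTE ji) andbF mulr0 mul0r.
Qed.

Lemma measurable_lin s : measurable_fun setT (lin s).
Proof. by apply: measurable_sum => i; apply: measurable_funM. Qed.

Definition cas_char s : T -> R := expR (dotr s s / 2) *: (fun w => cas (lin s w)).

(** Explicit lists of coefficients and frequencies let the quadratic forms over sequences, bounded
    above for powers of Gram matrices, apply as they stand to second moments. *)
Definition cas_span : set (T -> R) := [set Y | exists l : seq (R * 'rV[R]_p),
  Y = \sum_(a <- l) a.1 *: cas_char a.2].

Lemma cas_span_char a s : cas_span (a *: cas_char s).
Proof. by exists [:: (a, s)]; rewrite big_seq1. Qed.

Lemma cas_spanD Y Z : cas_span Y -> cas_span Z -> cas_span (Y + Z).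
Proof. by move=> [l ->] [k ->]; exists (l ++ k); rewrite big_cat. Qed.

Lemma cas_spanZ a Y : cas_span Y -> cas_span (a *: Y).
Proof.
move=> [l ->]; exists [seq (a * x.1, x.2) | x <- l].
by rewrite big_map scaler_sumr; apply: eq_bigr => x _; rewrite scalerA.
Qed.

Lemma cas_span_cas a s : cas_span (a *: (fun w => cas (lin s w))).
Proof.
have := cas_span_char (a / expR (dotr s s / 2)) s.
by rewrite /cas_char scalerA divfK// gt_eqF// expR_gt0.
Qed.

Lemma cas_span1 : cas_span 1.
Proof.
rewrite (_ : 1 = (1 : R) *: (fun w => cas (lin 0 w))); first exact: cas_span_cas.
by apply/funext => w; rewrite scale1r lin0 cas0.
Qed.

Lemma cas_span0 : cas_span 0.
Proof. by exists [::]; rewrite big_nil. Qed.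

Lemma cas_spanM Y Z : cas_span Y -> cas_span Z -> cas_span (Y * Z).
Proof.
move=> [l ->] [k ->].
elim/big_rec : _ => [|x V _ cV]; first by rewrite mul0r; exact: cas_span0.
rewrite mulrDl; apply: cas_spanD => // {cV}.
elim/big_rec : _ => [|y V' _ cV]; first by rewrite mulr0; exact: cas_span0.
rewrite mulrDr; apply: cas_spanD => // {cV}.
rewrite !(scale_funAl, scale_funAr); do 4 apply: cas_spanZ.
set s := x.2; set t := y.2; pose C u : T -> R := fun w => cas (lin u w).
rewrite (_ : _ * _ = 2^-1 *: C (s - t) + 2^-1 *: C (t - s) + 2^-1 *: C (s + t) +
   (- 2^-1) *: C (- (s + t))).
  by do 3 (apply: cas_spanD; last exact: cas_span_cas); exact: cas_span_cas.
apply/funext => w; rewrite !fctE casM /C !(linN, linD).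
by rewrite -![_ *: _]/(_ * _); field.
Qed.

Lemma cas_span_measurable Y : cas_span Y -> measurable_fun setT Y.
Proof.
move=> [l ->]; elim/big_rec : _ => [|x y _ my]; first exact: measurable_cst.
apply: measurable_funD => //; apply: measurable_funM => //; apply: measurable_funM => //.
apply: measurableT_comp; last exact: measurable_lin.
by apply: continuous_measurable_fun; exact: continuous_cas.
Qed.

Lemma cas_span_bounded Y : cas_span Y -> exists M : R, forall w, `|Y w| <= M.
Proof.
move=> [l ->]; elim/big_rec : _ => [|x y _ [M yM]].
  by exists 0 => w; rewrite normr0.
exists (`|x.1| * (expR (dotr x.2 x.2 / 2) * 2) + M) => w.
rewrite (le_trans (ler_normD _ _))// lerD// normrM ler_wpM2l// normrM.
by apply: ler_pM => //; [rewrite ger0_norm ?expR_ge0|exact: cas_bounded].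
Qed.

Lemma cas_span_sqint Y : cas_span Y -> sqint P Y.
Proof. exact: (gen_sqint P cas_span_measurable cas_span_bounded). Qed.

Lemma cas_span_sin a s : cas_span (a *: (fun w => sin (lin s w))).
Proof.
rewrite (_ : _ *: _ = (a / 2) *: (fun w => cas (lin s w)) +
    (- (a / 2)) *: (fun w => cas (lin (- s) w))).
  by apply: cas_spanD; exact: cas_span_cas.
apply/funext => w; rewrite !fctE linN sin_cas.
by rewrite -![_ *: _]/(_ * _); field.
Qed.

(** Each coordinate is the pointwise limit of n sin (U_i / n), a bounded element of the span, hence
    is measurable for the closure sets; so is every Borel function of the coordinates. *)
Lemma cas_span_dense (g : p.-tuple R -> R) : measurable_fun setT g ->
  sqint P (fun w => g [tuple U i w | i < p]) ->
  L2closure P cas_span (fun w => g [tuple U i w | i < p]).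
Proof.
pose D := g_sigma_algebraType (closure_sets P cas_span).
move=> mg; apply: (closure_measurable cas_span1 cas_spanD cas_spanZ cas_spanM
  cas_span_measurable cas_span_bounded).
apply: (@measurableT_comp _ _ _ D) => //.
apply/(@measurable_fun_tnthP _ _ D) => i.
rewrite (_ : _ \o _ = U i); last by apply/funext => w /=; rewrite tnth_mktuple.
apply: (@measurable_fun_cvg _ D _ _
  (fun n w => n.+1%:R * sin (U i w / n.+1%:R))) => [n|w _]; last exact: cvg_sin_scaled.
apply: (bounded_closure_measurable cas_span1 cas_spanD cas_spanZ cas_spanM
  cas_span_measurable cas_span_bounded).
apply: (gen_bounded_closure P cas_span_measurable cas_span_bounded).
rewrite (_ : (fun=> _) = n.+1%:R *:
   (fun w => sin (lin (n.+1%:R^-1 *: delta_mx 0 i) w))); first exact: cas_span_sin.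
by apply/funext => w; rewrite fctE lin_delta [_^-1 * _]mulrC.
Qed.

End TrigSpan.

Section GaussianPair.
Context d (T : measurableType d) (R : realType) (P : probability T R) (p : nat).
Implicit Types U V : 'I_p -> T -> R.
Implicit Types s t : 'rV[R]_p.

(* The joint law of two standard Gaussian vectors with cross-covariance M,
   through its characteristic function. *)
Definition gaussian_pair U V (M : 'M[R]_p) : Prop :=
  [/\ forall i, measurable_fun setT (U i),
      forall i, measurable_fun setT (V i),
      forall s t, \int[P]_w cos (lin U s w + lin V t w) =
        expR (- (dotr s s + dotr t t + 2 * bilr M s t) / 2) &
      forall s t, \int[P]_w sin (lin U s w + lin V t w) = 0].

Lemma bilrNr (M : 'M[R]_p) s t : bilr M s (- t) = - bilr M s t.
Proof.
rewrite /bilr -sumrN; apply: eq_bigr => i _; rewrite -sumrN.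
by apply: eq_bigr => j _; rewrite !mxE !mulrN.
Qed.

Lemma bilr0r (M : 'M[R]_p) s : bilr M s 0 = 0.
Proof.
by rewrite /bilr big1// => i _; rewrite big1// => j _; rewrite mxE !mulr0.
Qed.

Lemma dotrNN s : dotr (- s) (- s) = dotr s s.
Proof. by apply: eq_bigr => i _; rewrite !mxE mulrNN. Qed.

Lemma bilr1 s t : bilr 1%:M s t = dotr s t.
Proof.
apply: eq_bigr => i _; rewrite (bigD1 i)//= big1 ?addr0; first by rewrite mxE eqxx mul1r.
by move=> j ji; rewrite mxE eq_sym (negbTE ji) mul0r.
Qed.

Lemma dotr_delta s a i : dotr s (a *: delta_mx 0 i) = a * s 0 i.
Proof.
rewrite /dotr (bigD1 i)//= big1 ?addr0; first by rewrite !mxE !eqxx mulr1 mulrC.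
by move=> j ji; rewrite !mxE (negbTE ji) andbF !mulr0.
Qed.

Lemma bounded_continuous_integrable (f : R -> R) (M : R) (Y : T -> R) :
  continuous f -> (forall x, `|f x| <= M) -> measurable_fun setT Y ->
  P.-integrable setT (EFin \o (fun w => f (Y w))).
Proof.
move=> cf bf mY; apply: sqint_integrable; apply: (@bounded_sqint _ _ _ _ _ M) => //.
by apply: measurableT_comp => //; exact: continuous_measurable_fun.
Qed.

Lemma dotp_cas_char U V M s t : gaussian_pair U V M ->
  dotp P (cas_char U s) (cas_char V t) = expR (bilr M s t).
Proof.
move=> [mU mV Ecos Esin].
have mUs := measurable_lin mU s; have mVt := measurable_lin mV t.
have sU := cas_span_sqint P mU (cas_span_cas U 1 s).
have sV := cas_span_sqint P mV (cas_span_cas V 1 t).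
rewrite !scale1r in sU sV.
rewrite /cas_char dotpZl//; last exact: sqintZ.
rewrite dotpZr//.
have -> : dotp P (fun w => cas (lin U s w)) (fun w => cas (lin V t w)) =
    \int[P]_w (cos (lin U s w + lin V (- t) w) + sin (lin U s w + lin V t w)).
  by apply: eq_Rintegral => w _; rewrite casMcos linN.
have mUV u : measurable_fun setT (fun w => lin U s w + lin V u w).
  by apply: measurable_funD => //; exact: measurable_lin.
rewrite RintegralD//; last 2 first.
- by apply: (bounded_continuous_integrable (M := 1)) => //; [exact: continuous_cos|exact: cos_max].
- by apply: (bounded_continuous_integrable (M := 1)) => //; [exact: continuous_sin|exact: sin_max].
by rewrite Ecos Esin addr0 -!expRD bilrNr dotrNN; congr expR; field.
Qed.

Lemma cas_char0 U : cas_char U 0 = 1.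
Proof.
apply/funext => w; rewrite /cas_char !fctE lin0 cas0.
rewrite (_ : dotr 0 0 = 0) ?mul0r ?expR0 ?scale1r//.
by rewrite /dotr big1// => i _; rewrite mxE mul0r.
Qed.

(** Differentiating E(k_s(U) k_t(U)) = exp(s.t) in t_i at t = 0 gives s_i. The derivative is taken
    as a symmetric difference quotient, because n sin (U_i / n) converges to U_i in L^2. *)
Lemma dotp_cas_char_coord U s i : gaussian_pair U U 1%:M -> sqint P (U i) ->
  dotp P (cas_char U s) (U i) = s 0 i.
Proof.
move=> gU sUi; have [mU _ _ _] := gU.
have schar t : sqint P (cas_char U t).
  by rewrite -[cas_char U t]scale1r; exact: (cas_span_sqint P mU (cas_span_char U 1 t)).
pose F n : T -> R := fun w => n.+1%:R * sin (U i w / n.+1%:R).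
(* The sine is half the difference of two opposite [cas] functions; the exponential undoes the
   normalisation of the characters and tends to 1. *)
have FE n : F n = (n.+1%:R / 2 * expR (- (n.+1%:R^-1 ^+ 2 / 2))) *:
   (cas_char U (n.+1%:R^-1 *: delta_mx 0 i) - cas_char U (- (n.+1%:R^-1 *: delta_mx 0 i))).
  apply/funext => w; rewrite /F /cas_char !fctE dotrNN linN lin_delta -scalerBr scalerA.
  rewrite -[_ / 2 * _ * _]mulrA -expRD dotr_delta !mxE !eqxx mulr1 -expr2 addNr expR0 mulr1.
  by rewrite sin_cas [U i w / _]mulrC -[_ *: _]/(_ * _); field.
have [_ c] : sqint P (U i) /\ dotp P (F n - U i) (F n - U i) @[n --> \oo] --> 0.
  apply: (@dotp_dominated_cvg _ _ _ _ _ _ (fun w => `|U i w|)).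
  - move=> n; apply: measurable_funM => //; apply: measurableT_comp.
      by apply: continuous_measurable_fun; exact: continuous_sin.
    exact: measurable_funM.
  - by move=> w; exact: cvg_sin_scaled.
  - have [m I] := sUi; split; first exact: measurableT_comp.
    by apply: eq_integrable I => // w _ /=; rewrite real_normK// num_real.
  - move=> n w; rewrite /F normrM ger0_norm//.
    rewrite -ler_pdivlMl ?ltr0n// (le_trans (sin_le_norm _))// normrM mulrC.
    by rewrite ger0_norm.
have sF n : sqint P (F n) by rewrite FE; apply/sqintZ/sqintB.
have FG : dotp P (cas_char U s) (F n) @[n --> \oo] --> dotp P (cas_char U s) (U i).
  apply: (@dotp_cvg _ _ _ _ (fun=> cas_char U s)) => //.
  by under eq_fun do rewrite subrr dotp0l; exact: cvg_cst.
apply: (cvg_unique _ FG) => //.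
have -> : (fun n => dotp P (cas_char U s) (F n)) =
   (fun n => expR (- (n.+1%:R^-1 ^+ 2 / 2)) *
    ((n.+1%:R * (expR (s 0 i / n.+1%:R) - 1) - n.+1%:R * (expR (- s 0 i / n.+1%:R) - 1)) / 2)).
  apply/funext => n; rewrite FE dotpZr//; last exact: sqintB.
  rewrite dotpBr// !(dotp_cas_char _ _ gU) bilrNr bilr1 dotr_delta mulNr.
  rewrite [n.+1%:R^-1 * _]mulrC; ring.
have c1 : expR (- (n.+1%:R^-1 ^+ 2 / 2)) @[n --> \oo] --> expR (- (0 * 0 / 2) : R).
  apply: continuous_cvg; first exact: continuous_expR.
  by apply: cvgN; apply: cvgM; [apply: cvgM; exact: cvg_harmonic|exact: cvg_cst].
have c2 : n.+1%:R * (expR (s 0 i / n.+1%:R) - 1) - n.+1%:R * (expR (- s 0 i / n.+1%:R) - 1)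
    @[n --> \oo] --> s 0 i - - s 0 i.
  by apply: cvgB; exact: cvg_expR_scaled.
have c3 : (n.+1%:R * (expR (s 0 i / n.+1%:R) - 1) -
    n.+1%:R * (expR (- s 0 i / n.+1%:R) - 1)) / 2 @[n --> \oo] --> (s 0 i - - s 0 i) / 2.
  by apply: cvgM => //; exact: cvg_cst.
have E : expR (- (0 * 0 / 2)) * ((s 0 i - - s 0 i) / 2) = s 0 i.
  by rewrite !mul0r oppr0 expR0; field.
have := cvgM c1 c3; rewrite E; exact.
Qed.

End GaussianPair.

Section MehlerBound.
Context d (T : measurableType d) (R : realType) (P : probability T R) (p : nat).
Variables (U V : 'I_p -> T -> R) (M : 'M[R]_p) (e : R).
Hypothesis gU : gaussian_pair P U U 1%:M.
Hypothesis gV : gaussian_pair P V V 1%:M.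
Hypothesis gUV : gaussian_pair P U V M.
Hypothesis sU : forall i, sqint P (U i).
Hypothesis sV : forall i, sqint P (V i).
Hypothesis Me : forall i j, `|M i j| <= e.
Hypothesis pe1 : p%:R * e <= 1.

Let mU i : measurable_fun setT (U i).
Proof. by have [] := sU i. Qed.

Let mV i : measurable_fun setT (V i).
Proof. by have [] := sV i. Qed.

Lemma cvg_expR_forms I (r : seq I) J (q : seq J) (c : I -> R) (k : J -> R)
    (x : I -> J -> R) :
  \sum_(0 <= n < N) (n`!%:R^-1 * \sum_(a <- r) \sum_(b <- q) c a * k b * x a b ^+ n)
    @[N --> \oo] --> \sum_(a <- r) \sum_(b <- q) c a * k b * expR (x a b).
Proof.
have -> : (fun N => \sum_(0 <= n < N)
    (n`!%:R^-1 * \sum_(a <- r) \sum_(b <- q) c a * k b * x a b ^+ n)) =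
  (fun N => \sum_(a <- r) \sum_(b <- q) c a * k b * series (exp_coeff (x a b)) N).
  apply/funext => N; under eq_bigr => n _ do rewrite mulr_sumr.
  rewrite exchange_big; apply: eq_bigr => a _ /=.
  under eq_bigr => n _ do rewrite mulr_sumr.
  rewrite exchange_big; apply: eq_bigr => b _ /=.
  rewrite /series /= mulr_sumr; apply: eq_bigr => n _.
  by rewrite /exp_coeff /=; ring.
apply: cvg_sum_seq => a _; apply: cvg_sum_seq => b _.
apply: cvgM; [exact: cvg_cst|exact: is_cvg_series_exp_coeff].
Qed.

(* E(Y Z) minus the terms of degree 0 and 1 of the Hermite expansion. *)
Definition second_order_form (Y Z : T -> R) : R :=
  dotp P Y Z - dotp P Y 1 * dotp P Z 1 -
  \sum_i \sum_j M i j * (dotp P Y (U i) * dotp P Z (V j)).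

Lemma mehler_bound_span Y Z : cas_span U Y -> cas_span V Z ->
  `|second_order_form Y Z| <= (p%:R * e) ^+ 2 / 2 * (dotp P Y Y + dotp P Z Z).
Proof.
move=> [l ->] [k ->].
have schar (W : 'I_p -> T -> R) (mW : forall i, measurable_fun setT (W i)) t :
    sqint P (cas_char W t).
  by rewrite -[cas_char W t]scale1r; exact: (cas_span_sqint P mW (cas_span_char W 1 t)).
have scharZ (W : 'I_p -> T -> R) (mW : forall i, measurable_fun setT (W i)) a t :
    sqint P (a *: cas_char W t) by exact/sqintZ/schar.
have pair (W W' : 'I_p -> T -> R) N (x y : seq (R * 'rV[R]_p)) : gaussian_pair P W W' N ->
    dotp P (\sum_(a <- x) a.1 *: cas_char W a.2) (\sum_(b <- y) b.1 *: cas_char W' b.2) =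
    \sum_(a <- x) \sum_(b <- y) a.1 * b.1 * expR (bilr N a.2 b.2).
  move=> gW; have [mW mW' _ _] := gW.
  rewrite dotp_suml => [|a _|]; [|exact: scharZ|by apply: sqint_sum => b _; exact: scharZ].
  apply: eq_bigr => a _; rewrite dotp_sumr => [|b _|]; [|exact: scharZ|exact: scharZ].
  apply: eq_bigr => b _; rewrite dotpZl//; [|exact: schar|exact: scharZ].
  by rewrite dotpZr ?(dotp_cas_char _ _ gW) ?mulrA//; exact: schar.
have coord (W : 'I_p -> T -> R) (x : seq (R * 'rV[R]_p)) i : gaussian_pair P W W 1%:M ->
    sqint P (W i) ->
    dotp P (\sum_(a <- x) a.1 *: cas_char W a.2) (W i) = \sum_(a <- x) a.1 * a.2 0 i.
  move=> gW sW; have [mW _ _ _] := gW.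
  rewrite dotp_suml => [|a _|//]; last exact: scharZ.
  by apply: eq_bigr => a _; rewrite dotpZl ?dotp_cas_char_coord//; exact: schar.
have one (W : 'I_p -> T -> R) (x : seq (R * 'rV[R]_p)) : gaussian_pair P W W 1%:M ->
    dotp P (\sum_(a <- x) a.1 *: cas_char W a.2) 1 = \sum_(a <- x) a.1.
  move=> gW; have [mW _ _ _] := gW.
  rewrite dotp_suml => [|a _|]; [|exact: scharZ|exact: sqint1].
  apply: eq_bigr => a _; rewrite dotpZl; [|exact: schar|exact: sqint1].
  by rewrite -(cas_char0 W) (dotp_cas_char _ _ gW) bilr0r expR0 mulr1.
(* Up to the factor n!, these are the degree n parts of E(Y Z), E(Y^2) and E(Z^2). The degrees 0 and
   1 of the first are exactly what [second_order_form] subtracts. *)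
pose F n := \sum_(a <- l) \sum_(b <- k) a.1 * b.1 * bilr M a.2 b.2 ^+ n.
pose A n := \sum_(a <- l) \sum_(b <- l) a.1 * b.1 * dotr a.2 b.2 ^+ n.
pose B n := \sum_(a <- k) \sum_(b <- k) a.1 * b.1 * dotr a.2 b.2 ^+ n.
have F0 : F 0%N = (\sum_(a <- l) a.1) * (\sum_(b <- k) b.1).
  rewrite mulr_suml; apply: eq_bigr => a _; rewrite mulr_sumr.
  by apply: eq_bigr => b _; rewrite expr0 mulr1.
have F1 : F 1%N = \sum_i \sum_j M i j *
    ((\sum_(a <- l) a.1 * a.2 0 i) * (\sum_(b <- k) b.1 * b.2 0 j)).
  transitivity (\sum_(a <- l) \sum_(b <- k) \sum_i \sum_j
      M i j * ((a.1 * a.2 0 i) * (b.1 * b.2 0 j))).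
    apply: eq_bigr => a _; apply: eq_bigr => b _.
    rewrite expr1 /bilr mulr_sumr; apply: eq_bigr => i _.
    rewrite mulr_sumr; apply: eq_bigr => j _; ring.
  under eq_bigr => a _ do rewrite exchange_big.
  rewrite exchange_big; apply: eq_bigr => i _.
  under eq_bigr => a _ do rewrite exchange_big.
  rewrite exchange_big; apply: eq_bigr => j _.
  rewrite mulr_suml mulr_sumr; apply: eq_bigr => a _.
  by rewrite !mulr_sumr; apply: eq_bigr => b _.
rewrite /second_order_form (pair _ _ _ _ _ gUV) (pair _ _ _ _ _ gU) (pair _ _ _ _ _ gV).
rewrite !one// -F0.
under [X in _ - X]eq_bigr => i _ do under eq_bigr => j _ do rewrite !coord//.
rewrite -F1.
have cF := @cvg_expR_forms _ l _ k fst fst (fun a b => bilr M a.2 b.2).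
have cA := @cvg_expR_forms _ l _ l fst fst (fun a b => bilr 1%:M a.2 b.2).
have cB := @cvg_expR_forms _ k _ k fst fst (fun a b => bilr 1%:M a.2 b.2).
have A0 n : 0 <= A n by exact: (@gram_power_ge0 R p _ l snd n fst).
have B0 n : 0 <= B n by exact: (@gram_power_ge0 R p _ k snd n fst).
have pe0 : 0 <= p%:R * e.
  (* For p = 0 there is no entry of M to force 0 <= e, but the product vanishes. *)
  have [p0|p0] := posnP p; first by rewrite p0 mul0r.
  by rewrite mulr_ge0// (le_trans (normr_ge0 _) (Me (Ordinal p0) (Ordinal p0))).
have FAB n : `|F n| <= (p%:R * e) ^+ n / 2 * (A n + B n).
  exact: (@bilr_power_bound R p M e _ l snd _ k snd n fst fst).
pose S (G : nat -> R) N := \sum_(0 <= n < N) (n`!%:R^-1 * G n).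
(* From degree 2 on, (p e)^n <= (p e)^2 because p e <= 1. The terms of degree 0 and 1 of A and B are
   nonnegative and are added back, so that the right-hand side converges to full second moments. *)
have key N : `|S F (N + 2)%N - F 0%N - F 1%N| <=
    (p%:R * e) ^+ 2 / 2 * (S A (N + 2)%N + S B (N + 2)%N).
  rewrite /S addn2 !big_nat_recl//= fact0 invr1 !mul1r.
  rewrite (_ : _ + _ - _ - _ = \sum_(0 <= n < N) (n.+2`!%:R^-1 * F n.+2)); last by ring.
  apply: (@le_trans _ _ ((p%:R * e) ^+ 2 / 2 *
    (\sum_(0 <= n < N) (n.+2`!%:R^-1 * A n.+2) +
     \sum_(0 <= n < N) (n.+2`!%:R^-1 * B n.+2)))); last first.
    rewrite ler_wpM2l ?divr_ge0 ?sqr_ge0//.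
    have := A0 0%N; have := A0 1%N; have := B0 0%N; have := B0 1%N; lra.
  rewrite -big_split mulr_sumr.
  apply: le_trans (ler_norm_sum _ _ _) _; apply: ler_sum => n _ /=.
  rewrite normrM ger0_norm ?invr_ge0// -mulrDr mulrCA ler_wpM2l ?invr_ge0//.
  apply: le_trans (FAB _) _; rewrite ler_wpM2r ?addr_ge0// ler_pM2r//.
  by rewrite -addn2 exprD ler_piMl ?exprn_ge0// exprn_ile1.
have cS (G : nat -> R) l' : S G N @[N --> \oo] --> l' -> S G (N + 2)%N @[N --> \oo] --> l'.
  by move=> h; rewrite (cvg_shiftn 2 (S G)).
refine (le_cvg_seq _ _ key).
  apply: cvg_norm; apply: cvgB; last exact: cvg_cst.
  by apply: cvgB; last exact: cvg_cst; apply: cS; exact: cF.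
apply: cvgM; first exact: cvg_cst.
have E (x : seq (R * 'rV[R]_p)) N : S (fun n => \sum_(a <- x) \sum_(b <- x)
    a.1 * b.1 * dotr a.2 b.2 ^+ n) N =
  \sum_(0 <= n < N) (n`!%:R^-1 * \sum_(a <- x) \sum_(b <- x)
    a.1 * b.1 * bilr 1%:M a.2 b.2 ^+ n).
  apply: eq_bigr => n _; congr (_ * _); apply: eq_bigr => a _.
  by apply: eq_bigr => b _; rewrite bilr1.
apply: cvgD; apply: cS.
  by rewrite (funext (E l)); exact: cA.
by rewrite (funext (E k)); exact: cB.
Qed.

Lemma second_order_form_cvg (F G : nat -> T -> R) Y Z :
  (forall n, sqint P (F n)) -> (forall n, sqint P (G n)) -> sqint P Y -> sqint P Z ->
  dotp P (F n - Y) (F n - Y) @[n --> \oo] --> 0 ->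
  dotp P (G n - Z) (G n - Z) @[n --> \oo] --> 0 ->
  second_order_form (F n) (G n) @[n --> \oo] --> second_order_form Y Z.
Proof.
move=> sF sG sY sZ FY GZ.
have cst0 (W : T -> R) : dotp P (W - W) (W - W) @[n --> \oo] --> 0.
  by rewrite subrr dotp0l; exact: cvg_cst.
have cl (W : T -> R) : sqint P W -> dotp P (F n) W @[n --> \oo] --> dotp P Y W.
  by move=> sW; exact: (@dotp_cvg _ _ _ _ F (fun=> W)).
have cr (W : T -> R) : sqint P W -> dotp P (G n) W @[n --> \oo] --> dotp P Z W.
  by move=> sW; exact: (@dotp_cvg _ _ _ _ G (fun=> W)).
apply: cvgB.
  by apply: cvgB; [exact: dotp_cvg|apply: cvgM; [apply: cl|apply: cr]; exact: sqint1].
apply: cvg_sum_seq => i _; apply: cvg_sum_seq => j _.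
by apply: cvgM; [exact: cvg_cst|apply: cvgM; [exact: cl|exact: cr]].
Qed.

Lemma L2closure_seq (A : set (T -> R)) Y : L2closure P A Y ->
  exists F : nat -> T -> R, (forall n, A (F n)) /\
    ((forall Z, A Z -> sqint P Z) -> dotp P (F n - Y) (F n - Y) @[n --> \oo] --> 0).
Proof.
move=> [sY cY].
have /choice[F FA] : forall n : nat, exists Z, A Z /\ dotp P (Y - Z) (Y - Z) <= n.+1%:R^-1.
  by move=> n; have [//|Z AZ YZ] := cY n.+1%:R^-1; exists Z.
exists F; split => [n|AP]; first by have [] := FA n.
apply: (@squeeze_cvgr _ _ _ _ (cst 0) (@harmonic R)); last exact: cvg_harmonic.
  by apply: nearW => n; rewrite dotp_ge0 -opprB dotpNN; have [_] := FA n.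
exact: cvg_cst.
Qed.

Lemma mehler_bound Y Z : L2closure P (cas_span U) Y -> L2closure P (cas_span V) Z ->
  `|second_order_form Y Z| <= (p%:R * e) ^+ 2 / 2 * (dotp P Y Y + dotp P Z Z).
Proof.
move=> cY cZ; have [sY _] := cY; have [sZ _] := cZ.
have spU Y' (AY' : cas_span U Y') := cas_span_sqint P mU AY'.
have spV Y' (AY' : cas_span V Y') := cas_span_sqint P mV AY'.
have [F [FA /(_ spU) FY]] := L2closure_seq cY.
have [G [GA /(_ spV) GZ]] := L2closure_seq cZ.
have sF n := spU _ (FA n); have sG n := spV _ (GA n).
have c : `|second_order_form (F n) (G n)| @[n --> \oo] --> `|second_order_form Y Z|.
  by apply: cvg_norm; exact: second_order_form_cvg.
refine (le_cvg_seq c _ (fun n => mehler_bound_span (FA n) (GA n))).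
apply: cvgM; first exact: cvg_cst.
by apply: cvgD; exact: dotp_cvg.
Qed.

End MehlerBound.

(** * Normal laws *)

Section NormalIntegral.
Context {R : realType}.
Local Notation mu := (@lebesgue_measure R).
Implicit Types (m s t : R).

(** The density is identified almost everywhere with the Radon-Nikodym derivative, both having the
    same integral over every measurable set. *)
Lemma integral_normal_prob m s (f : measurableTypeR R -> \bar R) : s != 0 ->
  (normal_prob m s).-integrable setT f ->
  (\int[normal_prob m s]_x f x = \int[mu]_x (f x * (normal_pdf m s x)%:E))%E.
Proof.
move=> s0 intf.
rewrite -(Radon_Nikodym_change_of_variables (normal_prob_dominates m s))//=.
have mf := measurable_int _ intf.
apply: ae_eq_integral => //.
- apply: emeasurable_funM => //; apply: (measurable_int mu).
  by apply: Radon_Nikodym_integrable; exact: normal_prob_dominates.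
- apply: emeasurable_funM => //=; apply/measurableT_comp => //=.
  exact: measurable_normal_pdf.
- apply: ae_eqe_mul2l => /=.
  rewrite Radon_NikodymE//=; first exact: normal_prob_dominates.
  move=> dom; case: cid => /= h [h1 h2 h3].
  apply: integral_ae_eq => //=.
  + by apply/measurableT_comp => //; exact: measurable_normal_pdf.
  + by move=> E _ mE; rewrite -h3.
Qed.

Lemma normal_pdf_shift m s x : 0 < s ->
  normal_pdf m s (s * x + m) * s = normal_pdf 0 1 x.
Proof.
move=> s0; rewrite !normal_pdfE ?gt_eqF// /normal_fun /normal_peak.
have s1 : s != 0 by rewrite gt_eqF.
have -> : - (s * x + m - m) ^+ 2 / (s ^+ 2 *+ 2) = - (x - 0) ^+ 2 / (1 ^+ 2 *+ 2).
  by rewrite -(mulr_natr (s ^+ 2)) -(mulr_natr (1 ^+ 2)); field.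
have -> : (s ^+ 2 * pi *+ 2 : R) = s ^+ 2 * (1 ^+ 2 * pi *+ 2).
  by rewrite expr1n mul1r mulrnAr.
rewrite sqrtrM ?sqr_ge0// sqrtr_sqr gtr0_norm//.
set E := expR _; set r := (Num.sqrt _).
by rewrite invfM -!mulrA mulrC -!mulrA mulfV// mulr1.
Qed.

Lemma ge0_integral_normal_prob_affine m s (g : R -> R) M : 0 < s ->
  continuous g -> (forall x, 0 <= g x <= M) ->
  (\int[normal_prob m s]_x (g x)%:E = \int[normal_prob 0 1]_x (g (s * x + m))%:E)%E.
Proof.
move=> s0 cg gM.
have mg : measurable_fun setT g by exact: continuous_measurable_fun.
have cF : continuous (fun x : R => s * x + m).
  by move=> x; apply: cvgD; [apply: cvgM; [exact: cvg_cst|exact: cvg_id]|exact: cvg_cst].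
have cgF : continuous (fun x : R => g (s * x + m)).
  by move=> x; apply: continuous_comp; [exact: cF|exact: cg].
have intb (h : R -> R) (m' s' : R) : continuous h -> (forall x, 0 <= h x <= M) ->
    (normal_prob m' s').-integrable setT (fun x : measurableTypeR R => (h x)%:E).
  move=> ch hM; apply: measurable_bounded_integrable => //.
  - by rewrite (le_lt_trans (probability_le1 _ _))// ltry.
  - exact: continuous_measurable_fun.
  - exists M; split; first exact: num_real.
    move=> y My x _ /=; have /andP[h0 hM'] := hM x.
    by rewrite ger0_norm// (le_trans hM')// ltW.
have s1 : s != 0 by rewrite gt_eqF.
rewrite (integral_normal_prob s1 (intb g m s cg gM)).
rewrite (integral_normal_prob (oner_neq0 _)
  (intb (fun x => g (s * x + m)) 0 1 cgF (fun x => gM (s * x + m)))).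
have FE : (fun x : R^o => s * x + m)^`()%classic = cst s.
  apply/funext => x; rewrite derive1E deriveD// derive_cst addr0.
  by rewrite deriveMl// derive_id mulr1.
under eq_integral do rewrite -EFinM.
rewrite (@increasing_ge0_integration_by_substitutionT _ (fun x : R => s * x + m)
   (fun x => g x * normal_pdf m s x)).
- apply: eq_integral => x _; rewrite !fctE FE /= -EFinM -mulrA.
  by rewrite normal_pdf_shift.
- by move=> x y xy; rewrite ltrD2r ltr_pM2l.
- by rewrite FE => x; exact: cvg_cst.
- by rewrite FE; exact: is_cvg_cst.
- by rewrite FE; exact: is_cvg_cst.
- by move=> x; apply: derivableD => //.
- apply/cvgrNyPle => A; apply: filterS (nbhs_ninfty_le (num_real ((A - m) / s))) => x.
  by rewrite -lerBrDr [s * x]mulrC ler_pdivlMr.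
- apply/cvgryPge => A; apply: filterS (nbhs_pinfty_ge (num_real ((A - m) / s))) => x.
  by rewrite -lerBlDr [s * x]mulrC ler_pdivrMr.
- move=> x; apply: cvgM; first exact: cg.
  by apply: continuous_normal_pdf; rewrite gt_eqF.
- by move=> x; rewrite mulr_ge0 ?normal_pdf_ge0//; have /andP[] := gM x.
Qed.

End NormalIntegral.

Section GaussianExpectation.
Context {R : realType}.
Implicit Types (m v : R).

Local Notation gauss := (normal_prob (0 : R) 1).

Lemma bounded_continuous_prob_integrable d (T : measurableType d) (P : probability T R)
    (Y : T -> R) (g : R -> R) M : measurable_fun setT Y ->
  continuous g -> (forall x, `|g x| <= M) -> P.-integrable setT (fun w => (g (Y w))%:E).
Proof.
move=> mY cg gM; apply: sqint_integrable; apply: (@bounded_sqint _ _ _ _ _ M) => //.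
by apply: measurableT_comp => //; exact: continuous_measurable_fun.
Qed.

Lemma integral_prob_cst d (T : measurableType d) (P : probability T R) c :
  (\int[P]_x c%:E = c%:E)%E.
Proof. by rewrite integral_cst//= probability_setT mule1. Qed.

Lemma integral_prob_addr d (T : measurableType d) (P : probability T R)
    (h : T -> R) c : P.-integrable setT (EFin \o h) ->
  (\int[P]_x (h x + c)%:E = \int[P]_x (h x)%:E + c%:E)%E.
Proof.
move=> ih; under eq_integral do rewrite EFinD.
rewrite integralD//=; last exact: finite_measure_integrable_cst.
by rewrite integral_prob_cst.
Qed.

Lemma addeI_fin (a b : \bar R) (c : R) : (a + c%:E = b + c%:E)%E -> a = b.
Proof. by move=> /(congr1 (fun z => (z - c%:E)%E)); rewrite !addeK. Qed.

Lemma continuous_affine a b : continuous (fun x : R => a * x + b).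
Proof.
by move=> x; apply: cvgD; [apply: cvgM; [exact: cvg_cst|exact: cvg_id]|exact: cvg_cst].
Qed.

(** All Gaussian laws become images of one N(0, 1), so that limits in m and v are limits of
    integrands under a fixed measure. For v = 0 both sides equal g(m). *)
Lemma integral_gaussian_law m v (g : R -> R) M : 0 <= v -> continuous g ->
  (forall x, `|g x| <= M) ->
  (\int[gaussian_law m v]_x (g x)%:E = \int[gauss]_x (g (Num.sqrt v * x + m))%:E)%E.
Proof.
move=> v0 cg gM.
have mg : measurable_fun setT g by exact: continuous_measurable_fun.
have [v00|v00] := eqVneq v 0.
  rewrite /gaussian_law v00 eqxx integral_dirac//; last exact/measurable_EFinP.
  rewrite sqrtr0 diracT mul1e.
  under eq_integral do rewrite mul0r add0r.
  by rewrite integral_prob_cst.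
have s0 : 0 < Num.sqrt v by rewrite sqrtr_gt0 lt_def v00.
rewrite /gaussian_law (negbTE v00) /normal_law integral_distribution; last 2 first.
- exact/measurable_EFinP.
- by apply: (@bounded_continuous_prob_integrable _ _ (normal_prob m (Num.sqrt v))).
rewrite /=.
(* The affine change of variables is stated for nonnegative integrands, so it is applied to g + M
   and the constant is cancelled afterwards. *)
have gM' x : 0 <= g x + M <= M + M.
  by have := gM x; rewrite ler_norml => /andP[? ?]; lra.
have cgM : continuous (fun x => g x + M).
  by move=> x; apply: cvgD; [exact: cg|exact: cvg_cst].
have i1 : (normal_prob m (Num.sqrt v)).-integrable setT (fun x : measurableTypeR R => (g x)%:E).
  by apply: (@bounded_continuous_prob_integrable _ _ (normal_prob m (Num.sqrt v)) id).
have i2 : gauss.-integrable setT (fun x : measurableTypeR R => (g (Num.sqrt v * x + m))%:E).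
  apply: (bounded_continuous_prob_integrable gauss _ cg gM).
  by apply: continuous_measurable_fun; exact: continuous_affine.
apply: (@addeI_fin _ _ M).
refine (etrans (esym (integral_prob_addr M i1)) (etrans _ (integral_prob_addr M i2))).
exact: ge0_integral_normal_prob_affine s0 cgM gM'.
Qed.

Lemma Rintegral_gaussian_law d (T : measurableType d) (P : probability T R)
    (Y : T -> R) m v (g : R -> R) M : measurable_fun setT Y ->
  (forall B, measurable B -> P (Y @^-1` B) = gaussian_law m v B) ->
  0 <= v -> continuous g -> (forall x, `|g x| <= M) ->
  \int[P]_w g (Y w) = \int[gauss]_x g (Num.sqrt v * x + m).
Proof.
move=> mY lawY v0 cg gM; congr fine.
rewrite -(integral_gaussian_law m v0 cg gM).
have mg : measurable_fun setT g by exact: continuous_measurable_fun.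
pose Y' : {mfun T >-> R} :=
  MeasurableFun.Pack (MeasurableFun.Class (isMeasurableFun.Build _ _ _ _ Y mY)).
transitivity (\int[distribution P Y']_x (g x)%:E)%E; last first.
  by apply: eq_measure_integral => A mA _; exact: lawY.
rewrite integral_distribution//; first exact/measurable_EFinP.
exact: (bounded_continuous_prob_integrable P mY cg gM).
Qed.

End GaussianExpectation.

Section GaussianTransform.
Context {R : realType}.
Implicit Types (t z : R).
Local Notation mu := (@lebesgue_measure R).
Local Notation pdf := (@normal_pdf R 0 1).

(** The derivative of [cas]; its own derivative is - [cas]. *)
Definition dcas z : R := cos z - sin z.

Lemma dcas_bounded z : `|dcas z| <= 2.
Proof.
by rewrite (le_trans (ler_normB _ _))//; have := cos_max z; have := sin_max z; lra.
Qed.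

Lemma normal_pdf01E z : pdf z = normal_peak 1 * expR (- (z ^+ 2 / 2)).
Proof.
by rewrite normal_pdfE ?oner_eq0// /normal_fun subr0 expr1n mulNr.
Qed.

Lemma is_derive_pdf z : is_derive z 1 pdf (- z * pdf z).
Proof.
rewrite (funext normal_pdf01E); apply: is_derive_eq.
by rewrite -![_ *: _]/(_ * _); field.
Qed.

Lemma is_derive_cos_mul t z : is_derive z 1 (fun x => cos (t * x)) (- sin (t * z) * t).
Proof.
apply: (@is_derive1_comp _ cos (fun x => t * x) z).
by apply: is_derive_eq; rewrite -![_ *: _]/(_ * _); ring.
Qed.

Lemma is_derive_sin_mul t z : is_derive z 1 (fun x => sin (t * x)) (cos (t * z) * t).
Proof.
apply: (@is_derive1_comp _ sin (fun x => t * x) z).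
by apply: is_derive_eq; rewrite -![_ *: _]/(_ * _); ring.
Qed.

Lemma is_derive_cas_mul t z : is_derive z 1 (fun x => cas (t * x)) (t * dcas (t * z)).
Proof.
have -> : t * dcas (t * z) = - sin (t * z) * t + cos (t * z) * t by rewrite /dcas; ring.
by apply: is_deriveD; [exact: is_derive_cos_mul|exact: is_derive_sin_mul].
Qed.

Lemma is_derive_dcas_mul t z : is_derive z 1 (fun x => dcas (t * x)) (- t * cas (t * z)).
Proof.
have -> : - t * cas (t * z) = - sin (t * z) * t - cos (t * z) * t by rewrite /cas; ring.
by apply: is_deriveB; [exact: is_derive_cos_mul|exact: is_derive_sin_mul].
Qed.

(** The z-derivative of [dcas (t * z) * pdf z]. With F(t) the integral of [cas (t * z) * pdf z], its
    two terms integrate to - t F(t) and - F'(t), so the vanishing of its integral is the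
    differential equation for F. *)
Definition dcas_pdf' t z : R := - t * (cas (t * z) * pdf z) - z * dcas (t * z) * pdf z.

Lemma is_derive_dcas_pdf t z :
  is_derive z 1 (fun x => dcas (t * x) * pdf x) (dcas_pdf' t z).
Proof.
have d1 := is_derive_dcas_mul t z; have d2 := is_derive_pdf z.
apply: is_derive_eq; rewrite -![_ *: _]/(_ * _) /dcas_pdf'; ring.
Qed.

(** From |z| <= 1 + z^2 / 4 <= exp(z^2 / 4), the left-hand side is below a multiple of the N(0, 2)
    density. This yields both the integrability of z pdf(z) and the decay of boundary terms in the
    integration by parts. *)
Lemma abs_pdf_le z : `|z| * pdf z <= normal_peak 1 / normal_peak (Num.sqrt 2) *
  normal_pdf 0 (Num.sqrt 2) z.
Proof.
have s2 : Num.sqrt 2 != 0 :> R by rewrite gt_eqF// sqrtr_gt0.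
rewrite normal_pdf01E normal_pdfE// mulrA divfK ?gt_eqF ?normal_peak_gt0//.
rewrite mulrCA ler_pM2l ?normal_peak_gt0// /normal_fun subr0 sqr_sqrtr//.
have -> : - z ^+ 2 / (2 *+ 2) = - (z ^+ 2 / 2) + z ^+ 2 / 4 :> R.
  by rewrite -(mulr_natr 2 2) -natrM; field.
rewrite expRD mulrC ler_pM2l ?expR_gt0//.
apply: le_trans (expR_ge1Dx _); rewrite -(real_normK (num_real z)).
by have := sqr_ge0 (`|z| / 2 - 1); rewrite !expr2; lra.
Qed.

Lemma integrable_abs_pdf (h : R -> R) M : measurable_fun setT h ->
  (forall z, `|h z| <= M * `|z| * pdf z) -> mu.-integrable setT (EFin \o h).
Proof.
move=> mh hM.
have M0 : 0 <= M.
  have := le_trans (normr_ge0 _) (hM 1); rewrite normr1 mulr1.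
  by rewrite pmulr_lge0// normal_pdf01E mulr_gt0 ?expR_gt0 ?normal_peak_gt0.
apply: (@le_integrable _ _ _ mu setT measurableT _ (fun z =>
  ((M * (normal_peak 1 / normal_peak (Num.sqrt 2)))%:E * (normal_pdf 0 (Num.sqrt 2) z)%:E)%E)).
- exact/measurable_EFinP.
- move=> z _ /=; rewrite lee_fin (le_trans (hM z))// -!mulrA.
  rewrite (le_trans _ (ler_norm _))// ler_wpM2l//.
  by rewrite (le_trans (abs_pdf_le z))// mulrA.
- by apply: integrableZl => //; exact: integrable_normal_pdf.
Qed.

Lemma integrable_bounded_pdf (h : R -> R) M : measurable_fun setT h ->
  (forall z, `|h z| <= M * pdf z) -> mu.-integrable setT (EFin \o h).
Proof.
move=> mh hM.
apply: (@le_integrable _ _ _ mu setT measurableT _ (fun z => (M%:E * (pdf z)%:E)%E)).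
- exact/measurable_EFinP.
- by move=> z _ /=; rewrite lee_fin (le_trans (hM z))// ler_norm.
- by apply: integrableZl => //; exact: integrable_normal_pdf.
Qed.

Lemma continuous_mulr_comp (f : R -> R) t : continuous f -> continuous (fun x => f (t * x)).
Proof.
move=> cf x; apply: continuous_comp; last exact: cf.
by apply: cvgM; [exact: cvg_cst|exact: cvg_id].
Qed.

Lemma continuous_dcas : continuous dcas.
Proof. by move=> x; apply: cvgB; [exact: continuous_cos|exact: continuous_sin]. Qed.

Lemma continuous_pdf : continuous pdf.
Proof. by apply: continuous_normal_pdf; rewrite oner_eq0. Qed.

Lemma continuous_cas_pdf t : continuous (fun z => cas (t * z) * pdf z).
Proof.
move=> x; apply: cvgM; last exact: continuous_pdf.
by apply: continuous_mulr_comp; exact: continuous_cas.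
Qed.

Lemma continuous_zdcas_pdf t : continuous (fun z => z * dcas (t * z) * pdf z).
Proof.
move=> x; apply: cvgM; last exact: continuous_pdf.
apply: cvgM; first exact: cvg_id.
by apply: continuous_mulr_comp; exact: continuous_dcas.
Qed.

Lemma continuous_dcas_pdf' t : continuous (dcas_pdf' t).
Proof.
move=> x; apply: cvgB; last exact: continuous_zdcas_pdf.
by apply: cvgM; [exact: cvg_cst|exact: continuous_cas_pdf].
Qed.

Lemma integrable_cas_pdf t : mu.-integrable setT (EFin \o (fun z => cas (t * z) * pdf z)).
Proof.
apply: (@integrable_bounded_pdf _ 2).
  by apply: continuous_measurable_fun; exact: continuous_cas_pdf.
move=> z; rewrite normrM (ger0_norm (normal_pdf_ge0 _ _ _)).
by rewrite ler_wpM2r ?normal_pdf_ge0// cas_bounded.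
Qed.

Lemma zdcas_pdf_le t z : `|z * dcas (t * z) * pdf z| <= 2 * `|z| * pdf z.
Proof.
rewrite !normrM (ger0_norm (normal_pdf_ge0 _ _ _)) ler_wpM2r ?normal_pdf_ge0//.
by rewrite mulrC ler_wpM2r// dcas_bounded.
Qed.

Lemma integrable_zdcas_pdf t :
  mu.-integrable setT (EFin \o (fun z => z * dcas (t * z) * pdf z)).
Proof.
apply: (@integrable_abs_pdf _ 2); last exact: zdcas_pdf_le.
by apply: continuous_measurable_fun; exact: continuous_zdcas_pdf.
Qed.

Lemma integrable_dcas_pdf' t : mu.-integrable setT (EFin \o dcas_pdf' t).
Proof.
have h : mu.-integrable setT (fun z => ((- t)%:E * (cas (t * z) * pdf z)%:E)%E).
  by apply: integrableZl => //; exact: integrable_cas_pdf.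
by have := integrableB measurableT h (integrable_zdcas_pdf t).
Qed.

End GaussianTransform.

Section GaussianCas.
Context {R : realType}.
Implicit Types (t z : R).
Local Notation mu := (@lebesgue_measure R).
Local Notation pdf := (@normal_pdf R 0 1).

Lemma cvg_Rintegral_itv (f : R -> R) : mu.-integrable setT (EFin \o f) ->
  \int[mu]_(x in `[- n.+1%:R, n.+1%:R]) f x @[n --> \oo] --> \int[mu]_x f x.
Proof.
move=> intf; have mf : measurable_fun setT f.
  by apply/measurable_EFinP; exact: measurable_int intf.
under eq_fun do rewrite Rintegral_mkcond.
apply: (@dominated_Rintegral _ _ _ mu _ _ (fun x => `|f x|)).
- move=> n; apply: (measurable_restrictT _ _).1 => //; exact: measurable_funTS.
- move=> x; apply: cvg_near_cst; near=> n; rewrite patchE mem_set//=.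
  rewrite in_itv/= -ler_norml; near: n; exists (Num.bound `|x|) => // n /= xn.
  by rewrite (le_trans (ltW (archi_boundP _)))// ler_nat leqW.
- exact: (integrable_norm intf).
- move=> n x; rewrite patchE; case: ifP => // _; rewrite normr0//.
Unshelve. all: end_near. Qed.

(** The fundamental theorem of calculus on [-n, n] leaves two boundary values, each O(1 / n) because
    |z| pdf(z) is bounded. *)
Lemma Rintegral_dcas_pdf' t : \int[mu]_z dcas_pdf' t z = 0.
Proof.
have ftc n : \int[mu]_(x in `[- n.+1%:R, n.+1%:R]) dcas_pdf' t x =
   dcas (t * n.+1%:R) * pdf n.+1%:R - dcas (t * - n.+1%:R) * pdf (- n.+1%:R).
  have nn : - n.+1%:R < n.+1%:R :> R by rewrite -subr_gt0 opprK addr_gt0.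
  have cH : continuous (fun x => dcas (t * x) * pdf x).
    move=> x; apply: cvgM; last exact: continuous_pdf.
    by apply: continuous_mulr_comp; exact: continuous_dcas.
  rewrite /Rintegral (continuous_FTC2 (F := fun x => dcas (t * x) * pdf x) nn)//.
  - by apply: continuous_subspaceT; exact: continuous_dcas_pdf'.
  - split.
    + by move=> x _; have [] := is_derive_dcas_pdf t x.
    + by apply: cvg_at_right_filter; exact: cH.
    + by apply: cvg_at_left_filter; exact: cH.
  - by move=> x _; rewrite derive1E; have [_ ->] := is_derive_dcas_pdf t x.
have c := cvg_Rintegral_itv (integrable_dcas_pdf' t).
rewrite (funext ftc) in c.
apply: (cvg_unique _ c) => //.
pose K : R := normal_peak 1 / normal_peak (Num.sqrt 2) * normal_peak (Num.sqrt 2).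
have s2 : Num.sqrt 2 != 0 :> R by rewrite gt_eqF// sqrtr_gt0.
have pdfn z n : `|z| = n.+1%:R -> `|dcas (t * z) * pdf z| <= 2 * K * n.+1%:R^-1.
  move=> zn; rewrite normrM (ger0_norm (normal_pdf_ge0 _ _ _)) -mulrA.
  apply: ler_pM => //; [exact: normal_pdf_ge0|exact: dcas_bounded|].
  rewrite ler_pdivlMr// mulrC -zn (le_trans (abs_pdf_le z))//.
  by rewrite ler_wpM2l ?normal_pdf_ub// divr_ge0 ?normal_peak_ge0.
apply: norm_cvg0; apply: (@squeeze_cvgr _ _ _ _ (cst 0)
  (fun n => 2 * K * n.+1%:R^-1 + 2 * K * n.+1%:R^-1)).
- apply: nearW => n; rewrite normr_ge0/= (le_trans (ler_normB _ _))// lerD// pdfn//.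
    by rewrite ger0_norm.
  by rewrite normrN ger0_norm.
- exact: cvg_cst.
- rewrite -[X in _ --> X]addr0 -(mulr0 (2 * K)).
  by apply: cvgD; apply: cvgM; try exact: cvg_cst; exact: cvg_harmonic.
Qed.

(* Differentiating under the integral and integrating by parts, the transform F
   satisfies F' = - t F. *)
Lemma Rintegral_cas_pdf t : \int[mu]_z (cas (t * z) * pdf z) = expR (- (t ^+ 2 / 2)).
Proof.
pose F t := \int[mu]_z (cas (t * z) * pdf z).
have dF (s : R) : is_derive s (1 : R) F (- s * F s).
  pose f (x z : R) := cas (x * z) * pdf z.
  have df (x z : R) : is_derive x (1 : R) (f ^~ z) (z * dcas (x * z) * pdf z).
    rewrite (_ : f ^~ z = (fun y => pdf z * cas (z * y))); last first.
      by apply/funext => y; rewrite /f mulrC [z * y]mulrC.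
    have d1 := is_derive_cas_mul z x.
    by apply: is_derive_eq; rewrite -![_ *: _]/(_ * _) [x * z]mulrC; ring.
  have dfE : partial1of2 f = fun x z => z * dcas (x * z) * pdf z.
    apply/funext => x; apply/funext => z; rewrite partial1of2E.
    by have [_ ->] := df x z.
  have iab : mu.-integrable setT (EFin \o (fun z => 2 * `|z| * pdf z)).
    apply: (@integrable_abs_pdf _ _ 2) => [|z]; last first.
      by rewrite ger0_norm// mulr_ge0 ?normal_pdf_ge0// mulr_ge0.
    apply: measurable_funM; last exact: measurable_normal_pdf.
    by apply: measurable_funM => //; exact: measurableT_comp.
  have s0 : s \in `]s - 1, s + 1[ by rewrite in_itv/=; apply/andP; split; lra.
  have G0 z : 0 <= 2 * `|z| * pdf z by rewrite mulr_ge0 ?normal_pdf_ge0// mulr_ge0.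
  have Gub x z : `]s - 1, s + 1[%classic x -> setT z -> `|partial1of2 f x z| <= 2 * `|z| * pdf z.
    by move=> _ _; rewrite dfE zdcas_pdf_le.
  have intf x : `]s - 1, s + 1[%classic x -> mu.-integrable setT (EFin \o f x).
    by move=> _; exact: integrable_cas_pdf.
  have der x z : `]s - 1, s + 1[%classic x -> setT z -> derivable (f ^~ z) x 1.
    by move=> _ _; have [] := df x z.
  have D1 := derivable_under_integral measurableT s0 intf der G0 iab Gub.
  have D2 := differentiation_under_integral measurableT s0 intf der G0 iab Gub.
  apply: DeriveDef => //; rewrite -derive1E D2.
  have := Rintegral_dcas_pdf' s; rewrite /dcas_pdf' RintegralB//; last 2 first.
  - by have := integrableZl measurableT (- s) (integrable_cas_pdf s).
  - exact: integrable_zdcas_pdf.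
  rewrite RintegralZl//; last exact: integrable_cas_pdf.
  by move/eqP; rewrite subr_eq0 => /eqP ->; rewrite dfE.
have F0 : F 0 = 1.
  rewrite /F; under eq_Rintegral do rewrite mul0r cas0 mul1r.
  by rewrite /Rintegral integral_normal_pdf.
have cE : F t * expR (t ^+ 2 / 2) = F 0 * expR (0 ^+ 2 / 2).
  apply: (@is_derive_0_is_cst _ (fun t => F t * expR (t ^+ 2 / 2))) => s.
  have d1 := dF s.
  by apply: is_derive_eq; rewrite -![_ *: _]/(_ * _); field.
move: cE; rewrite F0 expr0n mul0r expR0 mulr1 /F => cE.
by apply: (mulIf (lt0r_neq0 (expR_gt0 (t ^+ 2 / 2)))); rewrite cE -expRD addNr expR0.
Qed.

End GaussianCas.

Section GaussianCharacteristic.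
Context d (T : measurableType d) (R : realType) (P : probability T R).
Local Notation gauss := (normal_prob (0 : R) 1).
Implicit Types (t m v : R).

Lemma Rintegral_gauss_cas t : \int[gauss]_z cas (t * z) = expR (- (t ^+ 2 / 2)).
Proof.
rewrite -Rintegral_cas_pdf; congr fine.
rewrite integral_normal_prob ?oner_eq0//.
apply: (@bounded_continuous_prob_integrable _ _ _ gauss (fun z => t * z) cas 2).
- by apply: measurable_funM.
- exact: continuous_cas.
- exact: cas_bounded.
Qed.

Variables (Y : T -> R) (m v : R).
Hypothesis mY : measurable_fun setT Y.
Hypothesis lawY : forall B, measurable B -> P (Y @^-1` B) = gaussian_law m v B.
Hypothesis v0 : 0 <= v.

Let int_cas t : P.-integrable setT (EFin \o (fun w => cas (t * Y w))).
Proof.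
apply: (@bounded_continuous_prob_integrable _ _ _ P (fun z => t * Y z) cas 2).
- by apply: measurable_funM.
- exact: continuous_cas.
- exact: cas_bounded.
Qed.

Lemma gaussian_cas t : \int[P]_w cas (t * Y w) = cas (t * m) * expR (- (t ^+ 2 * v / 2)).
Proof.
rewrite (@Rintegral_gaussian_law _ _ _ P Y m v (fun x => cas (t * x)) 2)//; last 2 first.
- exact: continuous_mulr_comp continuous_cas.
- by move=> x; exact: cas_bounded.
pose s := t * Num.sqrt v.
(* As cas (x + y) = cos y cas x + sin y cas (- x), only the transform of N(0, 1) enters. *)
transitivity (\int[gauss]_z (cos (t * m) * cas (s * z) + sin (t * m) * cas (- s * z))).
  apply: eq_Rintegral => z _.
  rewrite mulrDr mulrA -/s /cas mulNr cosN sinN cosD sinD; ring.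
have ic (r : R) : gauss.-integrable setT (EFin \o (fun z : measurableTypeR R => cas (r * z))).
  apply: (@bounded_continuous_prob_integrable _ _ _ gauss (fun z => r * z) cas 2).
  - by apply: measurable_funM.
  - exact: continuous_cas.
  - exact: cas_bounded.
rewrite RintegralD//; last 2 first.
- by have := integrableZl measurableT (cos (t * m)) (ic s).
- by have := integrableZl measurableT (sin (t * m)) (ic (- s)).
rewrite (RintegralZl _ measurableT (ic s)) (RintegralZl _ measurableT (ic (- s))).
rewrite !Rintegral_gauss_cas sqrrN -mulrDl.
by rewrite /s exprMn sqr_sqrtr.
Qed.

Lemma gaussian_cos t : \int[P]_w cos (t * Y w) = cos (t * m) * expR (- (t ^+ 2 * v / 2)).
Proof.
transitivity (\int[P]_w (2^-1 * cas (t * Y w) + 2^-1 * cas (- t * Y w))).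
  by apply: eq_Rintegral => w _; rewrite /cas !(mulNr t) cosN sinN; field.
rewrite RintegralD//; last 2 first.
- by have := integrableZl measurableT 2^-1 (int_cas t).
- by have := integrableZl measurableT 2^-1 (int_cas (- t)).
rewrite (RintegralZl _ measurableT (int_cas t)) (RintegralZl _ measurableT (int_cas (- t))).
rewrite !gaussian_cas.
by rewrite sqrrN /cas !(mulNr t) cosN sinN; field.
Qed.

Lemma gaussian_sin t : \int[P]_w sin (t * Y w) = sin (t * m) * expR (- (t ^+ 2 * v / 2)).
Proof.
transitivity (\int[P]_w (2^-1 * cas (t * Y w) + (- 2^-1) * cas (- t * Y w))).
  by apply: eq_Rintegral => w _; rewrite /cas !(mulNr t) cosN sinN; field.
rewrite RintegralD//; last 2 first.
- by have := integrableZl measurableT 2^-1 (int_cas t).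
- by have := integrableZl measurableT (- 2^-1) (int_cas (- t)).
rewrite (RintegralZl _ measurableT (int_cas t)) (RintegralZl _ measurableT (int_cas (- t))).
rewrite !gaussian_cas.
by rewrite sqrrN /cas !(mulNr t) cosN sinN; field.
Qed.

Hypothesis sY : sqint P Y.

Let cvg_inv2 : (n.+1%:R^-1 : R) ^+ 2 @[n --> \oo] --> (0 : R).
Proof.
rewrite -[X in _ --> X](mulr0 0) (_ : (fun n => _) = (fun n => n.+1%:R^-1 * n.+1%:R^-1 : R)).
  by apply: cvgM; exact: cvg_harmonic.
by apply/funext => n; rewrite expr2.
Qed.

Let cvg_weight : expR (- (n.+1%:R^-1 ^+ 2 * v / 2)) @[n --> \oo] --> (1 : R).
Proof.
have c1 : n.+1%:R^-1 ^+ 2 * v @[n --> \oo] --> 0 * v.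
  by apply: cvgM; [exact: cvg_inv2|exact: cvg_cst].
have c2 : n.+1%:R^-1 ^+ 2 * v / 2 @[n --> \oo] --> 0 * v / 2.
  by apply: cvgM; [exact: c1|exact: cvg_cst].
have c3 : - (n.+1%:R^-1 ^+ 2 * v / 2) @[n --> \oo] --> - (0 * v / 2) by exact: cvgN.
rewrite !mul0r oppr0 in c3.
by rewrite -[X in _ --> X]expR0; apply: continuous_cvg; first exact: continuous_expR.
Qed.

(** In the definition of a Gaussian process the parameters of each law are only asserted to exist;
    this lemma and the next identify them with moments. The bounded functions n sin (Y / n) have
    known expectations and converge to Y under the domination |Y|. *)
Lemma gaussian_mean : \int[P]_w Y w = m.
Proof.
have c : \int[P]_w (n.+1%:R * sin (Y w / n.+1%:R)) @[n --> \oo] --> \int[P]_w Y w.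
  apply: (@dominated_Rintegral _ _ _ P _ _ (fun w => `|Y w|)).
  - move=> n; apply: measurable_funM => //; apply: measurableT_comp.
      by apply: continuous_measurable_fun; exact: continuous_sin.
    exact: measurable_funM.
  - by move=> w; exact: cvg_sin_scaled.
  - by apply: integrable_norm; exact: sqint_integrable.
  - move=> n w; rewrite normrM ger0_norm//.
    rewrite -ler_pdivlMl ?ltr0n// (le_trans (sin_le_norm _))// normrM mulrC.
    by rewrite ger0_norm.
apply: (cvg_unique _ c) => //.
have E n : \int[P]_w (n.+1%:R * sin (Y w / n.+1%:R)) =
    (n.+1%:R * sin (m / n.+1%:R)) * expR (- (n.+1%:R^-1 ^+ 2 * v / 2)).
  rewrite RintegralZl//; last first.
    apply: (@bounded_continuous_prob_integrable _ _ _ P (fun w => Y w / n.+1%:R) sin 1).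
    - exact: measurable_funM.
    - exact: continuous_sin.
    - exact: sin_max.
  under eq_Rintegral do rewrite mulrC.
  by rewrite gaussian_sin [_^-1 * m]mulrC mulrA.
have c2 : n.+1%:R * sin (m / n.+1%:R) * expR (- (n.+1%:R^-1 ^+ 2 * v / 2))
    @[n --> \oo] --> m * 1 by apply: cvgM; [exact: cvg_sin_scaled|exact: cvg_weight].
by rewrite (funext E); rewrite mulr1 in c2.
Qed.

Lemma gaussian_variance : m = 0 -> dotp P Y Y = v.
Proof.
move=> m0.
(* The square of h_n is 2 (n + 1)^2 (1 - cos (Y / (n + 1))), whose expectation is known; the
   argument is halved for the sake of this double-angle formula. *)
pose h n w : R := 2 * n.+1%:R * sin (Y w / 2 / n.+1%:R).
have hY n w : `|h n w| <= `|Y w|.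
  rewrite /h normrM ger0_norm// -ler_pdivlMl ?mulr_gt0 ?ltr0n//.
  rewrite (le_trans (sin_le_norm _))// -mulrA -invfM normrM.
  by rewrite [leRHS]mulrC ler_wpM2l// ger0_norm.
have c : \int[P]_w (h n w * h n w) @[n --> \oo] --> \int[P]_w (Y w * Y w).
  apply: (@dominated_Rintegral _ _ _ P _ _ (fun w => Y w * Y w)).
  - have mh n : measurable_fun setT (h n).
      apply: measurable_funM => //; apply: measurableT_comp.
        by apply: continuous_measurable_fun; exact: continuous_sin.
      by apply: measurable_funM => //; exact: measurable_funM.
    by move=> n; exact: measurable_funM.
  - have hc w : h n w @[n --> \oo] --> Y w.
      rewrite (_ : Y w = 2 * (Y w / 2)); last by field.
      under eq_fun do rewrite /h -mulrA.
      by apply: cvgM; [exact: cvg_cst|exact: cvg_sin_scaled].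
    by move=> w; exact: cvgM.
  - exact: sqintM_integrable.
  - move=> n w; rewrite normrM (le_trans (ler_pM _ _ (hY n w) (hY n w)))//.
    by rewrite -normrM ger0_norm// -expr2 sqr_ge0.
apply: (cvg_unique _ c) => //.
have E n : \int[P]_w (h n w * h n w) =
    - 2 * (n.+1%:R ^+ 2 * (expR (- (v / 2) / n.+1%:R ^+ 2) - 1)).
  transitivity (\int[P]_w (2 * n.+1%:R ^+ 2 * (1 - cos (n.+1%:R^-1 * Y w)))).
    apply: eq_Rintegral => w _; rewrite /h.
    rewrite (_ : n.+1%:R^-1 * Y w = (Y w / 2 / n.+1%:R) *+ 2); last first.
      by rewrite -mulr_natr; field.
    by rewrite cos_mulr2n cos2sin2; ring.
  have ic : P.-integrable setT (EFin \o (fun w => cos (n.+1%:R^-1 * Y w))).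
    apply: (@bounded_continuous_prob_integrable _ _ _ P (fun w => n.+1%:R^-1 * Y w) cos 1).
    - exact: measurable_funM.
    - exact: continuous_cos.
    - exact: cos_max.
  have i1 : P.-integrable setT (EFin \o (fun w => 1 - cos (n.+1%:R^-1 * Y w))).
    by have := integrableB measurableT (finite_measure_integrable_cst P 1 measurableT) ic.
  rewrite RintegralZl// RintegralB//; last exact: finite_measure_integrable_cst.
  rewrite Rintegral_cst//= probability_setT /= mulr1 gaussian_cos m0 mulr0 cos0 mul1r.
  rewrite (_ : - (n.+1%:R^-1 ^+ 2 * v / 2) = - (v / 2) / n.+1%:R ^+ 2); first by ring.
  by field.
have c2 : (n.+1%:R ^+ 2 * (expR (- (v / 2) / n.+1%:R ^+ 2) - 1) : R) @[n --> \oo] --> - (v / 2).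
  (* The limit of k (exp (x / k) - 1) is taken along the squares k = (n + 1)^2; the index n n + n +
     n has the successor (n + 1)^2. *)
  have -> : (fun n : nat => n.+1%:R ^+ 2 * (expR (- (v / 2) / n.+1%:R ^+ 2) - 1) : R) =
      (fun n => n.+1%:R * (expR (- (v / 2) / n.+1%:R) - 1)) \o (fun n => n * n + n + n)%N.
    apply/funext => n /=; rewrite (_ : (n * n + n + n).+1%:R = n.+1%:R ^+ 2 :> R)//.
    by rewrite -!natr1 !natrD natrM; ring.
  have k : (n * n + n + n)%N @[n --> \oo] --> \oo.
    by move=> A [N _ NA]; exists N => // n /= Nn; apply: NA => /=; rewrite (leq_trans Nn)// leq_addl.
  exact: cvg_comp k (@cvg_expR_scaled R (- (v / 2))).
have c3 : - 2 * (n.+1%:R ^+ 2 * (expR (- (v / 2) / n.+1%:R ^+ 2) - 1))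
    @[n --> \oo] --> - 2 * - (v / 2).
  by apply: cvgM => //; exact: cvg_cst.
rewrite (funext E); move: c3; rewrite (_ : - 2 * - (v / 2) = v)//.
by field.
Qed.

End GaussianCharacteristic.

(** * Stability of Gaussian limits under L^2-small perturbations *)

Section Slutsky.
Context {R : realType}.
Local Notation gauss := (normal_prob (0 : R) 1).

(** Only y is confined to the compact interval, since the perturbed value z may leave it; a
    near-covering of the interval provides one radius for all y. *)
Lemma continuous_uniform_itv (g : R -> R) (K e : R) : continuous g -> 0 < e ->
  exists2 r : R, 0 < r & forall y z, `|y| <= K -> `|z - y| < r -> `|g z - g y| <= e.
Proof.
move=> cg e0.
have cK : compact `[- K, K]%classic by exact: segment_compact.
pose Q (r y : R) := forall z, `|z - y| < r -> `|g z - g y| <= e.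
have : \forall r \near (0 : R)^'+, `[- K, K]%classic `<=` Q r.
  have /compact_near_coveringP/(_ _ _ Q) := cK; apply=> x _.
  have e2 : 0 < e / 2 by rewrite divr_gt0.
  have /cvgrPdist_lt/(_ _ e2) := cg x.
  rewrite -nbhs_ballE => -[r /= r0 rg].
  exists (ball x (r / 2), [set d : R | d < r / 2]).
    split; first by apply: nbhsx_ballx; rewrite divr_gt0.
    by apply: nbhs_right_lt; rewrite divr_gt0.
  move=> [y d'] /= [xy dr] z zy.
  have gy : `|g x - g y| < e / 2.
    by apply: rg; apply: le_ball xy; lra.
  have gz : `|g x - g z| < e / 2.
    apply: rg; rewrite -ball_normE /= in xy *.
    rewrite (_ : x - z = (x - y) - (z - y)); last by ring.
    by rewrite (le_lt_trans (ler_normB _ _))//; lra.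
  rewrite (_ : g z - g y = (g x - g y) - (g x - g z)); last by ring.
  by rewrite (le_trans (ler_normB _ _))//; lra.
move=> H; have [r [/= r0 rQ]] := filter_ex (filterI (nbhs_right_gt (0 : R)) H).
exists r => // y z yK zy; apply: rQ => //=.
by rewrite in_itv/= -ler_norml.
Qed.

Context d (T : measurableType d) (P : probability T R).

(* The limit of the laws of Y n is obtained by rescaling a fixed N(0, 1), which
   covers a vanishing limit variance as well. *)
Lemma slutsky_gaussian (Y Z : nat -> T -> R) (v : nat -> R) (v' : R) :
  (forall n, sqint P (Y n)) -> (forall n, sqint P (Z n)) ->
  (forall n B, measurable B -> P (Y n @^-1` B) = gaussian_law 0 (v n) B) ->
  (forall n, 0 <= v n) -> (forall n, dotp P (Y n) (Y n) = v n) ->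
  v n @[n --> \oo] --> v' ->
  dotp P (Z n - Y n) (Z n - Y n) @[n --> \oo] --> 0 ->
  cvg_in_law P Z (gaussian_law 0 v').
Proof.
move=> sY sZ lawY v0 vE vv' ZY g cg [M0 [_ gM0]].
pose M := `|M0| + 1.
have gM x : `|g x| <= M by apply: gM0 => //; rewrite (le_lt_trans (ler_norm _))// ltrDl.
have M1 : 0 < M by rewrite ltr_wpDl.
have v'0 : 0 <= v'.
  by apply: (le_cvg_seq (f := cst 0) _ vv') => //; exact: cvg_cst.
have mg : measurable_fun setT g by exact: continuous_measurable_fun.
have mY n : measurable_fun setT (Y n) by have [] := sY n.
have mZ n : measurable_fun setT (Z n) by have [] := sZ n.
have iY n := bounded_continuous_prob_integrable P (mY n) cg gM.
have iZ n := bounded_continuous_prob_integrable P (mZ n) cg gM.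
rewrite (integral_gaussian_law 0 v'0 cg gM).
have maff a : measurable_fun setT (fun x : measurableTypeR R => a * x + 0).
  by apply: continuous_measurable_fun; exact: continuous_affine.
have iG a := bounded_continuous_prob_integrable gauss (maff a) cg gM.
have cY : \int[P]_w g (Y n w) @[n --> \oo] --> \int[gauss]_x g (Num.sqrt v' * x + 0).
  under eq_fun do rewrite (Rintegral_gaussian_law (mY _) (lawY _) (v0 _) cg gM).
  apply: (@dominated_Rintegral _ _ _ gauss _ _ (cst M)).
  - by move=> n; apply: measurableT_comp.
  - move=> x; apply: continuous_cvg; first exact: cg.
    apply: cvgD; last exact: cvg_cst.
    apply: cvgM; last exact: cvg_cst.
    by apply: continuous_cvg => //; exact: sqrt_continuous.
  - exact: finite_measure_integrable_cst.
  - by move=> n x; exact: gM.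
have cZY : \int[P]_w g (Z n w) - \int[P]_w g (Y n w) @[n --> \oo] --> 0.
  have [V V1 vV] : exists2 V, 0 < V & forall n, v n <= V.
    have /cvg_seq_bounded[V0 [_ vV0]] : cvgn v by apply/cvg_ex; exists v'.
    exists (`|V0| + 1); first by rewrite ltr_wpDl.
    move=> n; apply: le_trans (ler_norm _) _; apply: vV0 => //.
    by rewrite (le_lt_trans (ler_norm _))// ltrDl.
  apply/cvgr0Pnorm_lt => e e0.
  (* Chosen so that 2 M V / K^2 = e / 4. *)
  pose K := Num.sqrt (8 * M * V / e).
  have K0 : 0 < K by rewrite sqrtr_gt0 divr_gt0// !mulr_gt0.
  have e4 : 0 < e / 4 by rewrite divr_gt0.
  have [r r0 gr] := continuous_uniform_itv K cg e4.
  have bnd n : `|\int[P]_w g (Z n w) - \int[P]_w g (Y n w)| <=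
     e / 4 + 2 * M / K ^+ 2 * v n + 2 * M / r ^+ 2 * dotp P (Z n - Y n) (Z n - Y n).
    (* Chebyshev's inequality in pointwise form: if |y| > K or |z - y| >= r, the corresponding
       quadratic term exceeds 2 M; otherwise uniform continuity applies. *)
    have pt y z : `|g z - g y| <= e / 4 + 2 * M / K ^+ 2 * (y * y) +
        2 * M / r ^+ 2 * ((z - y) * (z - y)).
      have A0 : 0 <= 2 * M / K ^+ 2 * (y * y).
        by rewrite mulr_ge0 -?expr2 ?sqr_ge0// divr_ge0 ?sqr_ge0// mulr_ge0// ltW.
      have B0 : 0 <= 2 * M / r ^+ 2 * ((z - y) * (z - y)).
        by rewrite mulr_ge0 -?expr2 ?sqr_ge0// divr_ge0 ?sqr_ge0// mulr_ge0// ltW.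
      have big a b : 0 < b -> b <= `|a| -> `|g z - g y| <= 2 * M / b ^+ 2 * (a * a).
        move=> b0 ba; apply: (@le_trans _ _ (2 * M)).
          by rewrite (le_trans (ler_normB _ _))//; have := gM z; have := gM y; lra.
        rewrite mulrAC ler_pdivlMr ?exprn_gt0// ler_wpM2l ?mulr_ge0 ?(ltW M1)//.
        by rewrite -expr2 -(real_normK (num_real a)) ler_pXn2r ?nnegrE ?(ltW b0).
      have [yK|/ltW yK] := leP `|y| K; last by have := big _ _ K0 yK; lra.
      have [zy|zy] := ltP `|z - y| r; last by have := big _ _ r0 zy; lra.
      by have := gr _ _ yK zy; lra.
    have i1 : P.-integrable setT (EFin \o (fun w => g (Z n w) - g (Y n w))).
      by have := integrableB measurableT (iZ n) (iY n).
    have sZY : sqint P (Z n - Y n) by exact: sqintB.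
    have i2 : P.-integrable setT (EFin \o (fun w => 2 * M / K ^+ 2 * (Y n w * Y n w))).
      by have := integrableZl measurableT (2 * M / K ^+ 2) (sqintM_integrable (sY n) (sY n)).
    have i3 : P.-integrable setT (EFin \o
        (fun w => 2 * M / r ^+ 2 * ((Z n - Y n) w * (Z n - Y n) w))).
      by have := integrableZl measurableT (2 * M / r ^+ 2) (sqintM_integrable sZY sZY).
    have i4 := finite_measure_integrable_cst P (e / 4) measurableT.
    have i5 : P.-integrable setT (EFin \o (fun w => e / 4 + 2 * M / K ^+ 2 * (Y n w * Y n w))).
      by have := integrableD measurableT i4 i2.
    have i6 : P.-integrable setT (EFin \o (fun w => e / 4 + 2 * M / K ^+ 2 * (Y n w * Y n w) +
        2 * M / r ^+ 2 * ((Z n - Y n) w * (Z n - Y n) w))).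
      by have := integrableD measurableT i5 i3.
    rewrite -(RintegralB measurableT (iZ n) (iY n)).
    apply: le_trans (le_normr_Rintegral measurableT i1) _.
    apply: le_trans (le_Rintegral measurableT (integrable_norm i1) i6 _) _.
      by move=> w _; exact: pt.
    rewrite (RintegralD measurableT i5 i3) (RintegralD measurableT i4 i2).
    rewrite (RintegralZl _ measurableT (sqintM_integrable (sY n) (sY n))).
    rewrite (RintegralZl _ measurableT (sqintM_integrable sZY sZY)).
    by rewrite Rintegral_cst//= probability_setT /= mulr1 -(vE n) /dotp lexx.
  have e2 : 0 < e / 4 / (2 * M / r ^+ 2) by rewrite !divr_gt0// ?mulr_gt0// exprn_gt0.
  have /cvgr0Pnorm_lt/(_ _ e2) := ZY.
  apply: filterS => n; rewrite ger0_norm ?dotp_ge0// => dn.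
  apply: le_lt_trans (bnd n) _.
  have H1 : 2 * M / K ^+ 2 * v n <= e / 4.
    rewrite sqr_sqrtr; last by rewrite ltW// divr_gt0// !mulr_gt0.
    rewrite invf_div (_ : _ * v n = e / 4 * (v n / V)); last first.
      by field; rewrite (lt0r_neq0 M1) (lt0r_neq0 V1).
    by rewrite ler_piMr ?(ltW e4)// ler_pdivrMr// mul1r.
  have H2 : 2 * M / r ^+ 2 * dotp P (Z n - Y n) (Z n - Y n) < e / 4.
    by rewrite mulrC -ltr_pdivlMr// divr_gt0 ?exprn_gt0// mulr_gt0.
  lra.
have cZ : \int[P]_w g (Z n w) @[n --> \oo] --> \int[gauss]_x g (Num.sqrt v' * x + 0).
  have c0 : (\int[P]_w g (Z n w) - \int[P]_w g (Y n w)) + \int[P]_w g (Y n w)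
      @[n --> \oo] --> 0 + \int[gauss]_x g (Num.sqrt v' * x + 0).
    by apply: cvgD; [exact: cZY|exact: cY].
  rewrite add0r in c0; rewrite (_ : (fun n => _) = (fun n =>
    (\int[P]_w g (Z n w) - \int[P]_w g (Y n w)) + \int[P]_w g (Y n w)))//.
  by apply/funext => n; rewrite subrK.
rewrite (_ : integral _ _ _ = (\int[gauss]_x g (Num.sqrt v' * x + 0))%:E); last first.
  by rewrite fineK//; apply: integrable_fin_num => //; exact: (iG (Num.sqrt v')).
rewrite (_ : (fun n => _) = EFin \o (fun n => \int[P]_w g (Z n w))).
  by apply: cvg_EFin => //; exact: nearW.
apply/funext => n; rewrite unlock /= fineK//; exact: integrable_fin_num.
Qed.

End Slutsky.

(** * Regular variation *)

Section UniformConvergence.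
Context {R : realType}.
Local Notation mu := (@lebesgue_measure R).

Lemma lebesgue_measure_dilation (c : R) (A : set R) : 0 < c -> measurable A ->
  mu ((fun x => c * x) @^-1` A) = (c^-1%:E * mu A)%E.
Proof.
move=> c0 mA.
have mc : measurable_fun setT (fun x : measurableTypeR R => c * x : measurableTypeR R).
  exact: measurable_funM.
have -> : mu A = pushforward (mscale (NngNum (ltW c0)) mu)
    (fun x : measurableTypeR R => c * x : measurableTypeR R) A; last first.
  by rewrite /pushforward /mscale /= muleA -EFinM mulVf ?mul1e// gt_eqF.
apply: lebesgue_measure_unique => // X /ocitvP[->|[[a b] /= ab ->]].
  by rewrite !measure0.
rewrite /= /pushforward /mscale /=.
have -> : (fun x : R => c * x) @^-1` `]a, b]%classic = `]a / c, b / c]%classic.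
  by apply/seteqP; split => x /=; rewrite !in_itv/= ltr_pdivrMr// ler_pdivlMr// (mulrC c).
rewrite !lebesgue_measure_itv /= !lte_fin ltr_pM2r ?invr_gt0//.
case: ifP => _; last by rewrite mule0.
by rewrite -EFinD -EFinM -mulrBl mulrC divfK// gt_eqF.
Qed.

(* For large j the set of x in [1, 9] where L(x j) / L(j) is not close to 1 has
   measure below 1. Hence some x in [3, 9] is good for k and k x / n is good for
   n, and L(k), L(n) are both compared to L(x k). *)
Lemma slowly_varying_uniform (L : R -> R) (e : R) : slowly_varying L -> 0 < e ->
  exists N : nat, forall k n : nat, (N <= k)%N -> (k <= n)%N -> (n <= 3 * k)%N ->
    0 < L k%:R /\ 0 < L n%:R /\ `|L k%:R / L n%:R - 1| <= e.
Proof.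
move=> [[a [mL L0]] Lsv] e0.
(* Two values within relative error e' of a common one differ by a factor at most (1 + e') / (1 -
   e'), and 2 e' / (1 - e') <= 4 e' <= e. *)
pose e' := Num.min 2^-1 (e / 4).
have e'0 : 0 < e' by rewrite lt_min invr_gt0 ltr0n/= divr_gt0.
have e'2 : e' <= 2^-1 by rewrite ge_min lexx.
have e'4 : e' <= e / 4 by rewrite ge_min lexx orbT.
pose k0 := (Num.bound `|a|).+1.
have ak (k : nat) : (k0 <= k)%N -> a <= k%:R /\ 0 < k%:R :> R.
  move=> kk; split; last by rewrite ltr0n (leq_trans _ kk).
  rewrite (le_trans (ler_norm _))// (le_trans (ltW (archi_boundP _)))// ler_nat.
  by rewrite ltnW.
pose D : set R := `[1, 9]%classic.
have mD : measurable D by exact: measurable_itv.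
pose phi (k : nat) (x : R) : R := L (x * k%:R) / L k%:R.
have mphi k : (k0 <= k)%N -> measurable_fun D (phi k).
  move=> kk; have [aK K0] := ak _ kk.
  apply: measurable_funM => //.
  apply: (@measurable_comp _ _ _ _ _ _ `[a, +oo[%classic) => //.
  - move=> _ [x Dx <-]; move: Dx; rewrite /D /= in_itv/= => /andP[x1 _]; rewrite in_itv/= andbT.
    by rewrite (le_trans aK)// ler_peMl// ltW.
  - by apply: measurable_funM.
pose A (k : nat) : set R := D `&` [set x | e' <= `|phi k x - 1|].
have mA k : (k0 <= k)%N -> measurable (A k).
  move=> kk; have h : measurable_fun D (fun x => `|phi k x - 1|).
    by apply: measurableT_comp => //; apply: measurable_funB => //; exact: mphi.
  have := h mD `[e', +oo[%classic (measurable_itv _).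
  by congr measurable; apply/seteqP; split => x [/= Dx]; rewrite in_itv/= andbT.
have cA : \int[mu]_x (\1_(A (n + k0)%N) x : R) @[n --> \oo] --> (0 : R).
  have -> : 0 = \int[mu]_x (fun=> 0) x :> R by rewrite Rintegral_cst// mul0r.
  apply: (@dominated_Rintegral _ _ _ mu _ _ (\1_D : R -> R)).
  - by move=> n; apply: measurable_indic; apply: mA; exact: leq_addl.
  - move=> x.
    have [Dx|nDx] := pselect (D x); last first.
      by apply: cvg_near_cst; near=> n; rewrite indicE memNset// => -[].
    have x0 : 0 < x by move: Dx; rewrite /D /= in_itv/= => /andP[x1 _]; lra.
    have : phi n x @[n --> \oo] --> (1 : R).
      exact: (cvg_comp _ _ (@cvgr_idn R) (Lsv x x0)).
    move/cvgrPdist_lt/(_ _ e'0) => [N _ NA].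
    apply: cvg_near_cst; exists N => // n /= Nn; rewrite indicE memNset// => -[_ /=].
    by rewrite leNgt distrC NA//= (leq_trans Nn)// leq_addr.
  - by apply/integrable_indic_itv.
  - move=> n x; rewrite !indicE ger0_norm//.
    by have [/set_mem[Dx _]|//] := boolP (x \in A _); rewrite (mem_set Dx).
have half : 0 < 2^-1 :> R by rewrite invr_gt0.
have /cvgr0Pnorm_lt/(_ _ half)[N1 _ N1A] := cA.
exists (N1 + k0)%N => k n Nk kn n3k.
have kk : (k0 <= k)%N by rewrite (leq_trans _ Nk)// leq_addl.
have nn : (k0 <= n)%N by rewrite (leq_trans kk).
have [ak' k'0] := ak _ kk; have [an' n'0] := ak _ nn.
have Lk := L0 _ ak'; have Ln := L0 _ an'; split => //; split => //.
pose q : R := k%:R / n%:R.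
have q0 : 0 < q by rewrite divr_gt0.
have q1 : q <= 1 by rewrite ler_pdivrMr// mul1r ler_nat.
have q3 : 1 <= 3 * q by rewrite mulrA ler_pdivlMr// mul1r -natrM ler_nat.
have muA j : (N1 + k0 <= j)%N -> (mu (A j) < 1%:E)%E.
  move=> jN; have jk : (k0 <= j)%N by rewrite (leq_trans _ jN)// leq_addl.
  have fA : mu (A j) \is a fin_num.
    rewrite ge0_fin_numE//; apply: (@le_lt_trans _ _ (mu D)).
      by apply: le_measure; rewrite ?inE//; [exact: mA|exact: subIsetl].
    by rewrite /D lebesgue_measure_itv /= lte_fin; case: ifP => _; rewrite ?ltry.
  have := N1A (j - k0)%N; rewrite /= subnK// leq_subRL// addnC => /(_ jN).
  rewrite /Rintegral integral_indic//; last exact: mA.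
  rewrite setIT ger0_norm ?fine_ge0// => h; rewrite -(fineK fA) lte_fin.
  by rewrite (lt_trans h)// invf_lt1// ltr1n.
have [x [x3 x9 xA xB]] : exists x : R, [/\ 3 <= x, x <= 9, ~ A k x & ~ A n (q * x)].
  apply: contrapT => noex.
  (* With q = k / n in [1/3, 1], x in [3, 9] gives q x in [1, 9]. The interval has length 6, while
     the bad sets have measure at most 1 for k and, after dilation by 1 / q, at most 3 for n. *)
  pose D3 : set R := `[3, 9]%classic.
  have sub : D3 `<=` A k `|` (fun x : R => q * x) @^-1` A n.
    move=> x; rewrite /D3 /= in_itv/= => /andP[x3 x9].
    have [|nA] := pselect (A k x); [by left|right].
    by apply: contrapT => nB; apply: noex; exists x.
  have mB : measurable ((fun x : R => q * x) @^-1` A n).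
    by rewrite -[X in measurable X]setTI; apply: (measurable_funM _ _ measurableT) => //; exact: mA.
  pose B : set R := (fun x : R => q * x) @^-1` A n.
  have : (mu D3 <= mu (A k) + mu B)%E.
    apply: (@le_trans _ _ (mu (A k `|` B))); last by apply: measureU2 => //; exact: mA.
    apply: le_measure; [by rewrite inE; exact: measurable_itv| |exact: sub].
    by rewrite inE; apply: measurableU => //; exact: mA.
  rewrite /B lebesgue_measure_dilation//; last exact: mA.
  rewrite /D3 lebesgue_measure_itv /= lte_fin ltr_nat /=.
  have muAk := muA k Nk; have muAn := muA n (leq_trans Nk kn).
  have : (q^-1%:E * mu (A n) <= 3%:E * 1%:E)%E.
    apply: lee_pmul => //; last exact: ltW.
    + by rewrite lee_fin invr_ge0 ltW.
    + by rewrite lee_fin -[leLHS]mul1r ler_pdivrMr.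
  rewrite mule1 => h1 h2; have := le_trans h2 (leeD (ltW muAk) h1).
  by rewrite -!EFinD lee_fin; lra.
have c1 : `|L (x * k%:R) / L k%:R - 1| < e'.
  rewrite ltNge; apply/negP => h; apply: xA; split => //.
  by rewrite /D /= in_itv/=; apply/andP; split; lra.
have c2 : `|L (x * k%:R) / L n%:R - 1| < e'.
  rewrite ltNge; apply/negP => h; apply: xB; split => //.
    by rewrite /D /= in_itv/=; apply/andP; split; nra.
  by rewrite /= /phi (_ : q * x * n%:R = x * k%:R)// /q; field; rewrite gt_eqF.
move: c1 c2; set u := L (x * k%:R).
move=> c1 c2.
have E1 : `|u - L k%:R| < e' * L k%:R.
  by rewrite -ltr_pdivrMr// -[X in _ / X]gtr0_norm// -normf_div mulrBl divff ?gt_eqF.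
have E2 : `|u - L n%:R| < e' * L n%:R.
  by rewrite -ltr_pdivrMr// -[X in _ / X]gtr0_norm// -normf_div mulrBl divff ?gt_eqF.
have -> : L k%:R / L n%:R - 1 = (L k%:R - L n%:R) / L n%:R.
  by rewrite mulrBl divff// gt_eqF.
rewrite normf_div (gtr0_norm Ln) ler_pdivrMr//.
move: E1 E2; rewrite !ltr_norml => /andP[E1 E1'] /andP[E2 E2'].
by rewrite ler_norml; apply/andP; split; nra.
Unshelve. all: end_near. Qed.

End UniformConvergence.

Section Karamata.
Context {R : realType}.
Implicit Types (s q b u : nat -> R) (x y : R).

(** The distance to the fixed point B / (1 - Q) contracts by a factor r < 1 at each halving, up to a
    small error. For n >= 2^j N there are j halvings before the threshold N is crossed, which leaves
    r^j times a bound on all the distances. *)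
Lemma cvg_half_recursion s q b (Q B : R) (N0 : nat) :
  (forall n, (N0 <= n)%N -> s n = q n * s n./2 + b n) ->
  q n @[n --> \oo] --> Q -> b n @[n --> \oo] --> B -> `|Q| < 1 ->
  s n @[n --> \oo] --> B / (1 - Q).
Proof.
move=> sE qQ bB Q1.
have Q0 : 0 < 1 - Q by have := ler_norm Q; lra.
pose l := B / (1 - Q).
pose c n := b n + (q n - 1) * l.
have tE n : (N0 <= n)%N -> s n - l = q n * (s n./2 - l) + c n.
  by move=> /sE ->; rewrite /c; ring.
have c0 : c n @[n --> \oo] --> 0.
  have -> : 0 = B + (Q - 1) * l by rewrite /l; field; rewrite gt_eqF.
  apply: cvgD => //; apply: cvgM; last exact: cvg_cst.
  by apply: cvgB => //; exact: cvg_cst.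
pose r := (1 + `|Q|) / 2.
have r1 : r < 1 by rewrite /r; lra.
have r0 : 0 < r by rewrite /r; have := normr_ge0 Q; lra.
have Qr : `|Q| < r by rewrite /r; lra.
apply/cvgrPdist_le => e e0.
(* Makes e / 2 the fixed point of x -> r x + dlt, so the errors accumulated over any number of
   halvings stay below e / 2. *)
pose dlt := (1 - r) * (e / 2).
have dlt0 : 0 < dlt by rewrite mulr_gt0 ?divr_gt0// subr_gt0.
have /cvgr0Pnorm_lt/(_ _ dlt0)[N1 _ cN1] := c0.
have rQ0 : 0 < r - `|Q| by rewrite subr_gt0.
have /cvgrPdist_lt/(_ _ rQ0)[N2 _ qN2] := qQ.
(* The successor keeps n positive beyond the threshold, so that n./2 < n and the induction is
   well-founded. *)
pose N := (maxn N0 (maxn N1 N2)).+1.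
have rec n : (N <= n)%N -> `|s n - l| <= r * `|s n./2 - l| + dlt.
  move=> Nn; rewrite tE; last by rewrite (leq_trans _ Nn)// leqW// leq_maxl.
  rewrite (le_trans (ler_normD _ _))// lerD//.
    rewrite normrM ler_wpM2r//.
    have : `|Q - q n| < r - `|Q|.
      by apply: qN2; rewrite /= (leq_trans _ Nn)// leqW// !leq_max leqnn !orbT.
    have := ler_normB Q (Q - q n); rewrite (_ : Q - (Q - q n) = q n); last by ring.
    lra.
  by apply/ltW/cN1; rewrite /= (leq_trans _ Nn)// leqW// !leq_max leqnn !orbT.
pose M := \sum_(i < N) `|s i - l| + e / 2.
have half_lt n : (0 < n)%N -> (n./2 < n)%N.
  by move=> n0; rewrite ltn_half_double -addnn -[X in (X < _)%N]addn0 ltn_add2l.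
have e2E : r * (e / 2) + dlt = e / 2 by rewrite /dlt; ring.
have sN0 (n : nat) : 0 <= `|s n - l| by [].
have M0 : 0 <= \sum_(i < N) `|s i - l| by apply: sumr_ge0.
have bnd n : `|s n - l| <= M.
  elim/ltn_ind: n => n IH; have [nN|Nn] := ltnP n N.
    rewrite /M (bigD1 (Ordinal nN))//= -addrA lerDl addr_ge0//; last by rewrite ltW// divr_gt0.
    by apply: sumr_ge0.
  apply: le_trans (rec _ Nn) _.
  have n0 : (0 < n)%N by rewrite (leq_trans _ Nn).
  have := IH _ (half_lt _ n0); rewrite /M.
  by move=> h; have : r * `|s n./2 - l| <= r * M; [rewrite ler_pM2l|rewrite /M; nra].
have geo j n : (2 ^ j * N <= n)%N -> `|s n - l| <= r ^+ j * M + e / 2.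
  elim: j n => [|j IH] n.
    by rewrite expr0 mul1r => _; rewrite (le_trans (bnd n))// lerDl ltW// divr_gt0.
  move=> jn; have Nn : (N <= n)%N by rewrite (leq_trans _ jn)// leq_pmull// expn_gt0.
  have : (2 ^ j * N <= n./2)%N by rewrite geq_half_double -mul2n mulnA -expnS.
  move=> /IH h; apply: le_trans (rec _ Nn) _.
  have : r * `|s n./2 - l| <= r * (r ^+ j * M + e / 2) by rewrite ler_pM2l.
  by rewrite exprS; lra.
have rj : r ^+ j * M @[j --> \oo] --> 0.
  rewrite -(mul0r M); apply: cvgM; last exact: cvg_cst.
  by apply: cvg_expr; rewrite gtr0_norm.
have e2 : 0 < e / 2 by rewrite divr_gt0.
have /cvgr0Pnorm_lt/(_ _ e2)[j _ /(_ j (leqnn j)) rjM] := rj.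
exists (2 ^ j * N)%N => // n /= jn; rewrite distrC.
have := geo _ _ jn; have := ler_norm (r ^+ j * M); lra.
Qed.

Lemma cvg_half_div : (n./2%:R / n%:R : R) @[n --> \oo] --> (2^-1 : R).
Proof.
apply/cvgrPdist_le => e e0.
exists (Num.bound e^-1).+1 => // n /= en.
have n0 : 0 < n%:R :> R by rewrite ltr0n (leq_trans _ en).
have -> : 2^-1 - n./2%:R / n%:R = (odd n)%:R / (2 * n%:R) :> R.
  have {1}-> : n%:R = (odd n)%:R + 2 * n./2%:R :> R.
    by rewrite -natrM -natrD mul2n odd_double_half.
  have E : n%:R = (odd n)%:R + 2 * n./2%:R :> R.
    by rewrite -natrM -natrD mul2n odd_double_half.
  by rewrite [in RHS]E; field; rewrite -E gt_eqF.
rewrite ger0_norm ?divr_ge0 ?mulr_ge0// ?(ltW n0)//.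
rewrite ler_pdivrMr ?mulr_gt0//; apply: (@le_trans _ _ 1).
  by case: (odd n).
have := archi_boundP (ltW (_ : 0 < e^-1)); rewrite invr_gt0 => /(_ e0) h.
have : e^-1 < n%:R by rewrite (lt_le_trans h)// ler_nat ltnW.
by rewrite -[e^-1]mul1r ltr_pdivrMr// => ?; nra.
Qed.

Lemma continuous_powR_pt (a x : R) : 0 < x -> {for x, continuous (fun y : R => y `^ a)}.
Proof.
move=> x0; apply: differentiable_continuous; apply/derivable1_diffP.
by have [] := is_derive1_powR a x0.
Qed.

Lemma powR_ratio_half (a : R) :
  (n./2%:R `^ a / n%:R `^ a : R) @[n --> \oo] --> (2^-1 `^ a : R).
Proof.
have : ((n./2%:R / n%:R) `^ a : R) @[n --> \oo] --> (2^-1 `^ a : R).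
  have half0 : 0 < 2^-1 :> R by rewrite invr_gt0.
  exact: (continuous_cvg _ (@continuous_powR_pt a _ half0) (@cvg_half_div)).
apply: cvg_trans; apply: near_eq_cvg; exists 1%N => // n /= n0.
by rewrite powRM ?invr_ge0// -powR_inv1// -powRrM mulN1r powRN.
Qed.

End Karamata.

Section KaramataSums.
Context {R : realType}.
Implicit Types (rho a : R) (u : nat -> R) (n k : nat).

Lemma one_powR a : 1 `^ a = 1 :> R.
Proof. by rewrite powR1. Qed.

Lemma powR_half_lt1 a : 0 < a -> `|2^-1 `^ a : R| < 1.
Proof.
move=> a0; rewrite ger0_norm ?powR_ge0// -[ltRHS](one_powR a).
by rewrite gt0_ltr_powR// ?nnegrE ?invr_ge0// invf_lt1// ltr1n.
Qed.

(** Homogeneous case of the halving recursion: consecutive values have a ratio tending to 2^(-a) <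
    1, and the fixed point is 0. *)
Lemma cvg_powR_neg a : 0 < a -> (n%:R `^ (- a) : R) @[n --> \oo] --> (0 : R).
Proof.
move=> a0; have := @cvg_half_recursion R (fun n => n%:R `^ (- a))
  (fun n => n./2%:R `^ a / n%:R `^ a) (fun=> 0) (2^-1 `^ a) 0 2%N.
rewrite mul0r; apply; [|exact: powR_ratio_half|exact: cvg_cst|exact: powR_half_lt1].
move=> n n2; rewrite addr0 !powRN mulrAC divff ?mul1r// gt_eqF// powR_gt0// ltr0n.
by rewrite half_gt0.
Qed.

(** By the mean value theorem the increment is (rho + 1) c^rho with k < c < k + 1, and c^rho lies
    between its values at k and k + 1 for either sign of rho. *)
Lemma powR_increment rho k : -1 < rho -> (0 < k)%N ->
  `|(k.+1%:R `^ (rho + 1) - k%:R `^ (rho + 1)) - (rho + 1) * k%:R `^ rho| <=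
  (rho + 1) * `|k.+1%:R `^ rho - k%:R `^ rho|.
Proof.
move=> r1 k0; have s0 : 0 < rho + 1 by lra.
have k0' : 0 < k%:R :> R by rewrite ltr0n.
have kk : k%:R < k.+1%:R :> R by rewrite ltr_nat.
have [||c ck ->] := @MVT R (fun x => x `^ (rho + 1)) (fun x => (rho + 1) * x `^ (rho + 1 - 1))
    k%:R k.+1%:R kk.
- move=> x; rewrite in_itv/= => /andP[kx _].
  by apply: is_derive1_powR; exact: lt_trans kx.
- apply: derivable_within_continuous => x; rewrite in_itv/= => /andP[kx _].
  by have [] := is_derive1_powR (rho + 1) (lt_le_trans k0' kx).
move: ck; rewrite in_itv/= => /andP[kc ck].
have c0 : 0 < c by exact: lt_trans kc.
rewrite addrK -natr1 addrAC subrr add0r mulr1 -mulrBr normrM (gtr0_norm s0).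
rewrite ler_pM2l// natr1.
have [rho0|rho0] := leP 0 rho.
  have h1 : k%:R `^ rho <= c `^ rho by rewrite ge0_ler_powR ?nnegrE// ltW.
  have h2 : c `^ rho <= k.+1%:R `^ rho by rewrite ge0_ler_powR ?nnegrE// ltW.
  rewrite !ger0_norm ?subr_ge0//; first by rewrite lerB.
  exact: le_trans h2.
have mono x y : 0 < x -> x <= y -> y `^ rho <= x `^ rho.
  move=> x0 xy; have y0 := lt_le_trans x0 xy.
  have E z : z `^ rho = (z `^ (- rho))^-1 by rewrite powRN invrK.
  rewrite !E lef_pV2 ?posrE ?powR_gt0//.
  by rewrite ge0_ler_powR ?nnegrE ?oppr_ge0 ?(ltW rho0) ?(ltW x0)// (le_trans (ltW x0)).
have h1 := mono _ _ k0' (ltW kc); have h2 := mono _ _ c0 (ltW ck).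
rewrite !ler0_norm ?subr_le0//; first by rewrite lerN2 lerB.
exact: le_trans h1.
Qed.

(** As k^rho is monotone in k, the increment errors all have the same sign before absolute values
    are taken, and add up to the total variation. *)
Lemma powR_sum_bound rho n : -1 < rho ->
  `|n.+1%:R `^ (rho + 1) - 1 - (rho + 1) * \sum_(1 <= k < n.+1) k%:R `^ rho| <=
  (rho + 1) * `|n.+1%:R `^ rho - 1|.
Proof.
move=> r1; have s0 : 0 < rho + 1 by lra.
elim: n => [|n IH].
  by rewrite big_geq// mulr0 subr0 !powR1 subrr normr0 mulr0.
rewrite big_nat_recr//=.
have inc := powR_increment r1 (ltn0Sn n).
rewrite (_ : n.+2%:R `^ (rho + 1) - 1 - _ =
  (n.+1%:R `^ (rho + 1) - 1 - (rho + 1) * \sum_(1 <= k < n.+1) k%:R `^ rho) +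
  ((n.+2%:R `^ (rho + 1) - n.+1%:R `^ (rho + 1)) - (rho + 1) * n.+1%:R `^ rho)); last by ring.
apply: le_trans (ler_normD _ _) _; apply: le_trans (lerD IH inc) _.
rewrite -mulrDr ler_pM2l//.
have [rho0|rho0] := leP 0 rho.
  have h1 : n.+1%:R `^ rho <= n.+2%:R `^ rho by rewrite ge0_ler_powR ?nnegrE// ?ler_nat// ?ler1n.
  have h2 : 1 <= n.+1%:R `^ rho.
    by rewrite -[leLHS](one_powR rho) ge0_ler_powR ?nnegrE// ?ler_nat// ?ler1n.
  have h3 := le_trans h2 h1.
  by rewrite !ger0_norm ?subr_ge0//; lra.
have mono x y : 0 < x -> x <= y -> y `^ rho <= x `^ rho.
  move=> x0 xy; have y0 := lt_le_trans x0 xy.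
  have E z : z `^ rho = (z `^ (- rho))^-1 by rewrite powRN invrK.
  rewrite !E lef_pV2 ?posrE ?powR_gt0//.
  by rewrite ge0_ler_powR ?nnegrE ?oppr_ge0 ?(ltW rho0) ?(ltW x0)// (le_trans (ltW x0)).
have h1 : n.+2%:R `^ rho <= n.+1%:R `^ rho by apply: mono; rewrite ?ltr0n// ler_nat.
have h2 : n.+1%:R `^ rho <= 1 by rewrite -[leRHS](one_powR rho); apply: mono; rewrite ?ltr01// ler1n.
have h3 := le_trans h1 h2.
by rewrite !ler0_norm ?subr_le0//; lra.
Qed.

Lemma cvg_powR_sum rho : -1 < rho ->
  (\sum_(1 <= k < n.+1) k%:R `^ rho) / n%:R `^ (rho + 1) @[n --> \oo] --> (rho + 1)^-1.
Proof.
move=> r1; have s0 : 0 < rho + 1 by lra.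
have E : (n%:R `^ (- (rho + 1)) * (1 + (rho + 1)) + 2 * (rho + 1) * (n%:R `^ (-1)))
     / (rho + 1) @[n --> \oo] --> (0 * (1 + (rho + 1)) + 2 * (rho + 1) * 0) / (rho + 1).
  apply: cvgM; last exact: cvg_cst.
  apply: cvgD; apply: cvgM; try exact: cvg_cst.
    exact: cvg_powR_neg.
  exact: cvg_powR_neg.
rewrite mul0r mulr0 addr0 mul0r in E.
apply/subr_cvg0; apply: norm_cvg0.
apply: (@squeeze_cvgr _ _ _ _ (cst 0) _ _ _ _ _ E); last exact: cvg_cst.
exists 1%N => // -[//|n] _ /=; rewrite normr_ge0 /=.
have n0 : 0 < n.+1%:R `^ (rho + 1) :> R by rewrite powR_gt0.
have b := powR_sum_bound n r1.
rewrite big_nat_recr//=; set G := \sum_(1 <= i < n.+1) _ in b *.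
have y0 := powR_ge0 n.+1%:R rho.
have -> : n.+1%:R `^ (-1) = n.+1%:R `^ rho / n.+1%:R `^ (rho + 1) :> R.
  rewrite -powRN -powRD; last by rewrite pnatr_eq0 implybT.
  by congr powR; ring.
rewrite powRN; move: n0 b y0; set x := n.+1%:R `^ (rho + 1); set y := n.+1%:R `^ rho.
move=> n0 b y0.
have -> : (G + y) / x - (rho + 1)^-1 = ((rho + 1) * G + (rho + 1) * y - x) / ((rho + 1) * x).
  by field; rewrite !gt_eqF.
have -> : (x^-1 * (1 + (rho + 1)) + 2 * (rho + 1) * (y / x)) / (rho + 1) =
    (1 + (rho + 1) + 2 * (rho + 1) * y) / ((rho + 1) * x).
  by field; rewrite !gt_eqF.
have sx : 0 < (rho + 1) * x by rewrite mulr_gt0.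
rewrite normf_div (gtr0_norm sx) ler_pM2r ?invr_gt0//.
have b' : `|y - 1| <= y + 1 by rewrite ler_norml; apply/andP; split; lra.
have : `|x - 1 - (rho + 1) * G| <= (rho + 1) * (y + 1).
  by rewrite (le_trans b)// ler_pM2l.
rewrite !ler_norml => /andP[? ?]; apply/andP; split; nra.
Qed.

End KaramataSums.

Section RegularVariation.
Context {R : realType}.
Variable u : nat -> R.
Hypothesis u_slow : forall e : R, 0 < e -> exists N : nat, forall k n : nat,
  (N <= k)%N -> (k <= n)%N -> (n <= 3 * k)%N ->
  0 < u k /\ 0 < u n /\ `|u k / u n - 1| <= e.
Implicit Types (a rho : R) (n k : nat).

Definition regvar a n : R := n%:R `^ a * u n.

Lemma slow_pos : exists N, forall n, (N <= n)%N -> 0 < u n.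
Proof.
have [N uN] := u_slow ltr01; exists N => n Nn.
have n3 : (n <= 3 * n)%N by rewrite leq_pmull.
by have [] := uN n n Nn (leqnn n) n3.
Qed.

(** Source of the ratio 3 in the uniformity hypothesis: halving rounds down, and n = 3 has half
    1. *)
Lemma half_bounds n : (2 <= n)%N -> (n./2 <= n)%N /\ (n <= 3 * n./2)%N.
Proof.
move=> n2; have := odd_double_half n; rewrite -muln2.
have : (0 < n./2)%N by rewrite half_gt0.
by case: (odd n) => /=; lia.
Qed.

Lemma slow_half : u n./2 / u n @[n --> \oo] --> (1 : R).
Proof.
apply/cvgrPdist_le => e e0; have [N uN] := u_slow e0.
exists (2 * N).+2 => // n /= Nn.
have [h1 h2] := half_bounds (leq_trans (leq_addr (2 * N) 2) Nn).
have Nh : (N <= n./2)%N by rewrite geq_half_double -mul2n; lia.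
by rewrite distrC; have [_ []] := uN _ _ Nh h1 h2.
Qed.

Lemma regvar_pos : exists N, forall a n, (N <= n)%N -> 0 < regvar a n.
Proof.
have [N uN] := slow_pos; exists N.+1 => a n Nn.
by rewrite mulr_gt0 ?uN ?(ltnW Nn)// powR_gt0// ltr0n (leq_trans _ Nn).
Qed.

Lemma regvar_half a : regvar a n./2 / regvar a n @[n --> \oo] --> (2^-1 `^ a : R).
Proof.
have : (n./2%:R `^ a / n%:R `^ a) * (u n./2 / u n) @[n --> \oo] --> (2^-1 `^ a * 1 : R).
  by apply: cvgM; [exact: powR_ratio_half|exact: slow_half].
rewrite mulr1; apply: cvg_trans; apply: near_eq_cvg; apply: nearW => n.
by rewrite /regvar invfM; ring.
Qed.

Lemma regvar_near_pos : exists N, (2 <= N)%N /\ forall a n, (N <= n)%N ->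
  0 < regvar a n /\ 0 < regvar a n./2.
Proof.
have [N uN] := regvar_pos; exists (2 * N).+2; split => // a n Nn.
by split; apply: uN; rewrite ?geq_half_double -?mul2n; lia.
Qed.

Lemma cvg_regvar_inv a : 0 < a -> (regvar a n)^-1 @[n --> \oo] --> 0.
Proof.
move=> a0; have [N [_ rN]] := regvar_near_pos.
have := @cvg_half_recursion R (fun n => (regvar a n)^-1)
  (fun n => regvar a n./2 / regvar a n) (fun=> 0) (2^-1 `^ a) 0 N.
rewrite mul0r; apply; [|exact: regvar_half|exact: cvg_cst|exact: powR_half_lt1].
move=> n Nn; have [_ h] := rN a n Nn.
by rewrite addr0 mulrAC divff ?mul1r// gt_eqF.
Qed.

Lemma cvg_regvar_neg a : 0 < a -> regvar (- a) n @[n --> \oo] --> 0.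
Proof.
move=> a0; have [N [_ rN]] := regvar_near_pos.
have qc : (regvar (- a) n./2 / regvar (- a) n)^-1 @[n --> \oo] --> ((2^-1 `^ (- a))^-1 : R).
  by apply: cvgV; [rewrite gt_eqF// powR_gt0// invr_gt0|exact: regvar_half].
have := @cvg_half_recursion R (regvar (- a))
  (fun n => (regvar (- a) n./2 / regvar (- a) n)^-1) (fun=> 0) _ 0 N _ qc (cvg_cst _).
rewrite mul0r; apply; last by rewrite powRN invrK powR_half_lt1.
move=> n Nn; have [_ h] := rN (- a) n Nn.
by rewrite addr0 invf_div divfK// gt_eqF.
Qed.

(** In the block n/2 < k <= n the ratio u k / u n is uniformly close to 1, so the block sum is
    compared with that of k^rho. With s = rho + 1, the normalised block tends to s^-1 (1 - 2^(-s))
    and the normalised lower half has the weight q_n -> 2^(-s); the fixed point is s^-1. *)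
Lemma karamata_sum rho : -1 < rho ->
  (\sum_(1 <= k < n.+1) regvar rho k) / regvar (rho + 1) n @[n --> \oo] --> (rho + 1)^-1.
Proof.
move=> r1; set s := rho + 1; have s0 : 0 < s by rewrite /s; lra.
have [N [N2 rN]] := regvar_near_pos.
pose S n := \sum_(1 <= k < n.+1) regvar rho k.
pose B n := \sum_(n./2.+1 <= k < n.+1) regvar rho k.
pose G n : R := \sum_(1 <= k < n.+1) k%:R `^ rho.
pose p n : R := (\sum_(n./2.+1 <= k < n.+1) k%:R `^ rho) / n%:R `^ s.
have split_sum (F : nat -> R) n : \sum_(1 <= k < n.+1) F k =
    \sum_(1 <= k < n./2.+1) F k + \sum_(n./2.+1 <= k < n.+1) F k.
  by rewrite (big_cat_nat _ (n := n./2.+1))// ltnS leq_half_double ltnW// ltnS -addnn leq_addl.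
have pc : p n @[n --> \oo] --> s^-1 - s^-1 * 2^-1 `^ s.
  have hc : G n./2 / n./2%:R `^ s @[n --> \oo] --> s^-1.
    apply: (@cvg_comp _ _ _ (fun n => n./2) (fun n => G n / n%:R `^ s) \oo \oo) => //;
      last exact: cvg_powR_sum.
    move=> A [M _ MA]; exists (2 * M)%N => // n /= Mn; apply: MA => /=.
    by rewrite geq_half_double -mul2n.
  have : G n / n%:R `^ s - (G n./2 / n./2%:R `^ s) * (n./2%:R `^ s / n%:R `^ s)
      @[n --> \oo] --> s^-1 - s^-1 * 2^-1 `^ s.
    apply: cvgB; first exact: cvg_powR_sum.
    by apply: cvgM; [exact: hc|exact: powR_ratio_half].
  apply: cvg_trans; apply: near_eq_cvg; exists 2%N => // n /= n2.
  have h0 : 0 < n./2%:R `^ s :> R by rewrite powR_gt0// ltr0n half_gt0.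
  by rewrite mulrA divfK ?gt_eqF// -mulrBl /G split_sum addrAC subrr add0r.
have p0 n : 0 <= p n.
  by rewrite divr_ge0 ?powR_ge0// sumr_ge0// => k _; exact: powR_ge0.
have bc : B n / regvar s n @[n --> \oo] --> s^-1 - s^-1 * 2^-1 `^ s.
  apply/subr_cvg0; set c := s^-1 - _.
  have : (B n / regvar s n - p n) + (p n - c) @[n --> \oo] --> 0 + (c - c).
    apply: cvgD; last by apply: cvgB; [exact: pc|exact: cvg_cst].
    apply/cvgr0Pnorm_le => e e0.
    have c1 : 0 < `|c| + 1 by rewrite ltr_wpDl.
    have [M uM] := u_slow (divr_gt0 e0 c1).
    have /cvgrPdist_lt/(_ _ ltr01)[M' _ pM'] := pc.
    exists (maxn N (maxn (2 * M).+2 M')) => // n /=; rewrite !geq_max => /and3P[Nn Mn M'n].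
    have [_ h] := half_bounds (leq_trans N2 Nn).
    have [rn _] := rN s n Nn.
    have n0 : 0 < n%:R `^ s :> R by rewrite powR_gt0// ltr0n (leq_trans _ (leq_trans N2 Nn)).
    have Mh : (M <= n./2)%N by rewrite geq_half_double -mul2n; lia.
    have un : 0 < u n.
      have [hn _] := half_bounds (leq_trans N2 Nn).
      by have [_ []] := uM _ _ Mh hn h.
    have -> : B n / regvar s n - p n =
        (\sum_(n./2.+1 <= k < n.+1) k%:R `^ rho * (u k / u n - 1)) / n%:R `^ s.
      rewrite /p; set P' := \sum_(n./2.+1 <= k < n.+1) k%:R `^ rho.
      transitivity ((B n / u n - P') / n%:R `^ s).
        by rewrite /regvar; field; rewrite !gt_eqF.
      congr (_ / _); rewrite mulr_suml -sumrB; apply: eq_bigr => k _; rewrite /regvar; ring.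
    rewrite normrM (gtr0_norm (x := _^-1)) ?invr_gt0//.
    apply: (@le_trans _ _ ((e / (`|c| + 1)) * p n)).
      rewrite /p mulrA ler_pM2r ?invr_gt0// mulr_sumr.
      apply: le_trans (ler_norm_sum _ _ _) _.
      rewrite big_nat [leRHS]big_nat; apply: ler_sum => k /andP[hk kn].
      rewrite normrM (ger0_norm (powR_ge0 _ _)) mulrC ler_wpM2r ?powR_ge0//.
      have kM : (M <= k)%N by lia.
      have k3 : (n <= 3 * k)%N by lia.
      by have [_ []] := uM k n kM kn k3.
    have pn1 : p n <= `|c| + 1.
      have : `|c - p n| < 1 by exact: pM'.
      rewrite ltr_norml => /andP[? ?]; have := ler_norm c; lra.
    by rewrite mulrAC ler_pdivrMr// ler_pM2l.
  rewrite subrr addr0; apply: cvg_trans; apply: near_eq_cvg; apply: nearW => n.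
  by rewrite /=; ring.
have := @cvg_half_recursion R (fun n => S n / regvar s n)
  (fun n => regvar s n./2 / regvar s n) (fun n => B n / regvar s n) _ _ N _
  (@regvar_half s) bc (powR_half_lt1 s0).
rewrite (_ : (s^-1 - s^-1 * 2^-1 `^ s) / (1 - 2^-1 `^ s) = s^-1); last first.
  have h1 : 1 - 2^-1 `^ s != 0.
    have := powR_half_lt1 s0; rewrite ger0_norm ?powR_ge0// => h.
    by rewrite subr_eq0 eq_sym; apply/eqP => E; rewrite E ltxx in h.
  by field; rewrite h1 gt_eqF.
apply=> n Nn; have [h1 h2] := rN s n Nn.
rewrite /S split_sum -/(B n); set X := \sum_(1 <= k < n./2.+1) _.
by field; rewrite !gt_eqF.
Qed.

End RegularVariation.

(** * Stationary Gaussian sequences *)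

Section Process.
Context d (T : measurableType d) (R : realType) (P : probability T R).
Variable X : nat -> {RV P >-> R}.

Lemma measurable_window i m : measurable_fun setT (window X i m).
Proof.
apply/measurable_fun_tnthP => j.
rewrite (_ : _ \o _ = X (i + j)%N :> (T -> R)); first exact: measurable_funP.
by apply/funext => w /=; rewrite tnth_mktuple.
Qed.

Hypothesis X_stationary : stationary X.

Lemma stationary_ge0_integral h m (F : m.-tuple R -> \bar R) :
  measurable_fun setT F -> (forall t, 0 <= F t)%E ->
  (\int[P]_w F (window X h m w) = \int[P]_w F (window X 0 m w))%E.
Proof.
move=> mF F0.
have mw i : measurable_fun setT (window X i m) := @measurable_window i m.
pose W i : {mfun T >-> m.-tuple R} :=
  MeasurableFun.Pack (MeasurableFun.Class (isMeasurableFun.Build _ _ _ _ _ (mw i))).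
have -> i : (\int[P]_w F (window X i m w) = \int[distribution P (W i)]_t F t)%E.
  by rewrite ge0_integral_distribution.
have -> : (\int[P]_w F (window X 0 m w) = \int[distribution P (W 0%N)]_t F t)%E.
  by rewrite ge0_integral_distribution.
by apply: eq_measure_integral => B mB _; exact: X_stationary.
Qed.

Lemma stationary_integral h m (F : m.-tuple R -> R) : measurable_fun setT F ->
  P.-integrable setT (EFin \o (fun w => F (window X 0 m w))) ->
  P.-integrable setT (EFin \o (fun w => F (window X h m w))) /\
  \int[P]_w F (window X h m w) = \int[P]_w F (window X 0 m w).
Proof.
move=> mF iF.
have mw i : measurable_fun setT (window X i m) := @measurable_window i m.
have mFE : measurable_fun setT (EFin \o F) by exact/measurable_EFinP.
have iFh : P.-integrable setT (EFin \o (fun w => F (window X h m w))).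
  apply/integrableP; split.
    by apply: measurableT_comp => //; apply: measurableT_comp.
  have mA : measurable_fun setT (fun t => `|(F t)%:E|%E) by exact: measurableT_comp mFE.
  have /= -> := stationary_ge0_integral h mA (fun t => abse_ge0 _).
  by have /integrableP[] := iF.
split => //.
pose W i : {mfun T >-> m.-tuple R} :=
  MeasurableFun.Pack (MeasurableFun.Class (isMeasurableFun.Build _ _ _ _ _ (mw i))).
congr fine.
have -> : (\int[P]_w (F (window X h m w))%:E = \int[distribution P (W h)]_t (F t)%:E)%E.
  by rewrite integral_distribution.
have -> : (\int[P]_w (F (window X 0 m w))%:E = \int[distribution P (W 0%N)]_t (F t)%:E)%E.
  by rewrite integral_distribution.
by apply: eq_measure_integral => B mB _; exact: X_stationary.
Qed.

Lemma stationary_sqint h m (F : m.-tuple R -> R) : measurable_fun setT F ->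
  sqint P (fun w => F (window X 0 m w)) -> sqint P (fun w => F (window X h m w)).
Proof.
move=> mF [_ iF]; split.
  by apply: measurableT_comp => //; exact: measurable_window.
by have [] := @stationary_integral h m (fun t => F t ^+ 2) (measurable_funX 2 mF) iF.
Qed.

Hypothesis X_standard : standardized X.

Lemma sqint_X j : sqint P (X j).
Proof.
have mX : measurable_fun setT (X j : T -> R) by exact: measurable_funP.
split => //; have [E0 V1] := X_standard j.
apply/integrableP; split; first by apply/measurable_EFinP; exact: measurable_funX.
move: V1; rewrite /variance unlock E0 /= unlock => V1.
under eq_integral do rewrite /= ger0_norm ?sqr_ge0//.
rewrite (_ : integral _ _ _ = 1%E) ?ltry// -V1; apply: eq_integral => w _.
by rewrite expr2 -{1 2}[X j w]subr0.
Qed.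

Lemma expectation_dotp Y : sqint P Y -> 'E_P[Y]%E = (dotp P Y 1)%:E.
Proof.
move=> sY; rewrite unlock /dotp (_ : (fun w => _) = Y); last first.
  by apply/funext => w; rewrite mulr1.
by rewrite fineK//; apply: integrable_fin_num => //; exact: sqint_integrable.
Qed.

Lemma dotp_X1 j : dotp P (X j) 1 = 0.
Proof.
have [E0 _] := X_standard j; have := expectation_dotp (sqint_X j).
by rewrite E0 => -[].
Qed.

Lemma covariance_dotp i j : fine (covariance P (X i) (X j)) = dotp P (X i) (X j).
Proof.
have [Ei _] := X_standard i; have [Ej _] := X_standard j.
rewrite unlock Ei Ej /= unlock; congr fine; apply: eq_integral => w _.
by rewrite -[X i w]subr0 -[X j w]subr0.
Qed.

Lemma dotp_XX j : dotp P (X j) (X j) = 1.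
Proof. by have [_ V1] := X_standard j; rewrite -covariance_dotp -/(variance P _) V1. Qed.

Lemma dotp_shift i k : dotp P (X i) (X (i + k)%N) = autocov X k.
Proof.
rewrite /autocov covariance_dotp.
pose F (t : k.+1.-tuple R) := tnth t ord0 * tnth t ord_max.
have mF : measurable_fun setT F by apply: measurable_funM; exact: measurable_tnth.
have FE h : (fun w => F (window X h k.+1 w)) = (fun w => X h w * X (h + k)%N w).
  by apply/funext => w; rewrite /F /window !tnth_mktuple /= addn0.
have iF : P.-integrable setT (EFin \o (fun w => F (window X 0 k.+1 w))).
  by rewrite FE; apply: sqintM_integrable; exact: sqint_X.
have [_] := @stationary_integral i k.+1 F mF iF.
by rewrite /dotp !FE.
Qed.

Lemma dotp_X i j : dotp P (X i) (X j) = autocov X (maxn i j - minn i j).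
Proof.
have [ij|ji] := leqP i j.
  by rewrite -{1}(subnKC ij) dotp_shift.
by rewrite dotpC -{1}(subnKC (ltnW ji)) dotp_shift.
Qed.

End Process.

Section LinearCombinations.
Context d (T : measurableType d) (R : realType) (P : probability T R).
Variable X : nat -> {RV P >-> R}.
Hypothesis X_gaussian : gaussian_process X.
Hypothesis X_standard : standardized X.
Implicit Types Y Z : T -> R.

(** Coefficients are indexed by [nat] and not by ['I_m], so that combinations of different lengths
    can be padded with zeros and added. *)
Definition lincomb Y : Prop :=
  exists (m : nat) (a : nat -> R), Y = \sum_(i < m) a i *: (X i : T -> R).

Lemma lincomb0 : lincomb 0.
Proof. by exists 0%N, (fun=> 0); rewrite big_ord0. Qed.

Lemma lincombD Y Z : lincomb Y -> lincomb Z -> lincomb (Y + Z).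
Proof.
move=> [m [a ->]] [n [b ->]].
exists (m + n)%N, (fun i => (if (i < m)%N then a i else 0) + (if (i < n)%N then b i else 0)).
have pad (k l : nat) (c : nat -> R) : (k <= l)%N -> \sum_(i < k) c i *: (X i : T -> R) =
    \sum_(i < l) (if (i < k)%N then c i else 0) *: (X i : T -> R).
  move=> kl; rewrite (big_ord_widen l (fun i => c i *: (X i : T -> R)) kl) big_mkcond.
  by apply: eq_bigr => i _; case: ifP => // _; rewrite scale0r.
rewrite (pad _ _ a (leq_addr n m)) (pad _ _ b (leq_addl m n)) -big_split.
by apply: eq_bigr => i _; rewrite scalerDl.
Qed.

Lemma lincombZ c Y : lincomb Y -> lincomb (c *: Y).
Proof.
move=> [m [a ->]]; exists m, (fun i => c * a i).
by rewrite scaler_sumr; apply: eq_bigr => i _; rewrite scalerA.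
Qed.

Lemma lincomb_sum I (r : seq I) (Q : pred I) (F : I -> T -> R) :
  (forall i, Q i -> lincomb (F i)) -> lincomb (\sum_(i <- r | Q i) F i).
Proof. by move=> h; elim/big_ind : _ => //; [exact: lincomb0|exact: lincombD]. Qed.

Lemma lincomb_X i : lincomb (X i).
Proof.
exists i.+1, (fun j => (j == i)%:R); rewrite big_ord_recr/= eqxx scale1r big1 ?add0r//.
by move=> j _; rewrite ltn_eqF// scale0r.
Qed.

Lemma lincomb_sqint Y : lincomb Y -> sqint P Y.
Proof.
move=> [m [a ->]]; apply: sqint_sum => i _; apply: sqintZ; exact: sqint_X.
Qed.

Lemma lincomb_mean Y : lincomb Y -> dotp P Y 1 = 0.
Proof.
move=> [m [a ->]]; rewrite dotp_suml; last exact: sqint1.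
  by apply: big1 => i _; rewrite dotpZl ?dotp_X1 ?mulr0//; [exact: sqint_X|exact: sqint1].
by move=> i _; apply: sqintZ; exact: sqint_X.
Qed.

(** The parameters provided by [X_gaussian] are identified through the first two moments, which
    makes the second moment itself the variance parameter. *)
Lemma lincomb_law Y : lincomb Y -> forall B, measurable B ->
  P (Y @^-1` B) = gaussian_law 0 (dotp P Y Y) B.
Proof.
move=> cY; have sY := lincomb_sqint cY; have [mY _] := sY.
have [m [a YE]] := cY.
have [mu [v [v0 law]]] := X_gaussian (fun i : 'I_m => a i).
have YE' : Y = (fun w => \sum_(i < m) a i * X i w).
  by rewrite YE; apply/funext => w; rewrite fct_sumE.
rewrite -YE' in law.
have mu0 : mu = 0.
  rewrite -(gaussian_mean mY law v0 sY) -(lincomb_mean cY).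
  by apply: eq_Rintegral => w _; rewrite /= mulr1.
by move=> B mB; rewrite (gaussian_variance mY law v0 sY mu0) -mu0; exact: law.
Qed.

Lemma lincomb_cos Y : lincomb Y -> \int[P]_w cos (Y w) = expR (- (dotp P Y Y / 2)).
Proof.
move=> cY; have [mY _] := lincomb_sqint cY.
have := gaussian_cos mY (lincomb_law cY) (dotp_ge0 P Y) 1.
rewrite mulr0 cos0 mul1r expr1n mul1r => <-.
by apply: eq_Rintegral => w _; rewrite mul1r.
Qed.

Lemma lincomb_sin Y : lincomb Y -> \int[P]_w sin (Y w) = 0.
Proof.
move=> cY; have [mY _] := lincomb_sqint cY.
have := gaussian_sin mY (lincomb_law cY) (dotp_ge0 P Y) 1.
rewrite mulr0 sin0 mul0r => <-.
by apply: eq_Rintegral => w _; rewrite mul1r.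
Qed.

Lemma lincomb_gaussian_pair p (U V : 'I_p -> T -> R) :
  (forall i, lincomb (U i)) -> (forall i, lincomb (V i)) ->
  (forall i j, dotp P (U i) (U j) = (i == j)%:R) ->
  (forall i j, dotp P (V i) (V j) = (i == j)%:R) ->
  gaussian_pair P U V (\matrix_(i, j) dotp P (U i) (V j)).
Proof.
move=> cU cV UU VV.
have sU i := lincomb_sqint (cU i); have sV i := lincomb_sqint (cV i).
have linE (W : 'I_p -> T -> R) (s : 'rV[R]_p) : lin W s = \sum_i s 0 i *: W i.
  by apply/funext => w; rewrite fct_sumE.
have cl (W : 'I_p -> T -> R) (s : 'rV[R]_p) : (forall i, lincomb (W i)) -> lincomb (lin W s).
  by move=> cW; rewrite linE; apply: lincomb_sum => i _; exact: lincombZ.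
have ip (W W' : 'I_p -> T -> R) (s t : 'rV[R]_p) : (forall i, sqint P (W i)) ->
    (forall i, sqint P (W' i)) -> dotp P (lin W s) (lin W' t) =
    \sum_i \sum_j dotp P (W i) (W' j) * (s 0 i * t 0 j).
  move=> sW sW'; rewrite !linE dotp_suml; last 2 first.
  - by move=> i _; exact: sqintZ.
  - by apply: sqint_sum => i _; exact: sqintZ.
  apply: eq_bigr => i _; rewrite dotp_sumr; last 2 first.
  - by move=> j _; exact: sqintZ.
  - exact: sqintZ.
  by apply: eq_bigr => j _; rewrite dotpZl ?dotpZr//; [ring|exact: sqintZ].
have norm (W : 'I_p -> T -> R) (s : 'rV[R]_p) : (forall i, sqint P (W i)) ->
    (forall i j, dotp P (W i) (W j) = (i == j)%:R) -> dotp P (lin W s) (lin W s) = dotr s s.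
  move=> sW WW; rewrite ip//; apply: eq_bigr => i _.
  rewrite (bigD1 i)//= big1 ?addr0; first by rewrite WW eqxx mul1r.
  by move=> j ji; rewrite WW eq_sym (negbTE ji) mul0r.
split.
- by move=> i; have [] := sU i.
- by move=> i; have [] := sV i.
- move=> s t; have c := lincombD (cl _ s cU) (cl _ t cV).
  have := lincomb_cos c; rewrite dotp_sqrD; last 2 first.
  - exact: lincomb_sqint (cl _ s cU).
  - exact: lincomb_sqint (cl _ t cV).
  rewrite !norm// ip// => E; rewrite [LHS]E; congr expR.
  rewrite /bilr; under [in RHS]eq_bigr => i _ do under eq_bigr => j _ do rewrite mxE.
  by field.
- by move=> s t; have := lincomb_sin (lincombD (cl _ s cU) (cl _ t cV)).
Qed.

End LinearCombinations.

(** * Nondegeneracy of the covariance matrices *)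

Section Nondegenerate.
Context d (T : measurableType d) (R : realType) (P : probability T R).
Variable X : nat -> {RV P >-> R}.
Hypothesis X_stationary : stationary X.
Hypothesis X_standard : standardized X.
Hypothesis autocov_cvg0 : autocov X k @[k --> \oo] --> 0.
Implicit Types (q : {poly R}) (Y Z : T -> R).

(** Turns the time shift into multiplication by ['X]. By stationarity the norm does not depend on h,
    so null combinations are shift-invariant. *)
Definition poly_comb h q : T -> R := \sum_(i < size q) q`_i *: (X (i + h)%N : T -> R).

Lemma poly_comb_widen h q n : (size q <= n)%N ->
  poly_comb h q = \sum_(i < n) q`_i *: (X (i + h)%N : T -> R).
Proof.
move=> sqn; rewrite /poly_comb.
rewrite (big_ord_widen n (fun i => q`_i *: (X (i + h)%N : T -> R)) sqn) big_mkcond.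
apply: eq_bigr => i _; case: ltnP => // h'.
by rewrite nth_default// scale0r.
Qed.

Lemma poly_combD h q1 q2 : poly_comb h (q1 + q2) = poly_comb h q1 + poly_comb h q2.
Proof.
have [h1 h2] : (size q1 <= maxn (size q1) (size q2))%N /\ (size q2 <= maxn (size q1) (size q2))%N.
  by rewrite leq_maxl leq_maxr.
rewrite (poly_comb_widen h (size_polyD q1 q2)) (poly_comb_widen h h1) (poly_comb_widen h h2).
by rewrite -big_split; apply: eq_bigr => i _; rewrite coefD scalerDl.
Qed.

Lemma poly_combZ h c q : poly_comb h (c *: q) = c *: poly_comb h q.
Proof.
rewrite (poly_comb_widen h (size_scale_leq c q)) /poly_comb scaler_sumr.
by apply: eq_bigr => i _; rewrite coefZ scalerA.
Qed.

Lemma poly_comb0 h : poly_comb h 0 = 0.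
Proof. by rewrite /poly_comb size_poly0 big_ord0. Qed.

Lemma poly_comb_sum h I (r : seq I) (F : I -> {poly R}) :
  poly_comb h (\sum_(i <- r) F i) = \sum_(i <- r) poly_comb h (F i).
Proof.
elim: r => [|i r IH]; first by rewrite !big_nil poly_comb0.
by rewrite !big_cons poly_combD IH.
Qed.

Lemma poly_combMXn h q k : poly_comb h (q * 'X^k) = poly_comb (k + h) q.
Proof.
have s : (size (q * 'X^k)%R <= k + size q)%N.
  by rewrite (leq_trans (size_polyMleq _ _))// size_polyXn addnS /= addnC.
rewrite (poly_comb_widen h s) big_split_ord /= big1 ?add0r => [|i _]; last first.
  by rewrite coefMXn ltn_ord scale0r.
apply: eq_bigr => i _; rewrite coefMXn ltnNge leq_addr /= addKn.
by congr (_ *: (X _ : T -> R)); rewrite addnA (addnC k).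
Qed.

Lemma poly_comb_sqint h q : sqint P (poly_comb h q).
Proof. by apply: sqint_sum => i _; apply: sqintZ; exact: sqint_X. Qed.

Lemma poly_comb_shift h q :
  dotp P (poly_comb h q) (poly_comb h q) = dotp P (poly_comb 0 q) (poly_comb 0 q).
Proof.
have E k : dotp P (poly_comb k q) (poly_comb k q) = \sum_(i < size q) \sum_(j < size q)
    q`_i * (q`_j * autocov X (maxn i j - minn i j)).
  have s i : sqint P (q`_i *: (X (i + k)%N : T -> R)) by apply: sqintZ; exact: sqint_X.
  rewrite {1}/poly_comb dotp_suml//; last exact: poly_comb_sqint.
  apply: eq_bigr => i _; rewrite dotp_sumr//; apply: eq_bigr => j _.
  rewrite dotpZl//; last exact: sqint_X.
  rewrite dotpZr; [|exact: sqint_X|exact: sqint_X].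
  by rewrite dotp_X// -addn_maxl -addn_minl subnDr.
by rewrite !E.
Qed.

Definition null_rv Y := sqint P Y /\ dotp P Y Y = 0.

Lemma null_rvD Y Z : null_rv Y -> null_rv Z -> null_rv (Y + Z).
Proof.
move=> [sY Y0] [sZ Z0]; split; first exact: sqintD.
have := dotp_sqrD_le sY sZ; rewrite Y0 Z0 addr0 mulr0 => h.
by apply/eqP; rewrite eq_le h dotp_ge0.
Qed.

Lemma null_rvZ c Y : null_rv Y -> null_rv (c *: Y).
Proof.
move=> [sY Y0]; have sc := sqintZ c sY; split => //.
by rewrite dotpZl// dotpZr// Y0 !mulr0.
Qed.

Lemma null_rv0 : null_rv 0.
Proof. by split; [exact: sqint0|rewrite dotp0l]. Qed.

(** Polynomials with a null combination form an ideal: they are closed under sums, scalars and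
    multiplication by powers of ['X]. *)
Lemma null_poly_combM q1 q2 : null_rv (poly_comb 0 q1) -> null_rv (poly_comb 0 (q1 * q2)).
Proof.
move=> n1; rewrite -(coefK q2) poly_def mulr_sumr poly_comb_sum.
elim/big_ind : _ => [|Y Z|i _]; [exact: null_rv0|exact: null_rvD|].
rewrite -scalerAr poly_combZ; apply: null_rvZ; rewrite poly_combMXn addn0.
by split; [exact: poly_comb_sqint|rewrite poly_comb_shift; case: n1].
Qed.

(* Reduction modulo [v] makes size v powers of 'X spaced by an arbitrary step
   linearly dependent. *)
Lemma spaced_multiple (v : {poly R}) (M : nat) : v != 0 ->
  exists (y : 'rV[R]_(size v)) (q : {poly R}),
    y != 0 /\ v * q = \sum_(j < size v) y 0 j *: 'X^(j * M).
Proof.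
move=> v0; have s0 : (0 < size v)%N by rewrite size_poly_gt0.
pose A : 'M[R]_(size v, (size v).-1) :=
  \matrix_(j < size v) poly_rV ('X^(j * M) %% v).
(* The [size v] remainders lie in a space of dimension [(size v).-1], hence are linearly
   dependent. *)
have kA : kermx A != 0.
  rewrite kermx_eq0 /row_free; apply/eqP => rk.
  have := rank_leq_col A; rewrite rk; have := prednK s0; lia.
have /rowV0Pn[y /sub_kermxP yA y0] := kA.
exists y, (\sum_(j < size v) y 0 j *: ('X^(j * M) %/ v)); split => //.
have red : \sum_(j < size v) y 0 j *: ('X^(j * M) %% v) = 0.
  transitivity (rVpoly (y *m A)); last by rewrite yA linear0.
  rewrite mulmx_sum_row linear_sum; apply: eq_bigr => j _.
  rewrite linearZ /= rowK poly_rV_K// -ltnS prednK// ltn_modp//.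
transitivity (\sum_(j < size v) (v * (y 0 j *: ('X^(j * M) %/ v)) +
    y 0 j *: ('X^(j * M) %% v))).
  by rewrite big_split /= red addr0 mulr_sumr.
by apply: eq_bigr => j _; rewrite -scalerAr -scalerDr mulrC -divp_eq.
Qed.

(** Diagonal dominance: since |y_i y_j| <= (y_i^2 + y_j^2) / 2, correlations of size at most 1 / (2
    N) cost at most half of the sum of the y_i^2. *)
Lemma spaced_form_gt0 N (y : 'rV[R]_N) (rho : 'I_N -> 'I_N -> R) : y != 0 ->
  (forall i, rho i i = 1) -> (forall i j, i != j -> `|rho i j| <= (2 * N%:R)^-1) ->
  0 < \sum_i \sum_j y 0 i * (y 0 j * rho i j).
Proof.
move=> y0 r1 rb.
have N0 : (0 < N)%N.
  by case: N y y0 rho r1 rb => // y; rewrite thinmx0 eqxx.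
have NR : 0 < N%:R :> R by rewrite ltr0n.
pose S := \sum_i y 0 i ^+ 2.
have S0 : 0 < S.
  rewrite lt_def sumr_ge0 ?andbT; last by move=> i _; exact: sqr_ge0.
  apply: contra y0 => /eqP S0; apply/eqP/rowP => i; rewrite mxE.
  apply/eqP; rewrite -sqrf_eq0; move/eqP: S0; rewrite psumr_eq0 => [|j _]; last exact: sqr_ge0.
  by move/allP/(_ i); rewrite mem_index_enum => /(_ isT).
pose dl := (2 * N%:R)^-1 : R.
have dl0 : 0 < dl by rewrite invr_gt0 mulr_gt0.
have sumc (x : R) : \sum_(i < N) x = N%:R * x by rewrite sumr_const card_ord mulr_natl.
apply: (@lt_le_trans _ _ (\sum_i \sum_j ((i == j)%:R * y 0 i ^+ 2 -
    dl / 2 * (y 0 i ^+ 2 + y 0 j ^+ 2)))).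
  have -> : \sum_i \sum_j ((i == j)%:R * y 0 i ^+ 2 - dl / 2 * (y 0 i ^+ 2 + y 0 j ^+ 2)) =
      \sum_i (y 0 i ^+ 2 - dl / 2 * (N%:R * y 0 i ^+ 2 + S)).
    apply: eq_bigr => i _; rewrite sumrB -mulr_sumr big_split /= sumc; congr (_ - _).
    rewrite (bigD1 i)//= eqxx mul1r big1 ?addr0// => j ji.
    by rewrite eq_sym (negbTE ji) mul0r.
  rewrite sumrB -mulr_sumr big_split /= sumc -mulr_sumr -/S.
  rewrite (_ : S - _ = S / 2); first by rewrite divr_gt0.
  by rewrite /dl; field; rewrite gt_eqF.
apply: ler_sum => i _; apply: ler_sum => j _.
have := sqr_ge0 (y 0 i); have := sqr_ge0 (y 0 j).
have [<-|ij] := eqVneq i j.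
  by rewrite r1 mul1r mulr1 !expr2; nra.
rewrite mul0r sub0r => b a.
have := rb _ _ ij; rewrite -/dl ler_norml => /andP[h1 h2].
have := sqr_ge0 (y 0 i - y 0 j); have := sqr_ge0 (y 0 i + y 0 j).
rewrite !expr2 in a b *; nra.
Qed.

(* A null combination V of consecutive variables would make every multiple of
   the polynomial V null, in particular a combination of variables so far apart
   that they are almost orthonormal. *)
Lemma cov_matrix_unit p : cov_matrix X p \in unitmx.
Proof.
rewrite unitmxE unitfE; apply/negP => /det0P[v v0 vS].
have V0 : rVpoly v != 0.
  by apply: contra v0 => /eqP E; apply/eqP; rewrite -[v]rVpolyK E linear0.
have nV : null_rv (poly_comb 1 (rVpoly v)).
  split; first exact: poly_comb_sqint.
  have s i : sqint P ((rVpoly v)`_i *: (X (i + 1)%N : T -> R)) by apply: sqintZ; exact: sqint_X.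
  rewrite {1}(poly_comb_widen 1 (size_poly _ _)) dotp_suml//; last exact: poly_comb_sqint.
  rewrite (poly_comb_widen 1 (size_poly _ _)).
  transitivity (\sum_i (\sum_j v 0 j * cov_matrix X p j i) * v 0 i); last first.
    apply: big1 => i _; have := congr1 (fun A : 'rV_p => A 0 i) vS.
    by rewrite !mxE => ->; rewrite mul0r.
  transitivity (\sum_(j < p) \sum_(i < p) v 0 j * cov_matrix X p j i * v 0 i); last first.
    by rewrite exchange_big; apply: eq_bigr => i _; rewrite mulr_suml.
  apply: eq_bigr => j _; rewrite dotp_sumr//; apply: eq_bigr => i _.
  rewrite dotpZl//; last exact: sqint_X.
  rewrite dotpZr; [|exact: sqint_X|exact: sqint_X].
  by rewrite !coef_rVpoly_ord mxE covariance_dotp// !addn1; ring.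
(* [cov_matrix] starts at index 1, the ideal of null polynomials at index 0; stationarity joins the
   two. *)
have {}nV : null_rv (poly_comb 0 (rVpoly v)).
  by split; [exact: poly_comb_sqint|rewrite -(poly_comb_shift 1); case: nV].
set V := rVpoly v in V0 nV.
pose N := size V.
have N0 : (0 < N)%N by rewrite size_poly_gt0.
have dl0 : 0 < (2 * N%:R)^-1 :> R by rewrite invr_gt0 mulr_gt0// ltr0n.
have /cvgr0Pnorm_lt/(_ _ dl0)[M _ MA] := autocov_cvg0.
have [y [q [y0 Vq]]] := spaced_multiple M.+1 V0.
have [_] := null_poly_combM q nV.
rewrite Vq poly_comb_sum.
have pX j : poly_comb 0 (y 0 j *: 'X^(j * M.+1)) = y 0 j *: (X (j * M.+1)%N : T -> R).
  rewrite poly_combZ -[X in poly_comb _ X]mul1r poly_combMXn addn0.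
  by rewrite /poly_comb size_poly1 big_ord_recl big_ord0 /= addr0 coef1 scale1r.
under eq_bigr => j _ do rewrite pX.
have sX j : sqint P (y 0 j *: (X (j * M.+1)%N : T -> R)) by apply: sqintZ; exact: sqint_X.
move=> E.
have := @spaced_form_gt0 N y
  (fun i j => dotp P (X (i * M.+1)%N) (X (j * M.+1)%N)) y0.
rewrite (_ : \sum_i \sum_j _ = 0) ?ltxx; first last.
  rewrite -[RHS]E dotp_suml//; last exact: sqint_sum.
  apply: eq_bigr => i _; rewrite dotp_sumr//; apply: eq_bigr => j _.
  rewrite dotpZl//; last exact: sqint_X.
  by rewrite dotpZr//; exact: sqint_X.
move=> h; suff : false by []; apply: h => [i|i j ij]; first by rewrite dotp_XX.
rewrite dotp_X//; apply/ltW/MA => /=.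
rewrite -maxnMl -minnMl -mulnBl; apply: (@leq_trans (1 * M.+1)); first by rewrite mul1n.
rewrite leq_pmul2r//; have : val i != val j by [].
by rewrite neq_ltn; case: ltnP; lia.
Qed.

End Nondegenerate.

(** * Variances of partial sums *)

Section LagSums.
Context {R : realType}.

Lemma sum_lags (F : nat -> R) n :
  \sum_(1 <= i < n.+1) \sum_(1 <= j < n.+1) F (maxn i j - minn i j)%N =
  n%:R * F 0%N + 2 * \sum_(1 <= k < n.+1) (n%:R - k%:R) * F k.
Proof.
elim: n => [|n IH]; first by rewrite !big_nil mul0r mulr0 addr0.
have edge : \sum_(1 <= i < n.+1) F (n.+1 - i)%N = \sum_(1 <= k < n.+1) F k.
  by rewrite big_nat_rev /=; apply: eq_big_nat => i /andP[i1 i2]; congr F; lia.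
have e1 : \sum_(1 <= i < n.+1) F (maxn i n.+1 - minn i n.+1)%N = \sum_(1 <= k < n.+1) F k.
  by rewrite -edge; apply: eq_big_nat => i /andP[i1 i2]; congr F; lia.
have e2 : \sum_(1 <= i < n.+1) F (maxn n.+1 i - minn n.+1 i)%N = \sum_(1 <= k < n.+1) F k.
  by rewrite -edge; apply: eq_big_nat => i /andP[i1 i2]; congr F; lia.
rewrite big_nat_recr//=; under eq_big_nat => i _ do rewrite big_nat_recr//=.
rewrite big_split /= IH e1 (@big_nat_recr _ _ _ n.+1)//= e2 maxnn minnn subnn.
rewrite [in RHS](@big_nat_recr _ _ _ n.+1)//= subrr mul0r addr0.
have -> : \sum_(1 <= k < n.+1) (n.+1%:R - k%:R) * F k =
    \sum_(1 <= k < n.+1) (n%:R - k%:R) * F k + \sum_(1 <= k < n.+1) F k.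
  by rewrite -big_split; apply: eq_bigr => k _; rewrite /= -natr1; ring.
by rewrite -natr1; ring.
Qed.

Lemma sum_lags_le (F : nat -> R) n :
  \sum_(1 <= i < n.+1) \sum_(1 <= j < n.+1) F (maxn i j - minn i j)%N <=
  2 * n%:R * \sum_(k < n.+1) `|F k|.
Proof.
rewrite sum_lags big_ord_recl /=.
rewrite [leRHS](_ : _ = 2 * n%:R * `|F 0%N| + 2 * (n%:R * \sum_(1 <= k < n.+1) `|F k|)); last first.
  rewrite big_add1 /= big_mkord; under [in RHS]eq_bigr => k _ do rewrite -[X in F X]/(bump 0 k).
  by ring.
have n0 := ler0n R n.
apply: lerD.
  by have := ler_norm (F 0%N); have := normr_ge0 (F 0%N); nra.
rewrite ler_pM2l// mulr_sumr; apply: ler_sum_nat => k /andP[k1 kn].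
have kn' : k%:R <= n%:R :> R by rewrite ler_nat -ltnS.
have k0 := ler0n R k.
by have := ler_norm (F k); have := normr_ge0 (F k); nra.
Qed.

Variables (u : nat -> R) (D : R) (r : nat -> R).
Hypothesis u_slow : forall e : R, 0 < e -> exists N : nat, forall k n : nat,
  (N <= k)%N -> (k <= n)%N -> (n <= 3 * k)%N ->
  0 < u k /\ 0 < u n /\ `|u k / u n - 1| <= e.
Hypothesis D0 : 0 < D.
Hypothesis D1 : D < 1.
Hypothesis rE : forall k, (1 <= k)%N -> r k = regvar u (- D) k.

Let D1_gt0 : 0 < 1 - D.
Proof. by rewrite subr_gt0. Qed.

Lemma regvarS a n : (0 < n)%N -> regvar u (a + 1) n = n%:R * regvar u a n.
Proof.
move=> n0; rewrite /regvar powRD; last by rewrite pnatr_eq0 -lt0n n0 implybT.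
by rewrite powRr1//; ring.
Qed.

Lemma cvg_corr0 : r k @[k --> \oo] --> 0.
Proof.
have := cvg_regvar_neg u_slow D0; apply: cvg_trans; apply: near_eq_cvg.
by exists 1%N => // k /= k1; rewrite rE.
Qed.

Lemma cvg_sum_corr :
  (\sum_(1 <= k < n.+1) r k) / regvar u (1 - D) n @[n --> \oo] --> (1 - D)^-1.
Proof.
have h : - 1 < - D by rewrite ltrN2.
have := karamata_sum u_slow h; rewrite (_ : - D + 1 = 1 - D); last by ring.
apply: cvg_trans; apply: near_eq_cvg; apply: nearW => n.
by congr (_ / _); apply: eq_big_nat => k /andP[k1 _]; rewrite rE.
Qed.

(** The weighted sum is n times the sum of r(k) minus the sum of k r(k), of regular variation
    indices - D and 1 - D for the summands. Karamata's theorem gives 2 (1 / (1 - D) - 1 / (2 - D)) =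
    2 / ((1 - D) (2 - D)), which is the origin of c_D; the diagonal term n c is of lower order. *)
Lemma cvg_lag_variance (c : R) :
  (n%:R * c + 2 * \sum_(1 <= k < n.+1) (n%:R - k%:R) * r k) / regvar u (2 - D) n
    @[n --> \oo] --> 2 / ((1 - D) * (2 - D)).
Proof.
have h1 := D1_gt0.
have c1 : (regvar u (1 - D) n)^-1 @[n --> \oo] --> 0 := cvg_regvar_inv u_slow h1.
have h : - 1 < 1 - D by apply: lt_trans h1; rewrite ltrN10.
have := karamata_sum u_slow h; rewrite (_ : 1 - D + 1 = 2 - D); last by ring.
move=> c3.
have c4 : c * (regvar u (1 - D) n)^-1 + 2 *
    ((\sum_(1 <= k < n.+1) r k) / regvar u (1 - D) n -
     (\sum_(1 <= k < n.+1) regvar u (1 - D) k) / regvar u (2 - D) n) @[n --> \oo] -->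
    c * 0 + 2 * ((1 - D)^-1 - (2 - D)^-1).
  apply: cvgD; first by apply: cvgM; [exact: cvg_cst|exact: c1].
  apply: cvgM; first exact: cvg_cst.
  by apply: cvgB; [exact: cvg_sum_corr|exact: c3].
rewrite (_ : 2 / _ = c * 0 + 2 * ((1 - D)^-1 - (2 - D)^-1)); last first.
  by field; apply/andP; split; rewrite gt_eqF//; have := D1_gt0; lra.
move: c4; apply: cvg_trans; apply: near_eq_cvg.
exists 1%N => // n /= n0.
have nR : n%:R != 0 :> R by rewrite pnatr_eq0 -lt0n.
have -> : regvar u (2 - D) n = n%:R * regvar u (1 - D) n.
  by rewrite -regvarS//; congr regvar; ring.
have -> : \sum_(1 <= k < n.+1) (n%:R - k%:R) * r k =
    n%:R * (\sum_(1 <= k < n.+1) r k) - \sum_(1 <= k < n.+1) regvar u (1 - D) k.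
  rewrite mulr_sumr -sumrB; apply: eq_big_nat => k /andP[k1 _].
  rewrite mulrBl rE//; congr (_ - _); rewrite -regvarS//; congr regvar; ring.
rewrite (invfM n%:R).
set a := (regvar u _ n)^-1; set s1 := \sum_(1 <= k < n.+1) _; set s2 := \sum_(1 <= k < n.+1) _.
by field.
Qed.

(** As r is eventually positive and tends to 0, r(k)^2 <= e' r(k) from some index on, so the squares
    sum to a small multiple of the sum of r plus a constant. This treats D below, at and above 1/2
    alike. The choice of e' makes the limiting bound e / 4. *)
Lemma cvg_sum_sqr_corr :
  (\sum_(1 <= k < n.+1) r k ^+ 2) / regvar u (1 - D) n @[n --> \oo] --> 0.
Proof.
have h1 := D1_gt0.
apply/cvgr0Pnorm_le => e e0.
pose e' := e * (1 - D) / 4.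
have e'0 : 0 < e' by rewrite /e' divr_gt0// mulr_gt0.
have [N1 rN] := regvar_pos u_slow.
have /cvgr0Pnorm_le/(_ _ e'0)[N2 _ N2r] := cvg_corr0.
pose K := (N1 + N2).+1.
pose C := \sum_(1 <= k < K) `|r k ^+ 2 - e' * r k|.
have C0 : 0 <= C by apply: sumr_ge0.
have bd n : \sum_(1 <= k < n.+1) r k ^+ 2 <= C + e' * \sum_(1 <= k < n.+1) r k.
  rewrite -lerBlDr mulr_sumr -sumrB.
  apply: (@le_trans _ _ (\sum_(1 <= k < n.+1 | (k < K)%N) `|r k ^+ 2 - e' * r k|)).
    rewrite [leRHS]big_mkcond /=; apply: ler_sum_nat => k /andP[k1 _].
    case: ltnP => kK; first exact: ler_norm.
    have rk : 0 < r k by rewrite rE//; apply: rN; lia.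
    have : `|r k| <= e' by apply: N2r => /=; lia.
    by rewrite gtr0_norm// => ?; rewrite expr2 -mulrBl pmulr_lle0// subr_le0.
  rewrite /C; have [nK|Kn] := leqP n.+1 K.
    rewrite (@big_cat_nat _ _ _ n.+1 1 K)//= -[leLHS]addr0; apply: lerD; last exact: sumr_ge0.
    by rewrite big_mkcond /=; apply: ler_sum_nat => k _; case: ifP.
  rewrite (@big_cat_nat _ _ _ K 1 n.+1)//=; last exact: ltnW.
  rewrite [X in _ + X]big_nat_cond [X in _ + X]big1 ?addr0; last first.
    by move=> k /andP[/andP[k1 _]]; rewrite ltnNge k1.
  by rewrite big_mkcond /=; apply: ler_sum_nat => k _; case: ifP.
have c1 : C * (regvar u (1 - D) n)^-1 + e' *
    ((\sum_(1 <= k < n.+1) r k) / regvar u (1 - D) n) @[n --> \oo] -->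
    C * 0 + e' * (1 - D)^-1.
  apply: cvgD; apply: cvgM; first exact: cvg_cst.
  - exact: (cvg_regvar_inv u_slow h1).
  - exact: cvg_cst.
  - exact: cvg_sum_corr.
have lim_lt : C * 0 + e' * (1 - D)^-1 < e.
  by rewrite mulr0 add0r /e' mulrAC mulfK ?gt_eqF//; lra.
have [N3 _ N3h] := cvgr_lt _ c1 _ lim_lt.
exists (N1 + N3)%N => // n /= nN.
have rp : 0 < regvar u (1 - D) n by apply: rN; lia.
rewrite ger0_norm; last by rewrite divr_ge0 ?(ltW rp)// sumr_ge0// => k _; exact: sqr_ge0.
have /N3h/ltW : (N3 <= n)%N by lia.
apply: le_trans.
rewrite mulrA -mulrDl ler_pM2r ?invr_gt0//; exact: bd.
Qed.

End LagSums.

(** * Covariances of functions of windows *)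

Section Windows.
Context d (T : measurableType d) (R : realType) (P : probability T R).
Variable X : nat -> {RV P >-> R}.
Hypothesis X_stationary : stationary X.

Definition subtuple m s q (h : (s + q <= m)%N) (t : m.-tuple R) : q.-tuple R :=
  [tuple tnth t (widen_ord h (rshift s j)) | j < q].

Lemma measurable_subtuple m s q (h : (s + q <= m)%N) : measurable_fun setT (subtuple h).
Proof.
apply/measurable_fun_tnthP => j.
rewrite (_ : _ \o _ = fun t => tnth t (widen_ord h (rshift s j))); first exact: measurable_tnth.
by apply/funext => t /=; rewrite tnth_mktuple.
Qed.

Lemma subtuple_window m s q (h : (s + q <= m)%N) i w :
  subtuple h (window X i m w) = window X (i + s)%N q w.
Proof. by apply: eq_from_tnth => j; rewrite !tnth_mktuple /= addnA. Qed.

(** Both windows are read off a single longer one, to which stationarity applies; their joint law is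
    therefore shift-invariant. *)
Lemma dotp_window_shift i s1 s2 q1 q2 (g1 : q1.-tuple R -> R) (g2 : q2.-tuple R -> R) :
  measurable_fun setT g1 -> measurable_fun setT g2 ->
  sqint P (fun w => g1 (window X 0 q1 w)) -> sqint P (fun w => g2 (window X 0 q2 w)) ->
  dotp P (fun w => g1 (window X (i + s1)%N q1 w)) (fun w => g2 (window X (i + s2)%N q2 w)) =
  dotp P (fun w => g1 (window X s1 q1 w)) (fun w => g2 (window X s2 q2 w)).
Proof.
move=> mg1 mg2 sg1 sg2.
pose m := maxn (s1 + q1) (s2 + q2).
have h1 : (s1 + q1 <= m)%N := leq_maxl _ _.
have h2 : (s2 + q2 <= m)%N := leq_maxr _ _.
pose F t := g1 (subtuple h1 t) * g2 (subtuple h2 t).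
have mF : measurable_fun setT F.
  by apply: measurable_funM; apply: measurableT_comp => //; exact: measurable_subtuple.
have FE j : (fun w => F (window X j m w)) =
    fun w => g1 (window X (j + s1)%N q1 w) * g2 (window X (j + s2)%N q2 w).
  by apply/funext => w; rewrite /F !subtuple_window.
have iF : P.-integrable setT (EFin \o (fun w => F (window X 0 m w))).
  by rewrite FE; apply: sqintM_integrable; exact: stationary_sqint.
by have [_] := @stationary_integral _ _ _ _ X X_stationary i m F mF iF; rewrite !FE.
Qed.

End Windows.

Section Whitening.
Context d (T : measurableType d) (R : realType) (P : probability T R).
Variable X : nat -> {RV P >-> R}.
Hypothesis X_stationary : stationary X.
Hypothesis X_gaussian : gaussian_process X.
Hypothesis X_standard : standardized X.
Variables (p : nat) (A : 'M[R]_p).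
Hypothesis cov_fact : cov_matrix X p = A *m A^T.
Hypothesis A_unit : A \in unitmx.
Local Notation B := (invmx A).

Let sX i : sqint P (X i) := sqint_X X_standard i.

(** The coordinates of A^-1 applied to the window at i. Since Sigma_p = A A^T they form a standard
    Gaussian vector for each i, as the Mehler-type bound requires. *)
Definition whiten i (j : 'I_p) : T -> R := \sum_(k < p) B j k *: (X (i + k)%N : T -> R).

Lemma whiten_lincomb i j : lincomb X (whiten i j).
Proof. by apply: lincomb_sum => k _; apply: lincombZ; exact: lincomb_X. Qed.

Lemma dotp_whiten_l i j Y : sqint P Y ->
  dotp P (whiten i j) Y = \sum_(k < p) B j k * dotp P (X (i + k)%N) Y.
Proof.
move=> sY; rewrite dotp_suml// => [|k _]; last exact: sqintZ.
by apply: eq_bigr => k _; rewrite dotpZl.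
Qed.

Lemma dotp_whiten i i' j j' : dotp P (whiten i j) (whiten i' j') =
  \sum_(k < p) \sum_(k' < p) B j k * B j' k' * dotp P (X (i + k)%N) (X (i' + k')%N).
Proof.
rewrite dotp_whiten_l; last exact: (lincomb_sqint X_standard (whiten_lincomb _ _)).
apply: eq_bigr => k _; rewrite dotpC dotp_whiten_l// mulr_sumr.
by apply: eq_bigr => k' _; rewrite mulrA (dotpC P (X (i' + k')%N)).
Qed.

Lemma whiten_orthonormal i j j' : dotp P (whiten i j) (whiten i j') = (j == j')%:R.
Proof.
rewrite dotp_whiten; have E : B *m cov_matrix X p *m B^T = 1%:M.
  by rewrite cov_fact mulmxA mulVmx// mul1mx -trmx_mul mulVmx// trmx1.
have := congr1 (fun N : 'M[R]_p => N j j') E; rewrite !mxE => <-.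
rewrite exchange_big; apply: eq_bigr => k' _.
rewrite !mxE mulr_suml; apply: eq_bigr => k _.
by rewrite mxE covariance_dotp// !dotp_X// -addn_maxr -addn_minr subnDl maxnSS minnSS subSS; ring.
Qed.

Lemma window_whiten i w :
  window X i p w = tuple_mulmx A [tuple whiten i j w | j < p].
Proof.
apply: eq_from_tnth => k; rewrite !tnth_mktuple.
under eq_bigr => j _ do rewrite tnth_mktuple /whiten fct_sumE mulr_sumr.
rewrite exchange_big /=.
transitivity (\sum_(l < p) (A *m B) k l * X (i + l)%N w); last first.
  apply: eq_bigr => l _; rewrite mxE mulr_suml; apply: eq_bigr => j _.
  by rewrite mulrA.
rewrite mulmxV// (bigD1 k)//= mxE eqxx mul1r big1 ?addr0// => l lk.
by rewrite mxE eq_sym (negbTE lk) mul0r.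
Qed.

Lemma measurable_tuple_mulmx : measurable_fun setT (tuple_mulmx A).
Proof.
apply/measurable_fun_tnthP => k.
rewrite (_ : _ \o _ = fun t => \sum_(j < p) A k j * tnth t j); last first.
  by apply/funext => t /=; rewrite tnth_mktuple.
apply: measurable_sum => j; apply: measurable_funM => //; exact: measurable_tnth.
Qed.

Lemma window_L2closure (g : p.-tuple R -> R) i : measurable_fun setT g ->
  sqint P (fun w => g (window X i p w)) ->
  L2closure P (cas_span (whiten i)) (fun w => g (window X i p w)).
Proof.
move=> mg; have mU j : measurable_fun setT (whiten i j).
  by have [] := lincomb_sqint X_standard (whiten_lincomb i j).
have -> : (fun w => g (window X i p w)) =
    fun w => (g \o tuple_mulmx A) [tuple whiten i j w | j < p].
  by apply/funext => w /=; rewrite window_whiten.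
apply: cas_span_dense => //; apply: measurableT_comp => //.
exact: measurable_tuple_mulmx.
Qed.

Lemma sqr_sum_le n (x : 'I_n -> R) : (\sum_i x i) ^+ 2 <= n%:R * \sum_i x i ^+ 2.
Proof.
rewrite expr2 mulr_suml.
have -> : n%:R * \sum_i x i ^+ 2 = \sum_i \sum_j (x i ^+ 2 + x j ^+ 2) / 2.
  transitivity (\sum_(i < n) (n%:R * (x i ^+ 2 / 2) + (\sum_j x j ^+ 2) / 2)).
    by rewrite big_split /= -mulr_sumr -mulr_suml sumr_const card_ord -mulr_natl; field.
  apply: eq_bigr => i _; rewrite -mulr_suml big_split /= sumr_const card_ord -mulr_natl.
  by field.
apply: ler_sum => i _; rewrite mulr_sumr; apply: ler_sum => j _.
by have := sqr_ge0 (x i - x j); rewrite sqrrB; lra.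
Qed.

Variable g : p.-tuple R -> R.
Hypothesis mg : measurable_fun setT g.
Local Notation Y := (fun i w => g (window X i p w)).
Hypothesis sY : sqint P (Y 0%N).
Hypothesis Y1 : forall i, dotp P (Y i) 1 = 0.
Hypothesis YX : forall i (j : 'I_p), dotp P (Y i) (X (i + j)%N) = 0.

(** The cross-covariance of two whitened windows is at most K^2 E entrywise, where K comes from A^-1
    and E sums the correlations at all lags involved. The Mehler-type bound is quadratic in E, and
    E^2 is at most 2 p times the sum of squares. *)
Lemma window_lag_bound : exists C : R, 0 <= C /\ forall i k,
  `|dotp P (Y i) (Y (i + k + p)%N)| <= C * \sum_(m < 2 * p) autocov X (k + m) ^+ 2.
Proof.
pose K : R := \sum_i \sum_j `|B i j|.
have K0 : 0 <= K by apply: sumr_ge0 => i _; apply: sumr_ge0.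
have BK i : \sum_j `|B i j| <= K.
  rewrite /K [leRHS](bigD1 i)//= lerDl; apply: sumr_ge0 => j _; exact: sumr_ge0.
pose G := dotp P (Y 0%N) (Y 0%N).
have G0 : 0 <= G := dotp_ge0 P (Y 0%N).
exists ((p%:R * K ^+ 2) ^+ 2 * (2 * p)%:R * G); split.
  by rewrite !mulr_ge0// sqr_ge0.
move=> i k; set l := (i + k + p)%N.
(* The lag between coordinate a of the window at i and coordinate b of the window at l is k + (b + p
   - a), with 0 <= b + p - a < 2 p. The offset p in l keeps it at least k. *)
pose E : R := \sum_(m < 2 * p) `|autocov X (k + m)|.
have E0 : 0 <= E by exact: sumr_ge0.
have sYh h : sqint P (Y h) := stationary_sqint X_stationary h mg sY.
have YYG h : dotp P (Y h) (Y h) = G.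
  by have := dotp_window_shift X_stationary h 0 0 mg mg sY sY; rewrite !addn0.
have sU h j := lincomb_sqint X_standard (whiten_lincomb h j).
have YU h j : dotp P (Y h) (whiten h j) = 0.
  rewrite dotpC dotp_whiten_l//; apply: big1 => a _.
  by rewrite dotpC YX mulr0.
pose M := \matrix_(j, j') dotp P (whiten i j) (whiten l j').
have Me j j' : `|M j j'| <= K ^+ 2 * E.
  rewrite mxE dotp_whiten.
  apply: le_trans (ler_norm_sum _ _ _) _.
  apply: (@le_trans _ _ (\sum_a `|B j a| * (K * E))); last first.
    by rewrite -mulr_suml expr2 -mulrA ler_wpM2r ?mulr_ge0//; exact: BK.
  apply: ler_sum => a _; apply: le_trans (ler_norm_sum _ _ _) _.
  apply: (@le_trans _ _ (\sum_b `|B j a| * (`|B j' b| * E))); last first.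
    by rewrite -mulr_sumr -mulr_suml ler_wpM2l// ler_wpM2r//; exact: BK.
  apply: ler_sum => b _; rewrite !normrM -!mulrA !ler_wpM2l// dotp_X//.
  have lt : (b + p - a < 2 * p)%N by have := ltn_ord a; have := ltn_ord b; lia.
  rewrite /E (bigD1 (Ordinal lt))//= (_ : _ - _ = k + (b + p - a))%N; last first.
    by have := ltn_ord a; rewrite /l; lia.
  by rewrite lerDl sumr_ge0.
have key : `|dotp P (Y i) (Y l)| <= (p%:R * (K ^+ 2 * E)) ^+ 2 * G.
  have [pe|pe] := lerP (p%:R * (K ^+ 2 * E)) 1.
    have gp h h' := lincomb_gaussian_pair X_gaussian X_standard (whiten_lincomb h)
      (whiten_lincomb h') (whiten_orthonormal h) (whiten_orthonormal h').
    have M1 h : \matrix_(j, j') dotp P (whiten h j) (whiten h j') = 1%:M :> 'M[R]_p.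
      by apply/matrixP => j j'; rewrite !mxE whiten_orthonormal.
    have gU h : gaussian_pair P (whiten h) (whiten h) 1%:M by have := gp h h; rewrite M1.
    have := mehler_bound (gU i) (gU l) (gp i l) (sU i) (sU l) Me pe
      (window_L2closure mg (sYh i)) (window_L2closure mg (sYh l)).
    (* Both subtracted terms vanish, Y being orthogonal to 1 and to the whitened coordinates. *)
    rewrite /second_order_form !Y1 mulr0 subr0 big1 ?subr0; last first.
      by move=> j _; apply: big1 => j' _; rewrite !YU !mulr0.
    rewrite !YYG => h; apply: le_trans h _; rewrite le_eqVlt; apply/orP; left; apply/eqP.
    by field.
  (* Correlations too large for the series comparison: the claimed bound then exceeds G, which
     Cauchy-Schwarz provides. *)
  apply: (@le_trans _ _ G).
    have := dotp_CS (sYh i) (sYh l); rewrite !YYG -expr2.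
    by rewrite -(real_normK (num_real (dotp P (Y i) (Y l)))) ler_sqr ?nnegrE.
  by rewrite ler_peMl// exprn_ege1// ltW.
apply: le_trans key _.
pose S : R := \sum_(m < 2 * p) autocov X (k + m) ^+ 2.
have ES : E ^+ 2 <= (2 * p)%:R * S.
  apply: le_trans (sqr_sum_le _) _.
  by rewrite ler_wpM2l//; apply: ler_sum => m _; rewrite real_normK// num_real.
rewrite -/S (_ : _ * S = (p%:R * K ^+ 2) ^+ 2 * ((2 * p)%:R * S) * G); last by ring.
by rewrite mulrA exprMn ler_wpM2r// ler_wpM2l// sqr_ge0.
Qed.

End Whitening.

Section BoundedL2.
Context d (T : measurableType d) (R : realType) (P : probability T R).
Implicit Types F G : nat -> T -> R.

Definition bounded_L2 F : Prop := (forall n, sqint P (F n)) /\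
  exists C : R, forall n, dotp P (F n) (F n) <= C.

Lemma bounded_L2D F G : bounded_L2 F -> bounded_L2 G -> bounded_L2 (fun n => F n + G n).
Proof.
move=> [sF [C FC]] [sG [C' GC]]; split => [n|]; first exact: sqintD.
exists (2 * (C + C')) => n; apply: le_trans (dotp_sqrD_le (sF n) (sG n)) _.
by rewrite ler_pM2l// lerD.
Qed.

Lemma bounded_L2Z c F : bounded_L2 F -> bounded_L2 (fun n => c *: F n).
Proof.
move=> [sF [C FC]]; have sc n : sqint P (c *: F n) := sqintZ c (sF n).
split => //; exists (c ^+ 2 * C) => n.
by rewrite dotpZl// dotpZr// mulrA -expr2 ler_wpM2l// sqr_ge0.
Qed.

Lemma bounded_L2_sum I (s : seq I) (F : I -> nat -> T -> R) :
  (forall i, bounded_L2 (F i)) -> bounded_L2 (fun n => \sum_(i <- s) F i n).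
Proof.
move=> bF; elim: s => [|i s IH].
  split => [n|]; first by rewrite big_nil; exact: sqint0.
  by exists 0 => n; rewrite big_nil dotp0l.
rewrite (_ : (fun n => _) = fun n => F i n + \sum_(j <- s) F j n).
  exact: bounded_L2D.
by apply/funext => n; rewrite big_cons.
Qed.

End BoundedL2.

Section PartialSums.
Context d (T : measurableType d) (R : realType) (P : probability T R).
Variable X : nat -> {RV P >-> R}.
Hypothesis X_stationary : stationary X.
Hypothesis X_standard : standardized X.

Let sX i : sqint P (X i) := sqint_X X_standard i.

Lemma autocov_le1 k : `|autocov X k| <= 1.
Proof.
have := dotp_CS (sX 0%N) (sX k); rewrite !dotp_XX// mulr1 -{1}(dotp_shift X_stationary X_standard 0).
by rewrite add0n => h; rewrite -(expr_le1 (n := 2))// real_normK ?num_real.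
Qed.

Definition partial_sum n : T -> R := \sum_(1 <= i < n.+1) (X i : T -> R).

Lemma partial_sum_lincomb n : lincomb X (partial_sum n).
Proof. by apply: lincomb_sum => i _; exact: lincomb_X. Qed.

Lemma dotp_partial_sum n : dotp P (partial_sum n) (partial_sum n) =
  n%:R * autocov X 0 + 2 * \sum_(1 <= k < n.+1) (n%:R - k%:R) * autocov X k.
Proof.
rewrite -sum_lags {1}/partial_sum dotp_suml//; last exact: sqint_sum.
apply: eq_bigr => i _; rewrite dotp_sumr//; apply: eq_bigr => j _.
by rewrite dotp_X.
Qed.

(** Each unit shift of the summation range exchanges one variable at either end, so the difference
    consists of j variables gained and j lost, all of norm 1, whatever n. *)
Lemma bounded_L2_edges j : bounded_L2 P
  (fun n => \sum_(1 <= i < n.+1) (X (i + j)%N : T -> R) - partial_sum n).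
Proof.
have bX (s : nat -> nat) : bounded_L2 P (fun n => X (s n) : T -> R).
  by split => [n //|]; exists 1 => n; rewrite dotp_XX.
elim: j => [|j IH].
  rewrite (_ : (fun n => _) = fun n => 0 *: (X 0%N : T -> R)).
    exact: (bounded_L2Z 0 (bX (fun=> 0%N))).
  apply/funext => n; rewrite scale0r /partial_sum.
  by under eq_bigr => i _ do rewrite addn0; rewrite subrr.
have tel n : \sum_(1 <= i < n.+1) (X (i + j.+1)%N : T -> R) + X j.+1 =
    \sum_(1 <= i < n.+1) (X (i + j)%N : T -> R) + X (n + j.+1)%N.
  elim: n => [|n IHn]; first by rewrite !big_nil.
  rewrite !(@big_nat_recr _ _ _ n.+1)//= addrAC IHn.
  by rewrite -addSnnS.
rewrite (_ : (fun n => _) = fun n => \sum_(1 <= i < n.+1) (X (i + j)%N : T -> R) -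
    partial_sum n + X (n + j.+1)%N + -1 *: (X j.+1 : T -> R)).
  apply: bounded_L2D; first by apply: bounded_L2D; [exact: IH|exact: bX].
  by apply: bounded_L2Z; exact: (bX (fun=> j.+1)).
apply/funext => n; rewrite scaleN1r -[X in X - _](addrK (X j.+1 : T -> R)) tel.
by rewrite addrAC (addrAC (\sum_(1 <= i < n.+1) _)).
Qed.

End PartialSums.

Section Remainder.
Context d (T : measurableType d) (R : realType) (P : probability T R).
Variable X : nat -> {RV P >-> R}.
Hypothesis X_stationary : stationary X.
Hypothesis X_gaussian : gaussian_process X.
Hypothesis X_standard : standardized X.
Variables (p : nat) (A : 'M[R]_p).
Hypothesis cov_fact : cov_matrix X p = A *m A^T.
Hypothesis A_unit : A \in unitmx.
Variable g : p.-tuple R -> R.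
Hypothesis mg : measurable_fun setT g.
Local Notation Y := (fun i w => g (window X i p w)).
Hypothesis sY : sqint P (Y 0%N).
Hypothesis Y1 : forall i, dotp P (Y i) 1 = 0.
Hypothesis YX : forall i (j : 'I_p), dotp P (Y i) (X (i + j)%N) = 0.

Let sYh h : sqint P (Y h) := stationary_sqint X_stationary h mg sY.

(** By stationarity the variance is a sum over lags, at most 2 n times the sum of the absolute
    covariances; those at lags p and beyond are bounded by squared correlations. *)
Lemma remainder_bound : exists C : R, 0 <= C /\ forall n,
  dotp P (\sum_(1 <= i < n.+1) Y i) (\sum_(1 <= i < n.+1) Y i) <=
  C * n%:R * (1 + \sum_(1 <= k < n.+1) autocov X k ^+ 2).
Proof.
pose r := autocov X; pose G := dotp P (Y 0%N) (Y 0%N).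
have G0 : 0 <= G := dotp_ge0 P (Y 0%N).
have [C [C0 Cb]] := window_lag_bound X_stationary X_gaussian X_standard cov_fact A_unit
  mg sY Y1 YX.
have YY i k : dotp P (Y i) (Y (i + k)%N) = dotp P (Y 0%N) (Y k).
  by have := dotp_window_shift X_stationary i 0 k mg mg sY sY; rewrite addn0.
have r1 k : r k ^+ 2 <= 1.
  by rewrite -real_normK ?num_real// expr_le1// autocov_le1.
(* Translating the range by m brings in at most m new lags, each contributing at most 1; the other 1
   accounts for lag 0. *)
have shift n m : \sum_(k < n.+1) r (k + m)%N ^+ 2 <= 1 + m%:R + \sum_(1 <= k < n.+1) r k ^+ 2.
  elim: m => [|m IH].
    rewrite big_ord_recl addr0 big_add1 big_mkord; apply: lerD => //.
    by apply: ler_sum => k _; rewrite addn0.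
  apply: (@le_trans _ _ (\sum_(k < n.+2) r (k + m)%N ^+ 2)).
    rewrite [leRHS]big_ord_recl -[leLHS]add0r; apply: lerD; first exact: sqr_ge0.
    by apply: ler_sum => k _; rewrite addSnnS.
  by rewrite big_ord_recr -natr1 /= addrA [leRHS]addrAC lerD.
pose C' := p%:R * G + C * ((2 * p)%:R * (1 + (2 * p)%:R)).
have C'0 : 0 <= C' by rewrite addr_ge0 ?mulr_ge0// addr_ge0.
exists (2 * C'); split; first by rewrite mulr_ge0.
move=> n; set S := \sum_(1 <= k < n.+1) autocov X k ^+ 2.
have S0 : 0 <= S by apply: sumr_ge0 => k _; exact: sqr_ge0.
have -> : dotp P (\sum_(1 <= i < n.+1) Y i) (\sum_(1 <= i < n.+1) Y i) =
    \sum_(1 <= i < n.+1) \sum_(1 <= j < n.+1) dotp P (Y 0%N) (Y (maxn i j - minn i j)%N).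
  rewrite dotp_suml//; last exact: sqint_sum.
  apply: eq_bigr => i _; rewrite dotp_sumr//; apply: eq_bigr => j _.
  have [ij|ji] := leqP i j; first by rewrite -{1}(subnKC ij) YY.
  by rewrite dotpC -{1}(subnKC (ltnW ji)) YY.
apply: le_trans (sum_lags_le (fun k => dotp P (Y 0%N) (Y k)) n) _.
rewrite -!mulrA ler_pM2l// mulrCA ler_wpM2l//.
(* The range is enlarged so as to split at p: overlapping windows, at lags below p, are only given
   the Cauchy-Schwarz bound G. *)
apply: (@le_trans _ _ (\sum_(k < p + n.+1) `|dotp P (Y 0%N) (Y k)|)).
  by rewrite addnC big_split_ord /= lerDl sumr_ge0.
rewrite big_split_ord /=.
apply: (@le_trans _ _ (p%:R * G + C * ((2 * p)%:R * (1 + (2 * p)%:R + S)))).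
  apply: lerD.
    rewrite -[p in p%:R]card_ord mulr_natl -sumr_const; apply: ler_sum => k _.
    have := dotp_CS sY (sYh k).
    have := YY k 0%N; rewrite addn0 => ->; rewrite -/G -expr2.
    by rewrite -(real_normK (num_real (dotp P (Y 0%N) (Y k)))) ler_sqr ?nnegrE.
  apply: (@le_trans _ _ (\sum_(k < n.+1) C * \sum_(m < 2 * p) r (k + m)%N ^+ 2)).
    by apply: ler_sum => k _; rewrite addnC; exact: (Cb 0%N).
  rewrite -mulr_sumr ler_wpM2l// exchange_big.
  rewrite -[(2 * p)%N in leRHS]card_ord mulr_natl -sumr_const.
  apply: ler_sum => m _; apply: le_trans (shift n m) _.
  by rewrite card_ord lerD2r lerD2l ler_nat ltnW.
rewrite -subr_ge0 (_ : _ - _ = p%:R * G * S + C * ((2 * p)%:R * ((2 * p)%:R * S))).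
  by rewrite addr_ge0 ?mulr_ge0.
by rewrite /C'; ring.
Qed.

End Remainder.

(** * The limit theorem *)

Lemma expectation_fine d (T : measurableType d) (R : realType) (P : probability T R)
    (Y Z : T -> R) : fine 'E_P[fun w => (Y w * Z w)%R]%E = dotp P Y Z.
Proof. by rewrite unlock. Qed.

Theorem theorem5p6 (d : measure_display) (T : measurableType d) (R : realType)
  (P : probability T R) (X : nat -> {RV P >-> R}) (D : R) (L : R -> R)
  (p : nat) (f : p.-tuple R -> R)
  (X_stationary : stationary X) (X_gaussian : gaussian_process X)
  (X_standard : standardized X)
  (D_gt0 : 0 < D) (D_lt1 : D < 1) (L_slow : slowly_varying L)
  (autocovE : forall k : nat, (1 <= k)%N ->
     autocov X k = L k%:R * k%:R `^ (- D))
  (p_gt0 : (0 < p)%N)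
  (f_meas : measurable_fun [set: p.-tuple R] f)
  (f_rank : hermite_rank (cov_matrix X p) f 1)
  (f_sq : ('E_P[fun w => (f (window X 1 p w) ^+ 2)%R] < +oo)%E) :
  let c_D := 2 / ((1 - D) * (2 - D)) in
  let alpha := invmx (cov_matrix X p) *m cross_moments X f in
  let mean := fine 'E_P[fun w => f (window X 1 p w)]%E in
  cvg_in_law P
    (fun (n : nat) (w : T) =>
       (\sum_(1 <= i < n.+1) (f (window X i p w) - mean)) /
       (n%:R `^ (1 - D / 2) * Num.sqrt (L n%:R)))
    (gaussian_law 0 (c_D * (\sum_(j < p) alpha j 0) ^+ 2)).
Proof.
move=> c_D alpha mean.
pose u n := L n%:R; pose r := autocov X.
have u_slow := fun e e0 => @slowly_varying_uniform R L e L_slow e0.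
have rE k : (1 <= k)%N -> r k = regvar u (- D) k.
  by move=> k1; rewrite /r autocovE// mulrC.
have r0 : r k @[k --> \oo] --> 0 := @cvg_corr0 R u D r u_slow D_gt0 rE.
have Su : cov_matrix X p \in unitmx := cov_matrix_unit X_stationary X_standard r0 p.
(* Supplies the square factor of Sigma_p by which the windows are whitened. *)
have [A SA _] := f_rank.
have Au : A \in unitmx by move: Su; rewrite SA unitmx_mul => /andP[].
have sX i : sqint P (X i) := sqint_X X_standard i.
pose fW i w := f (window X i p w).
have mf2 : measurable_fun setT (fun t => (f t ^+ 2)%:E).
  by apply/measurable_EFinP; exact: measurable_funX.
have sf0 : sqint P (fW 0%N).
  split; first by apply: measurableT_comp => //; exact: measurable_window.
  apply/integrableP; split.
    apply/measurable_EFinP; apply: measurable_funX.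
    by apply: measurableT_comp => //; exact: measurable_window.
  under eq_integral do rewrite /= ger0_norm ?sqr_ge0//.
  have f20 t : (0 <= (f t ^+ 2)%:E)%E by rewrite lee_fin sqr_ge0.
  have /= <- := stationary_ge0_integral X_stationary 1 mf2 f20.
  by move: f_sq; rewrite unlock.
have sf i : sqint P (fW i) := stationary_sqint X_stationary i f_meas sf0.
have mean_i i : dotp P (fW i) 1 = mean.
  rewrite /mean (expectation_dotp (sf 1%N)) /=.
  have m1 : measurable_fun setT (cst 1 : p.-tuple R -> R) by exact: measurable_cst.
  have h k := dotp_window_shift X_stationary k 0 0 f_meas m1 sf0 (sqint1 P).
  by have := h i; have := h 1%N; rewrite !addn0 => <-.
pose c := cross_moments X f.
have cross_i i (j : 'I_p) : dotp P (fW i) (X (i + j)%N) = c j 0.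
  have mj : measurable_fun setT (fun t : p.-tuple R => tnth t j) by exact: measurable_tnth.
  have cE k : (fun w => tnth (window X k p w) j) = X (k + j)%N.
    by apply/funext => w; rewrite tnth_mktuple.
  have sj : sqint P (fun w => tnth (window X 0 p w) j) by rewrite cE.
  have h k := dotp_window_shift X_stationary k 0 0 f_meas mj sf0 sj.
  rewrite mxE expectation_fine.
  by have := h i; have := h 1%N; rewrite !addn0 !cE => <-.
(* As alpha solves the normal equations Sigma_p alpha = c, the linear part is the L^2 projection of
   the centered f on the window, and the rest is orthogonal to every coordinate. *)
pose g t := f t - mean - \sum_(j < p) alpha j 0 * tnth t j.
have mg : measurable_fun setT g.
  apply: measurable_funB; first exact: measurable_funB.
  apply: measurable_sum => j; apply: measurable_funM => //; exact: measurable_tnth.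
pose Y i w := g (window X i p w).
have YE i : Y i = fW i - mean *: (1 : T -> R) - \sum_(j < p) alpha j 0 *: (X (i + j)%N : T -> R).
  apply/funext => w; rewrite /Y /g -[RHS]/(fW i w - mean * 1 - _ w) mulr1 fct_sumE.
  by congr (_ - _); apply: eq_bigr => j _; rewrite tnth_mktuple.
have sM : sqint P (mean *: (1 : T -> R)) := sqintZ mean (sqint1 P).
have sF1 i : sqint P (fW i - mean *: (1 : T -> R)) := sqintB (sf i) sM.
have sax i j : sqint P (alpha j 0 *: (X (i + j)%N : T -> R)) := sqintZ _ (sX _).
have sLin i : sqint P (\sum_(j < p) alpha j 0 *: (X (i + j)%N : T -> R)).
  by apply: sqint_sum => j _.
have one : dotp P 1 1 = 1.
  rewrite /dotp (_ : (fun w => _) = cst 1) ?Rintegral_cst//=; last first.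
    by apply/funext => w; rewrite mulr1.
  by rewrite probability_setT mul1r.
have s1 := sqint1 P.
have Y1 i : dotp P (Y i) 1 = 0.
  rewrite YE dotpBl// dotpBl// dotpZl// one mulr1 mean_i subrr sub0r.
  rewrite dotp_suml// big1 ?oppr0// => j _.
  by rewrite dotpZl// dotp_X1// mulr0.
have YX i (j : 'I_p) : dotp P (Y i) (X (i + j)%N) = 0.
  rewrite YE dotpBl// dotpBl// dotpZl// cross_i (dotpC P 1) dotp_X1// mulr0 subr0.
  have -> : c = cov_matrix X p *m alpha by rewrite /alpha mulKVmx.
  apply/eqP; rewrite subr_eq0 mxE dotp_suml//; apply/eqP/eq_bigr => k _.
  rewrite dotpZl// mxE covariance_dotp// !dotp_X// maxnSS minnSS subSS.
  by rewrite -addn_maxr -addn_minr subnDl maxnC minnC mulrC.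
have sY0 : sqint P (Y 0%N) by rewrite YE; exact: sqintB.
have sY i : sqint P (Y i) := stationary_sqint X_stationary i mg sY0.
have [C [C0 CY]] := remainder_bound X_stationary X_gaussian X_standard SA Au mg sY0 Y1 YX.
pose S := partial_sum X.
have sS n : sqint P (S n) := lincomb_sqint X_standard (partial_sum_lincomb X n).
pose nrm n := n%:R `^ (1 - D / 2) * Num.sqrt (L n%:R).
pose a := \sum_(j < p) alpha j 0.
pose E n : T -> R := \sum_(j < p) alpha j 0 *:
  (\sum_(1 <= i < n.+1) (X (i + j)%N : T -> R) - S n).
have [sE [CE CEb]] : bounded_L2 P E.
  apply: bounded_L2_sum => j; apply: bounded_L2Z; exact: bounded_L2_edges.
pose V n : T -> R := \sum_(1 <= i < n.+1) Y i.
have sV n : sqint P (V n) by exact: sqint_sum.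
have decomp n : \sum_(1 <= i < n.+1) (fW i - mean *: (1 : T -> R)) = V n + E n + a *: S n.
  rewrite /E /a scaler_suml -addrA -big_split /=.
  under [X in _ + X]eq_bigr => j _ do rewrite -scalerDr subrK scaler_sumr.
  rewrite exchange_big -big_split /=; apply: eq_bigr => i _.
  by rewrite YE subrK.
pose Z n : T -> R := (nrm n)^-1 *: (V n + E n + a *: S n).
have -> : (fun (n : nat) (w : T) => (\sum_(1 <= i < n.+1) (f (window X i p w) - mean)) /
    (n%:R `^ (1 - D / 2) * Num.sqrt (L n%:R))) = Z.
  apply/funext => n; apply/funext => w; rewrite /Z -decomp.
  rewrite -[RHS]/((nrm n)^-1 * _ w) fct_sumE mulrC; congr (_ * _).
  by apply: eq_bigr => i _; rewrite -[RHS]/(fW i w - mean * 1) mulr1.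
have [N rN] := regvar_pos u_slow.
(* For small n, L(n) may be negative and its [Num.sqrt] is then 0; the identity is claimed only
   where L is known to be positive. *)
have nrm2 n : (N < n)%N -> nrm n ^+ 2 = regvar u (2 - D) n.
  move=> Nn; have := rN 0 n (ltnW Nn).
  rewrite /regvar powRr0 mul1r => /ltW Ln.
  rewrite exprMn sqr_sqrtr// -powR_mulrn ?powR_ge0// -powRrM; congr (_ `^ _ * _).
  by field.
(* The sum a of the alpha_j may be 0: these variables then vanish and the limit law is the Dirac
   measure at 0. *)
pose Yn n : T -> R := (a / nrm n) *: S n.
have cYn n : lincomb X (Yn n) by apply: lincombZ; exact: partial_sum_lincomb.
have sZ n : sqint P (Z n).
  by apply: sqintZ; apply: sqintD; [exact: sqintD|exact: sqintZ].
apply: (@slutsky_gaussian R _ _ P Yn Z (fun n => dotp P (Yn n) (Yn n))) => //.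
- by move=> n; exact: (lincomb_sqint X_standard (cYn n)).
- by move=> n B mB; exact: (lincomb_law X_gaussian X_standard (cYn n)).
- by move=> n; exact: dotp_ge0.
- have c1 := @cvg_lag_variance R u D r u_slow D_lt1 rE (r 0%N).
  have c2 : (n%:R * r 0%N + 2 * \sum_(1 <= k < n.+1) (n%:R - k%:R) * r k) /
      regvar u (2 - D) n * a ^+ 2 @[n --> \oo] --> c_D * a ^+ 2.
    by apply: cvgM; [exact: c1|exact: cvg_cst].
  move: c2; apply: cvg_trans; apply: near_eq_cvg; exists N.+1 => // n /= Nn.
  rewrite dotpZl//; last exact: sqintZ.
  rewrite dotpZr// dotp_partial_sum// -nrm2// expr2 invfM.
  by rewrite -/r; ring.
(* Majorant of the squared distance from Z to Yn: the part with C comes from the Y_i, one factor n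
   being absorbed in passing from index 2 - D to 1 - D, and the part with CE from the edge terms. *)
have c3 : 2 * (C * ((regvar u (1 - D) n)^-1 +
    (\sum_(1 <= k < n.+1) r k ^+ 2) / regvar u (1 - D) n) + CE * (regvar u (2 - D) n)^-1)
    @[n --> \oo] --> 2 * (C * (0 + 0) + CE * 0).
  apply: cvgM; first exact: cvg_cst.
  apply: cvgD; apply: cvgM; [exact: cvg_cst| |exact: cvg_cst|].
  - apply: cvgD; first by apply: cvg_regvar_inv => //; rewrite subr_gt0.
    exact: (cvg_sum_sqr_corr u_slow D_gt0 D_lt1 rE).
  - by apply: cvg_regvar_inv => //; lra.
rewrite addr0 !mulr0 addr0 mulr0 in c3.
apply: (@squeeze_cvgr _ _ _ _ (cst 0) _ _ _ _ _ c3); last exact: cvg_cst.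
exists N.+1 => // n /= Nn; rewrite dotp_ge0 /=.
have n0 : (0 < n)%N by apply: leq_trans Nn.
have -> : Z n - Yn n = (nrm n)^-1 *: (V n + E n).
  by rewrite /Z /Yn scalerDr scalerA (mulrC _ a) addrK.
have sVE : sqint P (V n + E n) by exact: sqintD.
rewrite dotpZl//; last exact: sqintZ.
rewrite dotpZr// mulrA -invfM -expr2 nrm2//.
have rv : 0 < regvar u (2 - D) n by apply: rN; exact: ltnW.
have rvE : regvar u (2 - D) n = n%:R * regvar u (1 - D) n.
  by rewrite -regvarS//; congr regvar; ring.
apply: (@le_trans _ _ ((regvar u (2 - D) n)^-1 * (2 * (C * n%:R * (1 +
    \sum_(1 <= k < n.+1) r k ^+ 2) + CE)))).
  rewrite ler_wpM2l ?invr_ge0 ?(ltW rv)//.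
  apply: le_trans (dotp_sqrD_le (sV n) (sE n)) _.
  by rewrite ler_pM2l// lerD//; exact: CY.
have nR : n%:R != 0 :> R by rewrite pnatr_eq0 -lt0n.
have rv1 : regvar u (1 - D) n != 0.
  by move: rv; rewrite rvE; apply: contraTneq => ->; rewrite mulr0 ltxx.
rewrite rvE le_eqVlt; apply/orP; left; apply/eqP.
by move: (regvar u (1 - D) n) (\sum_(1 <= k < n.+1) _) rv1 => q s q0; field; rewrite q0 nR.
Qed.
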